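(* Let $\tilde f_0\colon(\mathbb{C},0)\to(\mathbb{C},0)$ be an antiholomorphic parabolic germ of codimension $1$, and let $\tilde f_\eta$ be a generic unfolding of $\tilde f_0$ depending on the real parameter $\eta$, with fixed points at $z^2=\eta$. Let $\varepsilon=\varepsilon(\eta)$ be its canonical parameter. Then there exists a mix analytic diffeomorphism $H\colon(\eta,z)\mapsto(\varepsilon,m_\eta(z))=(\varepsilon,z_1)$ that maps the family $\{\tilde f_\eta\}_\eta$ to a family in the prepared form $$f_\varepsilon(z_1)=\bar z_1+(\bar z_1^2-\varepsilon)\left[B_0(\varepsilon)+B_1(\varepsilon)\bar z_1+(\bar z_1^2-\varepsilon)Q(\varepsilon,\bar z_1)\right]$$ that satisfies 1. $B_0(0)=\frac12$, and $B_0$ and $B_1$ are real-valued; 2. the numbers $\tau_\pm:=\frac{\partial f_\varepsilon}{\partial\bar z_1}(\pm\sqrt\varepsilon)$ satisfy: $\tau_\pm\in\mathbb{R}$ if $\varepsilon>0$; $\tau_\pm=\overline{\tau_\mp}$ if $\varepsilon<0$; $\tau_\pm=1$ if $\varepsilon=0$; 3. $\lambda_\pm:=\frac{\partial g_\varepsilon}{\partial z_1}(\pm\sqrt\varepsilon)=\overline{\tau_\pm^2}$, where $g_\varepsilon:=f_\varepsilon\circ f_\varepsilon$.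
   Context: A function $f$ of one complex variable is antiholomorphic if $\partial f/\partial z\equiv0$. An antiholomorphic parabolic germ of codimension $1$ is a germ $f_0\colon(\mathbb{C},0)\to(\mathbb{C},0)$ of antiholomorphic diffeomorphism with $|\partial f_0/\partial\bar z(0)|=1$, for which $0$ is an isolated fixed point of multiplicity $2$. In a suitable holomorphic coordinate, always assumed chosen, $f_0(z)=\bar z+\frac12\bar z^2+(\frac14-\frac{b_0}{2})\bar z^3+o(\bar z^3)$ with $b_0\in\mathbb{R}$ (the formal invariant). A function $f(t,z)$ of $t\in\mathbb{R}^n$, $z\in\mathbb{C}^m$ is mix analytic (resp. mix anti-analytic) if near every point $(t^*,z^* )$ it is given by a convergent power series in $t-t^*$ and $z-z^*$ (resp. in $t-t^*$ and $\bar z-\bar z^*$). An unfolding of $f_0$ is a germ of mix anti-analytic diffeomorphism $(\mathbb{R},0)\times(\mathbb{C},0)\to(\mathbb{C},0)$, $(\eta,z)\mapsto f_\eta(z)=f_0(z)+\sum_{j\ge0}a_j(\eta)\bar z^j$, $a_j(0)=0$. It is generic if $\frac{d\,\mathrm{Re}(a_0)}{d\eta}(0)\neq0$. ''With fixed points at $z^2=\eta$'' means that the fixed points of $\tilde f_\eta$, when they exist ($\eta\ge0$), are $\pm\sqrt\eta$; for $\eta<0$ the points $\pm\sqrt\eta$ form an orbit of period $2$. With $\tilde g_\eta=\tilde f_\eta\circ\tilde f_\eta$, the canonical parameter of the family is $\varepsilon(\eta)=\left(\frac{1}{\log\tilde g_\eta'(\sqrt\eta)}-\frac{1}{\log\tilde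 g_\eta'(-\sqrt\eta)}\right)^{-2}$ (principal branch of $\log$), extended to $\eta=0$ by $\varepsilon(0)=0$; it is a real-valued real analytic function of $\eta$. ''$H$ maps $\{\tilde f_\eta\}$ to $\{f_\varepsilon\}$'' means $f_{\varepsilon(\eta)}=m_\eta\circ\tilde f_\eta\circ m_\eta^{-1}$. Here $B_0,B_1$ and the remainder $Q$ are analytic in their arguments. *)

(* Defs.v *)
From Stdlib Require Import Reals.
From Coquelicot Require Import Coquelicot.
Open Scope C_scope.

(* All germs are represented by total functions, and a statement about germs
   is required only eventually, in the sense of [locally], at the base point. *)
Definition origin : R * C := (0%R, RtoC 0).

(* The coefficients are grouped by total degree; the second clause makes the
   double series absolutely convergent on the closed polydisc of radius [r]. *)
Definition mix_analytic_at (F : R -> C -> C) (t0 : R) (z0 : C) : Prop :=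
  exists (a : nat -> nat -> C) (r : R),
    (0 < r)%R /\
    ex_series (fun n => sum_n (fun j => Cmod (a j (n - j)%nat) * r ^ n)%R n) /\
    forall (t : R) (z : C), (Rabs (t - t0) < r)%R -> (Cmod (z - z0) < r)%R ->
      is_series
        (fun n => sum_n
           (fun j => a j (n - j)%nat * RtoC (t - t0) ^ j * (z - z0) ^ (n - j)) n)
        (F t z).

Definition mix_analytic_germ (F : R -> C -> C) : Prop :=
  locally origin (fun p => mix_analytic_at F (fst p) (snd p)).

(* A power series in [t - t0] and [Cconj z - Cconj z0]. *)
Definition mix_antianalytic_at (F : R -> C -> C) (t0 : R) (z0 : C) : Prop :=
  mix_analytic_at (fun t w => F t (Cconj w)) t0 (Cconj z0).

Definition mix_antianalytic_germ (F : R -> C -> C) : Prop :=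
  locally origin (fun p => mix_antianalytic_at F (fst p) (snd p)).

Definition analytic_at (B : R -> C) (t0 : R) : Prop :=
  exists (a : nat -> C) (r : R),
    (0 < r)%R /\
    forall t : R, (Rabs (t - t0) < r)%R ->
      is_series (fun n => a n * RtoC (t - t0) ^ n) (B t).

Definition analytic_germ (B : R -> C) : Prop :=
  locally 0%R (fun t => analytic_at B t).

(* [H] is a germ of diffeomorphism of [(R * C, 0)] with inverse [G], both with
   components of the class [A], to be instantiated with [mix_analytic_germ]
   or [mix_antianalytic_germ]. *)
Definition germ_diffeo (A : (R -> C -> C) -> Prop) (H G : R * C -> R * C) : Prop :=
  (H origin = origin /\
   A (fun t z => RtoC (fst (H (t, z)))) /\ A (fun t z => snd (H (t, z)))) /\
  (G origin = origin /\
   A (fun t z => RtoC (fst (G (t, z)))) /\ A (fun t z => snd (G (t, z)))) /\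
  locally origin (fun p => G (H p) = p) /\
  locally origin (fun p => H (G p) = p).

(* Wirtinger derivatives, from the partial derivatives in [z = x + i y]. *)
Definition Cderive_x (f : C -> C) (z : C) : C :=
  (Derive (fun x => Re (f (x, Im z))) (Re z),
   Derive (fun x => Im (f (x, Im z))) (Re z)).

Definition Cderive_y (f : C -> C) (z : C) : C :=
  (Derive (fun y => Re (f (Re z, y))) (Im z),
   Derive (fun y => Im (f (Re z, y))) (Im z)).

Definition dz (f : C -> C) (z : C) : C :=
  (Cderive_x f z - Ci * Cderive_y f z) / 2.

Definition dzbar (f : C -> C) (z : C) : C :=
  (Cderive_x f z + Ci * Cderive_y f z) / 2.

Definition antiholomorphic_germ (f : C -> C) : Prop :=
  locally (RtoC 0) (fun z : C =>
    ex_filterdiff (U := C_R_NormedModule) (V := C_R_NormedModule) f (locally z) /\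
    dz f z = 0).

Definition antiholomorphic_diffeo (f : C -> C) : Prop :=
  f 0 = 0 /\ antiholomorphic_germ f /\
  exists h : C -> C,
    h 0 = 0 /\ antiholomorphic_germ h /\
    locally (RtoC 0) (fun z : C => h (f z) = z) /\
    locally (RtoC 0) (fun z : C => f (h z) = z).

(* The multiplicity of [0] as a fixed point of the antiholomorphic germ [f] is
   its multiplicity as a fixed point of the holomorphic germ [f o f], i.e. the
   order of vanishing of [f (f z) - z]; this is also the intersection
   multiplicity at [0] of the complexified equations [f z = z] and
   [Cconj (f z) = Cconj z] in the independent variables [z] and [Cconj z]. *)
Definition fixed_point_multiplicity_two (f : C -> C) : Prop :=
  exists c : C, c <> 0 /\
    is_domin (locally (RtoC 0)) (fun z : C => z ^ 2)
      (fun z : C => f (f z) - z - c * z ^ 2).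

(* The last clause is the normalization of the holomorphic coordinate, [b0]
   being the formal invariant. *)
Definition parabolic_codim_one (f : C -> C) : Prop :=
  antiholomorphic_diffeo f /\
  Cmod (dzbar f 0) = 1%R /\
  locally (RtoC 0) (fun z : C => f z = z -> z = 0) /\
  fixed_point_multiplicity_two f /\
  exists b0 : R,
    is_domin (locally (RtoC 0)) (fun z : C => Cconj z ^ 3)
      (fun z : C =>
         f z - (Cconj z + 1 / 2 * Cconj z ^ 2
                + (1 / 4 - RtoC b0 / 2) * Cconj z ^ 3)).

(* The mix anti-analytic diffeomorphism [(eta, z) |-> f_eta z] with values in
   [(C, 0)] is a family of diffeomorphisms in [z], that is, the fibered map
   [(eta, z) |-> (eta, f_eta z)] is a diffeomorphism. *)
Definition unfolding (f0 : C -> C) (a : nat -> R -> C) (f : R -> C -> C) : Prop :=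
  (exists G, germ_diffeo mix_antianalytic_germ
               (fun p => (fst p, f (fst p) (snd p))) G) /\
  (forall j, a j 0%R = 0) /\
  locally origin (fun p =>
    is_series (fun j => a j (fst p) * Cconj (snd p) ^ j)
      (f (fst p) (snd p) - f0 (snd p))).

Definition generic (a : nat -> R -> C) : Prop :=
  Derive (fun eta => Re (a 0%nat eta)) 0 <> 0%R.

(* Principal square root of a real number: [i * sqrt (-t)] when [t < 0]. *)
Definition csqrt (t : R) : C :=
  if Rle_dec 0 t then (sqrt t, 0%R) else (0%R, sqrt (- t)).

Definition fixed_points_sq (f : R -> C -> C) : Prop :=
  locally origin (fun p : R * C =>
    ((0 <= fst p)%R ->
       (f (fst p) (snd p) = snd p <->
        snd p = csqrt (fst p) \/ snd p = - csqrt (fst p))) /\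
    ((fst p < 0)%R -> f (fst p) (snd p) <> snd p)) /\
  locally 0%R (fun eta =>
    (eta < 0)%R ->
      f eta (csqrt eta) = - csqrt eta /\ f eta (- csqrt eta) = csqrt eta).

Definition Carg (z : C) : R :=
  if Rle_dec 0 (Im z) then acos (Re z / Cmod z) else (- acos (Re z / Cmod z))%R.

(* Principal branch, with argument in [(-PI, PI]]. *)
Definition Clog (z : C) : C := (ln (Cmod z), Carg z).

Definition canonical_parameter (f : R -> C -> C) (eta : R) : C :=
  if Req_dec_T eta 0 then 0
  else
    let g := fun z => f eta (f eta z) in
    / ((/ Clog (C_derive g (csqrt eta)) - / Clog (C_derive g (- csqrt eta))) ^ 2).

Definition prepared_form (f : R -> C -> C) (B0 B1 : R -> C) (Q : R -> C -> C) : Prop :=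
  analytic_germ B0 /\ analytic_germ B1 /\ mix_analytic_germ Q /\
  locally origin (fun p : R * C =>
    let eps := fst p in
    let w := Cconj (snd p) in
    f eps (snd p) =
      w + (w ^ 2 - RtoC eps)
          * (B0 eps + B1 eps * w + (w ^ 2 - RtoC eps) * Q eps w)).

(* [f_(eps eta) = m_eta o ft_eta o m_eta^(-1)], where [G] is the inverse of
   [(eta, z) |-> (eps eta, m_eta z)], so that
   [m_eta^(-1) z1] is the second component of [G (eps eta, z1)]. *)
Definition maps_family (eps : R -> R) (m : R -> C -> C) (G : R * C -> R * C)
    (ft f : R -> C -> C) : Prop :=
  locally origin (fun p : R * C =>
    let eta := fst p in
    let z1 := snd p in
    f (eps eta) z1 = m eta (ft eta (snd (G (eps eta, z1))))).

(* Main.v *)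
Require Import Defs.
From Stdlib Require Import Reals Lra Lia List Permutation Cantor Arith.
From Stdlib Require Import ClassicalEpsilon FunctionalExtensionality.
From Coquelicot Require Import Coquelicot.
Open Scope C_scope.
Set Bullet Behavior "Strict Subproofs".

(** An antiholomorphic family is written f_eta(z) = F(eta, conj z) with F
    analytic. The fixed points (eta > 0) and the orbit of period two (eta < 0)
    are both expressed by the single equation F(eta, s) = s on the curve s^2 =
    eta, so that F(eta, w) = w + (w^2 - eta) K(eta, w), and the coefficient
    1/2 of the parabolic germ gives K(0,0) = 1/2. Everything that has to be
    normalised lives on the curve: it is a function of s, and parity in s
    turns a function of s into a pair of functions of eta = s^2.

    With l(s) = 1 + 2 s K(s^2, s), the derivative of F at w = s, the
    derivative of the second iterate at s is l(s) conj(l(conj s)) for both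
    signs of eta. Its logarithm is s (P + s Q) with P, Q real analytic in eta
    = s^2 and P(0) = 2, hence the canonical parameter equals eta e(eta)^2 with
    e = (P^2 - eta Q^2) / (2 P), which is real analytic with e(0) = 1: it is a
    change of parameter, and the linear map z -> e z carries the curve z^2 =
    eta to the curve z^2 = eps (canonical_data).

    A real scaling does not make the multipliers of f real. A change of
    coordinate with derivative u(s) at s multiplies l(s) by u(s) / conj(u(conj
    s)); taking for u(s) the square root of conj(l(conj s)), the new
    multiplier is u(s) conj(u(conj s)), which is conjugation invariant. One
    has u(s) = 1 + 2 s v(s) with v analytic, and splitting v into its even and
    odd parts yields the coordinate z -> z + (z^2 - eta) (v_0(eta) + z
    v_1(eta)) that fixes the curve and has derivative u(s) on it (angle_data,
    shear). The conjugated family fixes its curve again, hence has the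
    required form, and comparing derivatives along the curve
    (multiplier_relation) expresses B_0 and B_1 by the real even and odd parts
    of the new multiplier. The assertions on tau and lambda are then algebra
    with real B_0 and B_1.

    The analytic tools are obtained from one notion, expands: a function of
    two complex variables is the sum of a sequence of monomials, repetitions
    being permitted, whose weighted sum of moduli is bounded. The bound
    behaves like a norm for which products, infinite sums and compositions are
    estimated term by term (rep_sum, rep_comp), and a contraction argument
    gives the implicit function theorem (implicit_function). This one theorem
    provides the inverse of the parameter, the inverse of the coordinate, the
    square root above and the reciprocal of a unit. *)

(** * Sums over lists and double series *)

Definition lsum {A : Type} {G : AbelianMonoid} (f : A -> G) (l : list A) : G :=
  fold_right (fun a s => plus (f a) s) zero l.

Lemma lsum_app {A : Type} {G : AbelianMonoid} (f : A -> G) (l1 l2 : list A) :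
  lsum f (l1 ++ l2) = plus (lsum f l1) (lsum f l2).
Proof.
  induction l1 as [|a l1 IH]; simpl.
  - now rewrite plus_zero_l.
  - now rewrite IH, plus_assoc.
Qed.

Lemma lsum_perm {A : Type} {G : AbelianMonoid} (f : A -> G) (l1 l2 : list A) :
  Permutation l1 l2 -> lsum f l1 = lsum f l2.
Proof.
  induction 1; simpl; try congruence.
  rewrite !plus_assoc. now rewrite (plus_comm (f y)).
Qed.

Lemma lsum_map {A B : Type} {G : AbelianMonoid} (f : B -> G) (h : A -> B) (l : list A) :
  lsum f (map h l) = lsum (fun a => f (h a)) l.
Proof. induction l; simpl; congruence. Qed.

Lemma lsum_ext {A : Type} {G : AbelianMonoid} (f g : A -> G) (l : list A) :
  (forall a, f a = g a) -> lsum f l = lsum g l.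
Proof. intros E. induction l; simpl; congruence. Qed.

Lemma lsum_seq {G : AbelianMonoid} (f : nat -> G) (N : nat) :
  lsum f (seq 0 (S N)) = sum_n f N.
Proof.
  induction N as [|N IH].
  - simpl. now rewrite sum_O, plus_zero_r.
  - rewrite seq_S, lsum_app, IH, sum_Sn. simpl. now rewrite plus_zero_r.
Qed.

Lemma lsum_box {G : AbelianMonoid} (u : nat -> nat -> G) (N M : nat) :
  lsum (fun p => u (fst p) (snd p)) (list_prod (seq 0 (S M)) (seq 0 (S N)))
  = sum_n (fun m => sum_n (u m) N) M.
Proof.
  rewrite <- lsum_seq. induction (seq 0 (S M)) as [|m l IH]; [reflexivity|].
  change (list_prod (m :: l) (seq 0 (S N)))
    with (map (fun y => (m, y)) (seq 0 (S N)) ++ list_prod l (seq 0 (S N))).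
  rewrite lsum_app, IH, lsum_map. simpl (lsum _ (m :: l)).
  now rewrite <- (lsum_seq (u m) N).
Qed.

Lemma norm_lsum {A : Type} {K : AbsRing} {V : NormedModule K} (f : A -> V) (l : list A) :
  (norm (lsum f l) <= lsum (fun a => norm (f a)) l)%R.
Proof.
  induction l as [|a l IH]; simpl.
  - rewrite norm_zero. apply Rle_refl.
  - eapply Rle_trans; [apply norm_triangle|]. apply Rplus_le_compat_l, IH.
Qed.

Lemma lsum_nonneg {A : Type} (f : A -> R) (l : list A) :
  (forall a, (0 <= f a)%R) -> (0 <= lsum f l)%R.
Proof.
  intros H. induction l as [|a l IH]; simpl; [apply Rle_refl|].
  now apply Rplus_le_le_0_compat.
Qed.

(** This replaces all comparisons of finite partial sums in the rearrangement
    arguments: a sum over an included list is a part of the larger sum. *)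
Lemma NoDup_incl_split {A : Type} (l1 l2 : list A) :
  NoDup l1 -> incl l1 l2 -> exists r, Permutation l2 (l1 ++ r).
Proof.
  revert l2. induction l1 as [|a l1 IH]; intros l2 N I.
  - exists l2. apply Permutation_refl.
  - inversion N as [|? ? Na N1]; subst.
    destruct (in_split a l2 (I a (or_introl eq_refl))) as (x & y & ->).
    destruct (IH (x ++ y) N1) as [r Hr].
    + intros b Hb. assert (Hb2 := I b (or_intror Hb)).
      apply in_app_iff in Hb2. apply in_app_iff.
      destruct Hb2 as [Hb2|[Hb2|Hb2]]; auto. subst. contradiction.
    + exists r. transitivity (a :: x ++ y).
      * symmetry. apply Permutation_middle.
      * simpl. now constructor.
Qed.

Lemma NoDup_list_prod {A B : Type} (l1 : list A) (l2 : list B) :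
  NoDup l1 -> NoDup l2 -> NoDup (list_prod l1 l2).
Proof.
  induction 1 as [|a l1 Ha N1 IH]; intros N2; simpl; [constructor|].
  apply NoDup_app.
  - apply NoDup_map_NoDup_ForallPairs; [|assumption].
    intros x y _ _ E. congruence.
  - now apply IH.
  - intros [a' b] H1 H2. apply in_map_iff in H1. destruct H1 as (? & E & _).
    apply in_prod_iff in H2. inversion E; subst. tauto.
Qed.

Lemma sum_n_bounded_ex_series (a : nat -> R) (M : R) :
  (forall n, (0 <= a n)%R) -> (forall N, (sum_n a N <= M)%R) -> ex_series a.
Proof.
  intros Ha HM. destruct (ex_finite_lim_seq_incr (sum_n a) M) as [l Hl].
  - intros n. rewrite sum_Sn. unfold plus; simpl. specialize (Ha (S n)). lra.
  - exact HM.
  - exists l. exact Hl.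
Qed.

Lemma is_series_bound_le (a : nat -> R) (l M : R) :
  is_series a l -> (forall N, (sum_n a N <= M)%R) -> (l <= M)%R.
Proof.
  intros H HM.
  apply (filterlim_le (F := eventually) (sum_n a) (fun _ => M) (Finite l) (Finite M)).
  - exists 0%nat. intros n _. apply HM.
  - exact H.
  - apply filterlim_const.
Qed.

Lemma sum_n_nonneg_incr (a : nat -> R) (n m : nat) :
  (forall n, (0 <= a n)%R) -> (n <= m)%nat -> (sum_n a n <= sum_n a m)%R.
Proof.
  intros Ha H. induction H as [|m H IH]; [apply Rle_refl|].
  rewrite sum_Sn. unfold plus; simpl. specialize (Ha (S m)). lra.
Qed.

Lemma sum_n_le_is_series (a : nat -> R) (l : R) (N : nat) :
  (forall n, (0 <= a n)%R) -> is_series a l -> (sum_n a N <= l)%R.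
Proof.
  intros Ha H.
  apply (filterlim_le (F := eventually) (fun _ => sum_n a N) (sum_n a) (Finite (sum_n a N)) (Finite l)).
  - exists N. intros n Hn. now apply sum_n_nonneg_incr.
  - apply filterlim_const.
  - exact H.
Qed.

Lemma is_series_C_eps (a : nat -> C) (l : C) :
  is_series a l <->
  forall eps : R, (0 < eps)%R ->
    exists N, forall n, (N <= n)%nat -> (Cmod (sum_n a n - l) < eps)%R.
Proof.
  unfold is_series. split.
  - intros H eps Heps.
    assert (L := proj1 (filterlim_locally_ball_norm (K := C_AbsRing) (U := C_NormedModule) (sum_n a) l) H (mkposreal eps Heps)).
    destruct L as [N HN]. exists N. intros n Hn. apply (HN n Hn).
  - intros H.
    apply (proj2 (filterlim_locally_ball_norm (K := C_AbsRing) (U := C_NormedModule) (sum_n a) l)).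
    intros [eps Heps]. destruct (H eps Heps) as [N HN]. exists N. exact HN.
Qed.

Lemma C_ex_series (a : nat -> C) (M : R) :
  (forall N, (sum_n (fun n => Cmod (a n)) N <= M)%R) -> exists l, is_series a l.
Proof.
  intros HM.
  destruct (ex_series_le (K := C_AbsRing) (V := C_CompleteNormedModule) a (fun n => Cmod (a n))) as [l Hl].
  - intros n. apply Rle_refl.
  - apply (sum_n_bounded_ex_series _ M); auto. intros n. apply Cmod_ge_0.
  - exists l. exact Hl.
Qed.

Lemma Cmod_series_le (a : nat -> C) (l : C) (M : R) :
  is_series a l -> (forall N, (sum_n (fun n => Cmod (a n)) N <= M)%R) -> (Cmod l <= M)%R.
Proof.
  intros H HM. apply le_epsilon. intros eps Heps.
  destruct (proj1 (is_series_C_eps a l) H eps Heps) as [N HN].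
  specialize (HN N (Nat.le_refl N)).
  assert (T := norm_sum_n_m (K := C_AbsRing) (V := C_NormedModule) a 0 N).
  change (Cmod (sum_n a N) <= sum_n (fun n => Cmod (a n)) N)%R in T.
  specialize (HM N).
  assert (E : l = sum_n a N - (sum_n a N - l)) by ring.
  assert (T2 := Cmod_triangle (sum_n a N) (- (sum_n a N - l))).
  rewrite Cmod_opp in T2. unfold Cminus in E at 1. rewrite <- E in T2. lra.
Qed.

Lemma C_series_unique (a : nat -> C) (l l' : C) :
  is_series a l -> is_series a l' -> l = l'.
Proof.
  intros H H'. exact (filterlim_locally_unique (K := C_AbsRing) (V := C_NormedModule) (sum_n a) l l' H H').
Qed.

Lemma Cmod_dist_plus (a b c d : C) :
  (Cmod (plus a b - plus c d) <= Cmod (a - c) + Cmod (b - d))%R.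
Proof.
  change (Cmod ((a + b) - (c + d)) <= Cmod (a - c) + Cmod (b - d))%R.
  replace ((a + b) - (c + d)) with ((a - c) + (b - d)) by ring.
  apply Cmod_triangle.
Qed.

Lemma Cmod_dist_chain (a b c d : C) :
  (Cmod (a - d) <= Cmod (b - a) + Cmod (b - c) + Cmod (c - d))%R.
Proof.
  replace (a - d) with (- (b - a) + ((b - c) + (c - d))) by ring.
  eapply Rle_trans; [apply Cmod_triangle|]. rewrite Cmod_opp.
  assert (H := Cmod_triangle (b - c) (c - d)). lra.
Qed.

Section Double.
Variables (u : nat -> nat -> C) (M : nat -> R) (Mt : R).
Hypothesis rowbound : forall m N, (sum_n (fun n => Cmod (u m n)) N <= M m)%R.
Hypothesis totbound : forall N, (sum_n M N <= Mt)%R.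

Let v (k : nat) : C := u (fst (of_nat k)) (snd (of_nat k)).

(** Any finite set of indices lies in a square box, whose sum is bounded row
    by row. *)
Lemma finite_bound (l : list nat) : NoDup l -> (lsum (fun k => Cmod (v k)) l <= Mt)%R.
Proof.
  intros Nl.
  assert (exists N, forall k, In k l -> (fst (of_nat k) <= N /\ snd (of_nat k) <= N)%nat) as [N HN].
  { clear Nl. induction l as [|k l [N IH]]; [exists 0%nat; simpl; tauto|].
    exists (N + fst (of_nat k) + snd (of_nat k))%nat. simpl. intros k' [->|Hk]; [lia|].
    specialize (IH k' Hk). lia. }
  destruct (NoDup_incl_split (map of_nat l) (list_prod (seq 0 (S N)) (seq 0 (S N)))) as [r Hr].
  - apply NoDup_map_NoDup_ForallPairs; [|assumption].
    intros x y _ _ E. rewrite <- (cancel_to_of x), <- (cancel_to_of y). now f_equal.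
  - intros p Hp. apply in_map_iff in Hp. destruct Hp as (k & <- & Hk).
    specialize (HN k Hk). destruct (of_nat k) as [m n]. simpl in HN.
    apply in_prod; apply in_seq; lia.
  - assert (E := lsum_perm (fun p => Cmod (u (fst p) (snd p))) _ _ Hr).
    rewrite (lsum_box (fun m n => Cmod (u m n)) N N), lsum_app, lsum_map in E.
    assert (P := lsum_nonneg (fun p => Cmod (u (fst p) (snd p))) r (fun p => Cmod_ge_0 _)).
    change (@plus R_AbelianMonoid) with Rplus in E.
    assert (B : (sum_n (fun m => sum_n (fun n => Cmod (u m n)) N) N <= Mt)%R).
    { eapply Rle_trans; [|apply (totbound N)]. apply sum_n_m_le. intros m. apply rowbound. }
    change (fun k => Cmod (v k)) with (fun a => Cmod (u (fst (of_nat a)) (snd (of_nat a)))).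
    lra.
Qed.

Lemma double_series_abs (K : nat) : (sum_n (fun k => Cmod (v k)) K <= Mt)%R.
Proof. rewrite <- lsum_seq. apply finite_bound, seq_NoDup. Qed.

(** The box sums and the partial sums along the diagonal enumeration differ
    only by terms of index greater than K, whose total modulus is the tail of
    a convergent series; letting first the width and then the height of the
    box grow identifies the iterated sum with the sum of the enumerated
    series. *)
Lemma double_series (s : nat -> C) :
  (forall m, is_series (u m) (s m)) -> exists T, is_series v T /\ is_series s T.
Proof.
  intros Hs.
  destruct (C_ex_series v Mt double_series_abs) as [T HT].
  exists T. split; [exact HT|].
  destruct (sum_n_bounded_ex_series (fun k => Cmod (v k)) Mt (fun k => Cmod_ge_0 _) double_series_abs) as [A HA].
  (* Boxes containing the first K terms are close to the K-th partial sum. *)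
  assert (box : forall K M0 N0, (forall k, (k <= K)%nat -> (fst (of_nat k) <= M0 /\ snd (of_nat k) <= N0)%nat) ->
     (Cmod (sum_n (fun m => sum_n (u m) N0) M0 - sum_n v K) <= A - sum_n (fun k => Cmod (v k)) K)%R).
  { intros K M0 N0 HK.
    set (B := list_prod (seq 0 (S M0)) (seq 0 (S N0))).
    assert (NB : NoDup (map to_nat B)).
    { apply NoDup_map_NoDup_ForallPairs.
      - intros x y _ _ E. rewrite <- (cancel_of_to x), <- (cancel_of_to y). now f_equal.
      - apply NoDup_list_prod; apply seq_NoDup. }
    destruct (NoDup_incl_split (seq 0 (S K)) (map to_nat B)) as [r Hr].
    - apply seq_NoDup.
    - intros k Hk. apply in_seq in Hk. apply in_map_iff. exists (of_nat k).
      split; [apply cancel_to_of|]. specialize (HK k ltac:(lia)).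
      destruct (of_nat k) as [m n]; simpl in HK. apply in_prod; apply in_seq; lia.
    - assert (E := lsum_perm v _ _ Hr). rewrite lsum_app, lsum_seq, lsum_map in E.
      assert (E2 := lsum_perm (fun k => Cmod (v k)) _ _ Hr). rewrite lsum_app, lsum_seq in E2.
      rewrite (lsum_ext _ (fun p => u (fst p) (snd p))) in E
        by (intros p; unfold v; now rewrite cancel_of_to).
      unfold B in E. rewrite lsum_box in E. rewrite E.
      assert (Ep : forall x y : C, plus x y - x = y) by (intros x y; unfold plus; simpl; ring).
      rewrite Ep.
      eapply Rle_trans; [exact (norm_lsum (K := C_AbsRing) (V := C_NormedModule) v r)|].
      change (lsum (fun a => norm (v a)) r) with (lsum (fun k => Cmod (v k)) r).
      assert (Q : (lsum (fun k => Cmod (v k)) (map to_nat B) <= A)%R).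
      { destruct (NoDup_incl_split (map to_nat B) (seq 0 (S (list_max (map to_nat B))))) as [r' Hr'].
        - exact NB.
        - intros k Hk. apply in_seq. assert (L := proj1 (list_max_le (map to_nat B) _) (Nat.le_refl _)).
          rewrite Forall_forall in L. specialize (L k Hk). lia.
        - assert (E3 := lsum_perm (fun k => Cmod (v k)) _ _ Hr'). rewrite lsum_app, lsum_seq in E3.
          assert (P := lsum_nonneg (fun p => Cmod (v p)) r' (fun p => Cmod_ge_0 _)).
          assert (P2 := sum_n_le_is_series _ A (list_max (map to_nat B)) (fun k => Cmod_ge_0 (v k)) HA).
          change (@plus R_AbelianMonoid) with Rplus in E3. lra. }
      change (@plus R_AbelianMonoid) with Rplus in E2. unfold B in Q. fold B in Q. lra. }
  apply is_series_C_eps. intros eps Heps.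
  assert (exists K, (A - sum_n (fun k => Cmod (v k)) K < eps / 4)%R /\ (Cmod (sum_n v K - T) < eps / 4)%R) as (K & HK1 & HK2).
  { destruct (proj1 (is_series_C_eps v T) HT (eps / 4)%R ltac:(lra)) as [N1 HN1].
    assert (HA' : is_lim_seq (sum_n (fun k => Cmod (v k))) A) by exact HA.
      apply is_lim_seq_spec in HA'. destruct (HA' (mkposreal (eps / 4) ltac:(lra))) as [N2 HN2].
    exists (N1 + N2)%nat. split.
    - specialize (HN2 (N1 + N2)%nat ltac:(lia)). simpl in HN2. apply Rabs_def2 in HN2. lra.
    - apply HN1. lia. }
  assert (exists N, forall k, (k <= K)%nat -> (fst (of_nat k) <= N /\ snd (of_nat k) <= N)%nat) as [N HN].
  { clear. induction K as [|K [N IH]].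
    - exists (fst (of_nat 0) + snd (of_nat 0))%nat. intros k Hk. replace k with 0%nat by lia. lia.
    - exists (N + fst (of_nat (S K)) + snd (of_nat (S K)))%nat. intros k Hk.
      destruct (Nat.eq_dec k (S K)) as [->|]; [lia|]. specialize (IH k ltac:(lia)). lia. }
  exists N. intros M0 HM0.
  (* For a fixed height, the box sum tends to the sum of the rows as its width
     grows. *)
  assert (L : forall e, (0 < e)%R -> exists N1, forall n, (N1 <= n)%nat ->
     (Cmod (sum_n (fun m => sum_n (u m) n) M0 - sum_n s M0) < e)%R).
  { clear - Hs. induction M0 as [|M0 IH]; intros e He.
    - destruct (proj1 (is_series_C_eps _ _) (Hs 0%nat) e He) as [N1 HN1].
      exists N1. intros n Hn. rewrite !sum_O. now apply HN1.
    - destruct (proj1 (is_series_C_eps _ _) (Hs (S M0)) (e/2)%R ltac:(lra)) as [N1 HN1].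
      destruct (IH (e/2)%R ltac:(lra)) as [N2 HN2].
      exists (N1 + N2)%nat. intros n Hn. rewrite !sum_Sn.
      specialize (HN1 n ltac:(lia)). specialize (HN2 n ltac:(lia)).
      eapply Rle_lt_trans; [apply Cmod_dist_plus|]. lra. }
  destruct (L (eps / 4)%R ltac:(lra)) as [N1 HN1].
  specialize (HN1 (N + N1)%nat ltac:(lia)).
  assert (Bx := box K M0 (N + N1)%nat).
  assert (Bx2 := Bx ltac:(intros k Hk; specialize (HN k Hk); lia)).
  set (X := sum_n (fun m => sum_n (u m) (N + N1)%nat) M0) in *.
  assert (T1 := Cmod_dist_chain (sum_n s M0) X (sum_n v K) T). lra.
Qed.
End Double.

(** * Absolutely convergent monomial expansions *)

Definition term : Type := (C * (nat * nat))%type.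
Definition tval (w : term) (t z : C) : C := fst w * (t ^ fst (snd w) * z ^ snd (snd w)).
Definition tnorm (w : term) (r : R) : R := (Cmod (fst w) * (r ^ fst (snd w) * r ^ snd (snd w)))%R.

Definition expansion (r M : R) (w : nat -> term) (F : C -> C -> C) : Prop :=
  (forall N, (sum_n (fun n => tnorm (w n) r) N <= M)%R) /\
  forall t z, (Cmod t <= r)%R -> (Cmod z <= r)%R ->
    is_series (fun n => tval (w n) t z) (F t z).

(** Exponents may be repeated, so that an expansion is not unique. This costs
    nothing, as no argument compares coefficients, and it makes sums,
    quotients by a coordinate and parity splitting immediate: one acts on each
    monomial separately. The bound M plays the part of a weighted norm. *)
Definition expands (r M : R) (F : C -> C -> C) : Prop :=
  (0 < r)%R /\ exists w, expansion r M w F.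

Lemma tnorm_pos (w : term) (r : R) : (0 <= r)%R -> (0 <= tnorm w r)%R.
Proof.
  intros H. unfold tnorm. apply Rmult_le_pos; [apply Cmod_ge_0|].
  apply Rmult_le_pos; now apply pow_le.
Qed.

Lemma tval_tnorm (w : term) (r : R) (t z : C) :
  (Cmod t <= r)%R -> (Cmod z <= r)%R -> (Cmod (tval w t z) <= tnorm w r)%R.
Proof.
  intros Ht Hz. unfold tval, tnorm. rewrite !Cmod_mult, !Cmod_pow.
  apply Rmult_le_compat_l; [apply Cmod_ge_0|].
  apply Rmult_le_compat.
  1,2: apply pow_le, Cmod_ge_0.
  all: apply pow_incr; split; [apply Cmod_ge_0|assumption].
Qed.

Lemma sum_n_le (a b : nat -> R) (N : nat) :
  (forall n, (a n <= b n)%R) -> (sum_n a N <= sum_n b N)%R.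
Proof. intros H. now apply sum_n_m_le. Qed.

Lemma sum_half_pow (n : nat) : sum_n (fun n => (/ 2) ^ n)%R n = (2 - (/ 2) ^ n)%R.
Proof.
  induction n as [|n IH]; [rewrite sum_O; simpl; lra|].
  rewrite sum_Sn, IH. change (@plus R_AbelianMonoid) with Rplus.
  change (2 - (/ 2) ^ n + (/2 * (/ 2) ^ n) = 2 - (/ 2 * (/ 2) ^ n))%R. lra.
Qed.

Lemma rep_make (r M : R) (w : nat -> term) :
  (0 < r)%R -> (forall N, (sum_n (fun n => tnorm (w n) r) N <= M)%R) ->
  exists F, expansion r M w F.
Proof.
  intros Hr HM.
  assert (E : forall p : C * C, exists l, (Cmod (fst p) <= r)%R -> (Cmod (snd p) <= r)%R ->
     is_series (fun n => tval (w n) (fst p) (snd p)) l).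
  { intros [t z]; simpl.
    destruct (Rle_dec (Cmod t) r) as [Ht|Ht]; [|exists 0; tauto].
    destruct (Rle_dec (Cmod z) r) as [Hz|Hz]; [|exists 0; tauto].
    destruct (C_ex_series (fun n => tval (w n) t z) M) as [l Hl]; [|now exists l].
    intros N. eapply Rle_trans; [|apply (HM N)]. apply sum_n_le.
    intros n. now apply tval_tnorm. }
  exists (fun t z => proj1_sig (constructive_indefinite_description _ (E (t, z)))).
  split; [exact HM|]. intros t z Ht Hz.
  destruct (constructive_indefinite_description _ (E (t, z))) as [l Hl]. now apply Hl.
Qed.

Lemma rep_M_pos (r M : R) (F : C -> C -> C) : expands r M F -> (0 <= M)%R.
Proof.
  intros (Hr & w & H & _). specialize (H 0%nat). rewrite sum_O in H.
  assert (T := tnorm_pos (w 0%nat) r ltac:(lra)). lra.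
Qed.

Lemma rep_r_pos (r M : R) (F : C -> C -> C) : expands r M F -> (0 < r)%R.
Proof. now intros [H _]. Qed.

Lemma rep_bound (r M : R) (F : C -> C -> C) (t z : C) :
  expands r M F -> (Cmod t <= r)%R -> (Cmod z <= r)%R -> (Cmod (F t z) <= M)%R.
Proof.
  intros (Hr & w & HM & H) Ht Hz. apply (Cmod_series_le _ _ M (H t z Ht Hz)).
  intros N. eapply Rle_trans; [|apply (HM N)]. apply sum_n_le.
  intros n. now apply tval_tnorm.
Qed.

Lemma rep_ext (r M : R) (F G : C -> C -> C) :
  expands r M F ->
  (forall t z, (Cmod t <= r)%R -> (Cmod z <= r)%R -> F t z = G t z) -> expands r M G.
Proof.
  intros (Hr & w & HM & H) E. split; [exact Hr|]. exists w. split; [exact HM|].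
  intros t z Ht Hz. rewrite <- E by assumption. now apply H.
Qed.

Lemma rep_le (r M r' M' : R) (F : C -> C -> C) :
  expands r M F -> (0 < r')%R -> (r' <= r)%R -> (M <= M')%R -> expands r' M' F.
Proof.
  intros (Hr & w & HM & H) H0 Hr' HM'. split; [exact H0|]. exists w. split.
  - intros N. eapply Rle_trans; [|exact HM']. eapply Rle_trans; [|apply (HM N)].
    apply sum_n_le. intros n. unfold tnorm.
    apply Rmult_le_compat_l; [apply Cmod_ge_0|].
    apply Rmult_le_compat.
    1,2: apply pow_le; lra.
    all: apply pow_incr; lra.
  - intros t z Ht Hz. apply H; lra.
Qed.

Lemma sum_n_single {G : AbelianMonoid} (a : nat -> G) (N : nat) :
  (forall n, a (S n) = zero) -> sum_n a N = a 0%nat.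
Proof.
  intros H. induction N as [|N IH]; [now rewrite sum_O|].
  now rewrite sum_Sn, IH, H, plus_zero_r.
Qed.

Lemma is_series_eventually (a : nat -> C) (l : C) (N : nat) :
  (forall n, (N <= n)%nat -> sum_n a n = l) -> is_series a l.
Proof.
  intros H. apply is_series_C_eps. intros eps Heps. exists N. intros n Hn.
  rewrite H by assumption. replace (l - l) with (RtoC 0) by ring. now rewrite Cmod_0.
Qed.

Lemma rep_monomial (r : R) (c : C) (j k : nat) : (0 < r)%R ->
  expands r (Cmod c * (r ^ j * r ^ k))%R (fun t z => c * (t ^ j * z ^ k)).
Proof.
  intros Hr. split; [exact Hr|].
  exists (fun n => match n with O => (c, (j, k)) | _ => (RtoC 0, (j, k)) end). split.
  - intros N. rewrite sum_n_single; [apply Rle_refl|].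
    intros n. unfold tnorm; simpl. now rewrite Cmod_0, Rmult_0_l.
  - intros t z _ _. apply (is_series_eventually _ _ 0). intros n _.
    rewrite sum_n_single; [reflexivity|]. intros m. unfold tval; simpl.
    unfold zero; simpl. apply Cmult_0_l.
Qed.

(** All closure properties come from this one: the expansions of the summands,
    taken together, are an expansion of the sum. *)
Lemma rep_sum (r : R) (M : nat -> R) (Mt : R) (F : nat -> C -> C -> C) (G : C -> C -> C) :
  (forall m, expands r (M m) (F m)) -> (forall N, (sum_n M N <= Mt)%R) ->
  (forall t z, (Cmod t <= r)%R -> (Cmod z <= r)%R -> is_series (fun m => F m t z) (G t z)) ->
  expands r Mt G.
Proof.
  intros HF HM HG. assert (Hr := rep_r_pos _ _ _ (HF 0%nat)).
  assert (HF' : forall m, exists w, expansion r (M m) w (F m)) by (intros m; apply (HF m)).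
  set (w := fun m => proj1_sig (constructive_indefinite_description _ (HF' m))).
  assert (Hw : forall m, expansion r (M m) (w m) (F m))
    by (intros m; exact (proj2_sig (constructive_indefinite_description _ (HF' m)))).
  split; [exact Hr|].
  exists (fun k => w (fst (of_nat k)) (snd (of_nat k))). split.
  - intros N.
    assert (D := double_series_abs (fun m n => RtoC (tnorm (w m n) r)) M Mt).
    eapply Rle_trans; [|apply D with (K := N)].
    + apply sum_n_le. intros n. rewrite Cmod_R. apply Rle_abs.
    + intros m N'. eapply Rle_trans; [|apply (proj1 (Hw m) N')]. apply sum_n_le.
      intros n. rewrite Cmod_R, Rabs_pos_eq; [apply Rle_refl|]. apply tnorm_pos; lra.
    + exact HM.
  - intros t z Ht Hz.
    destruct (double_series (fun m n => tval (w m n) t z) M Mt) with (s := fun m => F m t z)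
      as (T & HT & HS).
    + intros m N'. eapply Rle_trans; [|apply (proj1 (Hw m) N')]. apply sum_n_le.
      intros n. now apply tval_tnorm.
    + exact HM.
    + intros m. now apply (proj2 (Hw m)).
    + rewrite (C_series_unique _ _ _ (HG t z Ht Hz) HS). exact HT.
Qed.

Lemma rep_sum_ex (r : R) (M : nat -> R) (Mt : R) (F : nat -> C -> C -> C) :
  (forall m, expands r (M m) (F m)) -> (forall N, (sum_n M N <= Mt)%R) ->
  exists G, expands r Mt G /\
  forall t z, (Cmod t <= r)%R -> (Cmod z <= r)%R -> is_series (fun m => F m t z) (G t z).
Proof.
  intros HF HM.
  assert (E : forall p : C * C, exists l, (Cmod (fst p) <= r)%R -> (Cmod (snd p) <= r)%R ->
     is_series (fun m => F m (fst p) (snd p)) l).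
  { intros [t z]; simpl.
    destruct (Rle_dec (Cmod t) r) as [Ht|Ht]; [|exists 0; tauto].
    destruct (Rle_dec (Cmod z) r) as [Hz|Hz]; [|exists 0; tauto].
    destruct (C_ex_series (fun m => F m t z) Mt) as [l Hl]; [|now exists l].
    intros N. eapply Rle_trans; [|apply (HM N)]. apply sum_n_le.
    intros n. now apply (rep_bound r). }
  exists (fun t z => proj1_sig (constructive_indefinite_description _ (E (t, z)))).
  assert (S : forall t z, (Cmod t <= r)%R -> (Cmod z <= r)%R -> is_series (fun m => F m t z)
     (proj1_sig (constructive_indefinite_description _ (E (t, z))))).
  { intros t z Ht Hz.
    destruct (constructive_indefinite_description _ (E (t, z))) as [l Hl]. now apply Hl. }
  split; [|exact S]. now apply (rep_sum r M Mt F).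
Qed.

Lemma rep_zero (r : R) : (0 < r)%R -> expands r 0 (fun _ _ => 0).
Proof.
  intros Hr. eapply rep_ext.
  - eapply rep_le; [apply (rep_monomial r 0 0 0)| | |]; try lra.
    rewrite Cmod_0. lra.
  - intros t z _ _. simpl. ring.
Qed.

Lemma rep_const (r : R) (c : C) : (0 < r)%R -> expands r (Cmod c) (fun _ _ => c).
Proof.
  intros Hr. eapply rep_ext.
  - eapply rep_le; [apply (rep_monomial r c 0 0)| | |]; try lra.
  - intros t z _ _. simpl. ring.
Qed.

Lemma rep_fst (r : R) : (0 < r)%R -> expands r r (fun t _ => t).
Proof.
  intros Hr. eapply rep_ext.
  - eapply rep_le; [apply (rep_monomial r 1 1 0)| | |]; try lra. rewrite Cmod_1. simpl. lra.
  - intros t z _ _. simpl. ring.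
Qed.

Lemma rep_snd (r : R) : (0 < r)%R -> expands r r (fun _ z => z).
Proof.
  intros Hr. eapply rep_ext.
  - eapply rep_le; [apply (rep_monomial r 1 0 1)| | |]; try lra. rewrite Cmod_1. simpl. lra.
  - intros t z _ _. simpl. ring.
Qed.

Lemma rep_plus (r M M' : R) (F G : C -> C -> C) :
  expands r M F -> expands r M' G -> expands r (M + M') (fun t z => F t z + G t z).
Proof.
  intros HF HG. assert (Hr := rep_r_pos _ _ _ HF).
  assert (PM := rep_M_pos _ _ _ HF). assert (PM' := rep_M_pos _ _ _ HG).
  apply (rep_sum r (fun m => match m with O => M | 1%nat => M' | _ => 0%R end) _
    (fun m => match m with O => F | 1%nat => G | _ => fun _ _ => 0 end)).
  - intros [|[|m]]; auto. now apply rep_zero.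
  - intros [|N]; [rewrite sum_O; lra|].
    apply Req_le. induction N as [|N IH].
    + rewrite sum_Sn, sum_O. reflexivity.
    + rewrite sum_Sn, IH. unfold plus; simpl. ring.
  - intros t z _ _. apply (is_series_eventually _ _ 1). intros [|n] Hn; [lia|]. clear Hn.
    induction n as [|n IH].
    + rewrite sum_Sn, sum_O. reflexivity.
    + rewrite sum_Sn, IH. apply (plus_zero_r (G := C_AbelianMonoid)).
Qed.

Lemma sum_n_scal (c : R) (a : nat -> R) (N : nat) :
  sum_n (fun n => (c * a n)%R) N = (c * sum_n a N)%R.
Proof. apply (sum_n_mult_l (K := R_Ring) c a N). Qed.

Lemma is_series_C_scal (c : C) (a : nat -> C) (l : C) :
  is_series a l -> is_series (fun n => c * a n) (c * l).
Proof. apply (is_series_scal (K := C_AbsRing) (V := C_NormedModule) c a l). Qed.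

Lemma is_series_C_plus (a b : nat -> C) (l m : C) :
  is_series a l -> is_series b m -> is_series (fun n => a n + b n) (l + m).
Proof. apply (is_series_plus (K := C_AbsRing) (V := C_NormedModule) a b l m). Qed.

Lemma is_series_C_ext (a b : nat -> C) (l : C) :
  (forall n, a n = b n) -> is_series a l -> is_series b l.
Proof. apply (is_series_ext (K := C_AbsRing) (V := C_NormedModule) a b l). Qed.

Lemma rep_monomial_mult (r M : R) (c : C) (j k : nat) (F : C -> C -> C) :
  expands r M F -> expands r (Cmod c * (r ^ j * r ^ k) * M) (fun t z => (c * (t ^ j * z ^ k)) * F t z).
Proof.
  intros (Hr & w & HM & H). split; [exact Hr|].
  exists (fun n => (c * fst (w n), ((j + fst (snd (w n)))%nat, (k + snd (snd (w n)))%nat))). split.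
  - intros N. rewrite (sum_n_ext _ (fun n => ((Cmod c * (r ^ j * r ^ k)) * tnorm (w n) r)%R)).
    + rewrite sum_n_scal. apply Rmult_le_compat_l; [|apply HM].
      apply Rmult_le_pos; [apply Cmod_ge_0|]. apply Rmult_le_pos; apply pow_le; lra.
    + intros n. unfold tnorm; simpl. rewrite Cmod_mult, !pow_add. ring.
  - intros t z Ht Hz. eapply is_series_C_ext; [|apply is_series_C_scal, (H t z Ht Hz)].
    intros n. unfold tval; simpl. rewrite !Cpow_add_r. ring.
Qed.

(** A product is the sum of the second factor multiplied by each monomial of
    the first. *)
Lemma rep_mult (r M M' : R) (F G : C -> C -> C) :
  expands r M F -> expands r M' G -> expands r (M * M') (fun t z => F t z * G t z).
Proof.
  intros (Hr & w & HM & H) HG.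
  apply (rep_sum r (fun n => (tnorm (w n) r * M')%R) _ (fun n t z => tval (w n) t z * G t z)).
  - intros n. apply rep_monomial_mult. exact HG.
  - intros N. rewrite (sum_n_ext _ (fun n => (M' * tnorm (w n) r)%R)) by (intros n; apply Rmult_comm).
    rewrite sum_n_scal, Rmult_comm. apply Rmult_le_compat_r; [|apply HM].
    exact (rep_M_pos _ _ _ HG).
  - intros t z Ht Hz. rewrite Cmult_comm.
    eapply is_series_C_ext; [|apply is_series_C_scal, (H t z Ht Hz)].
    intros n. apply Cmult_comm.
Qed.

Lemma rep_scal (r M : R) (c : C) (F : C -> C -> C) :
  expands r M F -> expands r (Cmod c * M) (fun t z => c * F t z).
Proof.
  intros HF. apply rep_mult; [|exact HF]. apply rep_const, (rep_r_pos _ _ _ HF).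
Qed.

Lemma rep_opp (r M : R) (F : C -> C -> C) :
  expands r M F -> expands r M (fun t z => - F t z).
Proof.
  intros HF. eapply rep_ext.
  - eapply rep_le; [apply (rep_scal r M (-(1)) F HF)| | |]; try lra.
    + exact (rep_r_pos _ _ _ HF).
    + rewrite Cmod_opp, Cmod_1. lra.
  - intros t z _ _. cbv beta; ring.
Qed.

Lemma rep_minus (r M M' : R) (F G : C -> C -> C) :
  expands r M F -> expands r M' G -> expands r (M + M') (fun t z => F t z - G t z).
Proof. intros HF HG. apply (rep_plus r M M' F (fun t z => - G t z) HF), rep_opp, HG. Qed.

Lemma rep_pow (r M : R) (F : C -> C -> C) (n : nat) :
  expands r M F -> expands r (M ^ n) (fun t z => F t z ^ n).
Proof.
  intros HF. induction n as [|n IH].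
  - simpl. eapply rep_le; [apply (rep_const r 1)| | |]; try apply (rep_r_pos _ _ _ HF); try lra.
    rewrite Cmod_1. lra.
  - eapply rep_ext; [apply (rep_mult _ _ _ _ _ HF IH)|]. reflexivity.
Qed.

(** Each monomial of F becomes a product of powers of X and Y, whose bound is
    the norm of this monomial on the polydisc of radius R0. *)
Lemma rep_comp (R0 M r : R) (F X Y : C -> C -> C) :
  expands R0 M F -> expands r R0 X -> expands r R0 Y -> expands r M (fun t z => F (X t z) (Y t z)).
Proof.
  intros (HR & w & HM & H) HX HY.
  apply (rep_sum r (fun n => tnorm (w n) R0) _ (fun n t z => tval (w n) (X t z) (Y t z))).
  - intros n. apply rep_scal, rep_mult; now apply rep_pow.
  - exact HM.
  - intros t z Ht Hz. apply H; now apply (rep_bound r).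
Qed.

(** The bound is k rho^(k-1) D, written so as to make sense for k = 0. *)
Lemma rep_pow_diff (r rho D : R) (Y Y' : C -> C -> C) (k : nat) :
  (0 < rho)%R -> expands r rho Y -> expands r rho Y' -> expands r D (fun t z => Y t z - Y' t z) ->
  expands r (INR k * rho ^ k * (D / rho)) (fun t z => Y t z ^ k - Y' t z ^ k).
Proof.
  intros Hrho HY HY' HD. induction k as [|k IH].
  - eapply rep_ext; [eapply rep_le; [apply (rep_zero r)| | |]|].
    1,2: exact (rep_r_pos _ _ _ HY).
    + lra.
    + simpl. lra.
    + intros t z _ _. simpl. ring.
  - eapply rep_ext; [eapply rep_le;
      [apply (rep_plus _ _ _ _ _ (rep_mult _ _ _ _ _ HY IH) (rep_mult _ _ _ _ _ HD (rep_pow _ _ _ k HY')))| | |]|].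
    + exact (rep_r_pos _ _ _ HY).
    + lra.
    + rewrite S_INR. simpl. apply Req_le. field. lra.
    + intros t z _ _. simpl. ring.
Qed.

Lemma INR_le_pow2 (k : nat) : (INR k <= 2 ^ k)%R.
Proof.
  induction k as [|k IH]; [simpl; lra|]. rewrite S_INR. simpl.
  assert (1 <= 2 ^ k)%R by (apply pow_R1_Rle; lra). lra.
Qed.

(** Halving the radius in the second variable pays for the factor k that a
    difference of k-th powers brings, since k is at most 2^k. *)
Lemma rep_lip (R0 M r D : R) (F X Y Y' : C -> C -> C) :
  expands R0 M F -> expands r R0 X -> expands r (R0 / 2) Y -> expands r (R0 / 2) Y' ->
  expands r D (fun t z => Y t z - Y' t z) ->
  expands r (2 * M / R0 * D) (fun t z => F (X t z) (Y t z) - F (X t z) (Y' t z)).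
Proof.
  intros (HR & w & HM & H) HX HY HY' HD.
  assert (PD := rep_M_pos _ _ _ HD). assert (Hr := rep_r_pos _ _ _ HX).
  apply (rep_sum r (fun n => (2 * D / R0 * tnorm (w n) R0)%R) _
     (fun n t z => tval (w n) (X t z) (Y t z) - tval (w n) (X t z) (Y' t z))).
  - intros n. set (j := fst (snd (w n))). set (k := snd (snd (w n))).
    eapply rep_ext; [eapply rep_le;
      [apply (rep_scal _ _ (fst (w n)) _ (rep_mult _ _ _ _ _ (rep_pow _ _ _ j HX)
         (rep_pow_diff r (R0 / 2) D Y Y' k ltac:(lra) HY HY' HD)))| | |]|].
    + exact Hr.
    + lra.
    + unfold tnorm. fold j k.
      replace (2 * D / R0 * (Cmod (fst (w n)) * (R0 ^ j * R0 ^ k)))%R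
        with (Cmod (fst (w n)) * (R0 ^ j * (R0 ^ k * (2 * D / R0))))%R by ring.
      apply Rmult_le_compat_l; [apply Cmod_ge_0|].
      apply Rmult_le_compat_l; [apply pow_le; lra|].
      replace (D / (R0 / 2))%R with (2 * D / R0)%R by (field; lra).
      apply Rmult_le_compat_r.
      * apply Rmult_le_pos; [lra|]. apply Rlt_le, Rinv_0_lt_compat; lra.
      * replace (R0 / 2)%R with (R0 * / 2)%R by reflexivity. rewrite Rpow_mult_distr.
        assert (P := pow_le R0 k ltac:(lra)). assert (I := INR_le_pow2 k).
        assert (E : (2 ^ k * (/ 2) ^ k = 1)%R) by (rewrite <- Rpow_mult_distr, Rinv_r by lra; apply pow1).
        assert (P2 := pow_le (/2) k ltac:(lra)).
        assert (INR k * (/ 2) ^ k <= 1)%R by (rewrite <- E; now apply Rmult_le_compat_r).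
        replace (INR k * (R0 ^ k * (/ 2) ^ k))%R with (R0 ^ k * (INR k * (/ 2) ^ k))%R by ring.
        rewrite <- (Rmult_1_r (R0 ^ k)) at 2. now apply Rmult_le_compat_l.
    + intros t z _ _. unfold tval. fold j k. ring.
  - intros N. rewrite sum_n_scal.
    replace (2 * M / R0 * D)%R with (2 * D / R0 * M)%R by (field; lra).
    apply Rmult_le_compat_l; [|apply HM].
    apply Rmult_le_pos; [lra|]. apply Rlt_le, Rinv_0_lt_compat; lra.
  - intros t z Ht Hz.
    assert (B : forall Z, expands r (R0 / 2) Z -> (Cmod (Z t z) <= R0)%R).
    { intros Z HZ. assert (Q := rep_bound r (R0/2) Z t z HZ Ht Hz). lra. }
    assert (BX := rep_bound r R0 X t z HX Ht Hz).
    assert (S1 := H _ _ BX (B Y HY)). assert (S2 := H _ _ BX (B Y' HY')).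
    apply (is_series_C_scal (-(1))) in S2.
    assert (S3 := is_series_C_plus _ _ _ _ S1 S2).
    replace (F (X t z) (Y t z) - F (X t z) (Y' t z))
      with (F (X t z) (Y t z) + - (1) * F (X t z) (Y' t z)) by ring.
    eapply is_series_C_ext; [|exact S3]. intros n. simpl. ring.
Qed.

Lemma sum_n_Cconj (a : nat -> C) (N : nat) :
  sum_n (fun n => Cconj (a n)) N = Cconj (sum_n a N).
Proof.
  induction N as [|N IH]; [now rewrite !sum_O|].
  rewrite !sum_Sn, IH. symmetry. apply Cplus_conj.
Qed.

Lemma is_series_Cconj (a : nat -> C) (l : C) :
  is_series a l -> is_series (fun n => Cconj (a n)) (Cconj l).
Proof.
  intros H. apply is_series_C_eps. intros eps Heps.
  destruct (proj1 (is_series_C_eps a l) H eps Heps) as [N HN]. exists N. intros n Hn.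
  rewrite sum_n_Cconj, <- Cminus_conj, Cmod_conj. now apply HN.
Qed.

(** The function with conjugate coefficients. *)
Definition star (F : C -> C -> C) : C -> C -> C := fun t z => Cconj (F (Cconj t) (Cconj z)).

Lemma rep_star (r M : R) (F : C -> C -> C) : expands r M F -> expands r M (star F).
Proof.
  intros (Hr & w & HM & H). split; [exact Hr|].
  exists (fun n => (Cconj (fst (w n)), snd (w n))). split.
  - intros N. rewrite (sum_n_ext _ (fun n => tnorm (w n) r)); [apply HM|].
    intros n. unfold tnorm; simpl. now rewrite Cmod_conj.
  - intros t z Ht Hz. unfold star.
    eapply is_series_C_ext; [|apply is_series_Cconj, (H (Cconj t) (Cconj z))]; try now rewrite Cmod_conj.
    intros n. unfold tval; simpl. now rewrite !Cmult_conj, !Cpow_conj, !Cconj_conj.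
Qed.

Lemma rep_swap (r M : R) (F : C -> C -> C) : expands r M F -> expands r M (fun t z => F z t).
Proof.
  intros (Hr & w & HM & H). split; [exact Hr|].
  exists (fun n => (fst (w n), (snd (snd (w n)), fst (snd (w n))))). split.
  - intros N. rewrite (sum_n_ext _ (fun n => tnorm (w n) r)); [apply HM|].
    intros n. unfold tnorm; simpl. ring.
  - intros t z Ht Hz. eapply is_series_C_ext; [|apply (H z t Hz Ht)].
    intros n. unfold tval; simpl. ring.
Qed.

Lemma Cpow_0_l (n : nat) : (RtoC 0) ^ S n = 0.
Proof. simpl. ring. Qed.

Lemma rep_div_snd (r M : R) (F : C -> C -> C) :
  expands r M F -> exists Q, expands r (M / r) Q /\
    forall t z, (Cmod t <= r)%R -> (Cmod z <= r)%R -> F t z = F t 0 + z * Q t z.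
Proof.
  intros (Hr & w & HM & H).
  set (w' := fun n => match snd (snd (w n)) with
     | O => (RtoC 0, (0, 0)) | S k => (fst (w n), (fst (snd (w n)), k)) end%nat).
  destruct (rep_make r (M / r)%R w' Hr) as [Q HQ].
  - intros N. eapply Rle_trans; [apply (sum_n_le _ (fun n => (/ r * tnorm (w n) r)%R))|].
    + intros n. unfold w', tnorm. destruct (snd (snd (w n))) as [|k]; simpl.
      * rewrite Cmod_0, Rmult_0_l. apply Rmult_le_pos; [apply Rlt_le, Rinv_0_lt_compat; lra|].
        apply Rmult_le_pos; [apply Cmod_ge_0|].
        rewrite Rmult_1_r. apply pow_le; lra.
      * apply Req_le. field. lra.
    + rewrite sum_n_scal. unfold Rdiv. rewrite (Rmult_comm M).
      apply Rmult_le_compat_l; [apply Rlt_le, Rinv_0_lt_compat; lra|]. apply HM.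
  - exists Q. split; [split; [exact Hr|now exists w']|].
    intros t z Ht Hz.
    assert (H0 : (Cmod 0 <= r)%R) by (rewrite Cmod_0; lra).
    apply (C_series_unique _ _ _ (H t z Ht Hz)).
    eapply is_series_C_ext; [|apply (is_series_C_plus _ _ _ _ (H t 0 Ht H0)
       (is_series_C_scal z _ _ (proj2 HQ t z Ht Hz)))].
    intros n. unfold w', tval. simpl. destruct (snd (snd (w n))) as [|k]; simpl; ring.
Qed.

(** The constant terms of X add up to zero and can be removed; every other
    monomial gains a factor l when the radius is multiplied by l. So a germ
    vanishing at the origin has arbitrarily small bound. *)
Lemma rep_small (r M l : R) (X : C -> C -> C) :
  expands r M X -> X 0 0 = 0 -> (0 < l <= 1)%R -> expands (l * r) (l * M) X.
Proof.
  intros (Hr & w & HM & H) X0 Hl. split; [nra|].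
  set (w' := fun n => match (fst (snd (w n)) + snd (snd (w n)))%nat with
     | O => (RtoC 0, (0, 0))%nat | S k => w n end).
  exists w'. split.
  - intros N. eapply Rle_trans; [apply (sum_n_le _ (fun n => (l * tnorm (w n) r)%R))|].
    + intros n. unfold w'. destruct (fst (snd (w n)) + snd (snd (w n)))%nat as [|k] eqn:E.
      * unfold tnorm at 1; simpl. rewrite Cmod_0, Rmult_0_l.
        apply Rmult_le_pos; [lra|]. apply tnorm_pos; lra.
      * unfold tnorm. rewrite <- !pow_add, E, Rpow_mult_distr. simpl.
        assert (P := pow_le r k ltac:(lra)). assert (C0 := Cmod_ge_0 (fst (w n))).
        assert (P2 : (l ^ k <= 1)%R) by (rewrite <- (pow1 k); apply pow_incr; lra).
        assert (P3 := pow_le l k ltac:(lra)).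
        replace (Cmod (fst (w n)) * (l * l ^ k * (r * r ^ k)))%R
          with (l ^ k * (l * (Cmod (fst (w n)) * (r * r ^ k))))%R by ring.
        rewrite <- (Rmult_1_l (l * (Cmod (fst (w n)) * (r * r ^ k)))) at 2.
        apply Rmult_le_compat_r; [|exact P2].
        apply Rmult_le_pos; [lra|]. apply Rmult_le_pos; [lra|].
        apply Rmult_le_pos; lra.
    + rewrite sum_n_scal. apply Rmult_le_compat_l; [lra|apply HM].
  - intros t z Ht Hz.
    assert (Ht' : (Cmod t <= r)%R) by nra. assert (Hz' : (Cmod z <= r)%R) by nra.
    assert (H0 : (Cmod 0 <= r)%R) by (rewrite Cmod_0; lra).
    replace (X t z) with (X t z + -(1) * X 0 0) by (rewrite X0; ring).
    eapply is_series_C_ext; [|apply (is_series_C_plus _ _ _ _ (H t z Ht' Hz')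
       (is_series_C_scal (-(1)) _ _ (H 0 0 H0 H0)))].
    intros n. unfold w'. destruct (snd (w n)) as [j k] eqn:E. unfold tval. simpl. rewrite E. simpl.
    destruct j as [|j]; destruct k as [|k]; rewrite ?Nat.add_0_r; simpl;  rewrite ?E; simpl; ring.
Qed.

(** Monomials with even exponent form P(s^2), those with odd exponent form s
    Q(s^2). The expansion of F may involve the second variable, which is set
    to zero. *)
Lemma rep_even_odd (r M : R) (F : C -> C -> C) :
  (r <= 1)%R -> expands r M F ->
  exists P Q : C -> C, expands (r ^ 2) M (fun t _ => P t) /\ expands (r ^ 2) (M / r) (fun t _ => Q t) /\
    forall s, (Cmod s <= r)%R -> F s 0 = P (s ^ 2) + s * Q (s ^ 2).
Proof.
  intros Hr1 (Hr & w & HM & H).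
  set (wp := fun n => match snd (snd (w n)) with
     | O => if Nat.even (fst (snd (w n))) then (fst (w n), (Nat.div2 (fst (snd (w n))), 0))
            else (RtoC 0, (0, 0))
     | S k => (RtoC 0, (0, 0)) end%nat).
  set (wq := fun n => match snd (snd (w n)) with
     | O => if Nat.even (fst (snd (w n))) then (RtoC 0, (0, 0))
            else (fst (w n), (Nat.div2 (fst (snd (w n))), 0))
     | S k => (RtoC 0, (0, 0)) end%nat).
  assert (Hr2 : (0 < r ^ 2)%R) by (apply pow_lt; lra).
  assert (Hi : (0 < / r)%R) by (apply Rinv_0_lt_compat; lra).
  assert (par : forall j, ((Nat.even j = true -> j = 2 * Nat.div2 j) /\
                (Nat.even j = false -> j = S (2 * Nat.div2 j)))%nat).
  { intros j. assert (D := Nat.div2_odd j). rewrite <- Nat.negb_even in D.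
    destruct (Nat.even j); simpl in *; split; intros; try discriminate; lia. }
  assert (Z : forall x, tnorm (RtoC 0, (0, 0)%nat) x = 0%R)
    by (intros x; unfold tnorm; simpl; rewrite Cmod_0; ring).
  destruct (rep_make (r ^ 2) M wp Hr2) as [P HP].
  { intros N. eapply Rle_trans; [|apply (HM N)]. apply sum_n_le. intros n. unfold wp.
    destruct (w n) as [c [j k]]. simpl. destruct k as [|k]; [destruct (Nat.even j) eqn:E| ];
      try (rewrite Z; apply tnorm_pos; lra).
    unfold tnorm; simpl. apply Req_le. f_equal. f_equal.
    apply (proj1 (par j)) in E. rewrite E at 2. rewrite pow_mult. simpl. reflexivity. }
  destruct (rep_make (r ^ 2) (M / r) wq Hr2) as [Q HQ].
  { intros N. eapply Rle_trans; [apply (sum_n_le _ (fun n => (/ r * tnorm (w n) r)%R))|].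
    - intros n. unfold wq.
      destruct (w n) as [c [j k]]. simpl.
      destruct k as [|k]; [destruct (Nat.even j) eqn:E| ];
      try (rewrite Z; apply Rmult_le_pos; [lra|apply tnorm_pos; lra]).
      unfold tnorm; simpl. apply (proj2 (par j)) in E. rewrite E at 2.
      apply Req_le. rewrite <- tech_pow_Rmult, pow_mult. simpl. field. lra.
    - rewrite sum_n_scal. unfold Rdiv. rewrite (Rmult_comm M).
      apply Rmult_le_compat_l; [lra|]. apply HM. }
  assert (H0 : forall x : R, (0 < x)%R -> (Cmod 0 <= x)%R) by (intros x Hx; rewrite Cmod_0; lra).
  assert (ind : forall (w0 : nat -> term) (M0 : R) (P0 : C -> C -> C), expansion (r ^ 2) M0 w0 P0 ->
     (forall n, snd (snd (w0 n)) = 0%nat) -> expands (r ^ 2) M0 (fun t _ => P0 t 0)).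
  { intros w0 M0 P0 (B0 & S0) E0. split; [exact Hr2|]. exists w0. split; [exact B0|].
    intros t z Ht Hz. eapply is_series_C_ext; [|apply (S0 t 0 Ht (H0 _ Hr2))].
    intros n. unfold tval. rewrite E0. reflexivity. }
  exists (fun t => P t 0), (fun t => Q t 0). split; [|split].
  - apply (ind wp); [exact HP|]. intros n. unfold wp.
    destruct (w n) as [c [j k]]; simpl. destruct k; [destruct (Nat.even j)| ]; reflexivity.
  - apply (ind wq); [exact HQ|]. intros n. unfold wq.
    destruct (w n) as [c [j k]]; simpl. destruct k; [destruct (Nat.even j)| ]; reflexivity.
  - intros s Hs.
    assert (Hs2 : (Cmod (s ^ 2) <= r ^ 2)%R).
    { rewrite Cmod_pow. apply pow_incr. split; [apply Cmod_ge_0|exact Hs]. }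
    apply (C_series_unique _ _ _ (H s 0 Hs (H0 _ Hr))).
    eapply is_series_C_ext; [|apply (is_series_C_plus _ _ _ _ (proj2 HP _ 0 Hs2 (H0 _ Hr2))
       (is_series_C_scal s _ _ (proj2 HQ _ 0 Hs2 (H0 _ Hr2))))].
    intros n. unfold wp, wq, tval. destruct (w n) as [c [j k]]; simpl.
    destruct k as [|k]; [destruct (Nat.even j) eqn:E| ]; simpl.
    + apply (proj1 (par j)) in E. rewrite E at 2. rewrite Cpow_mult_r. simpl. ring.
    + apply (proj2 (par j)) in E. rewrite E at 2. rewrite Cpow_S, Cpow_mult_r. simpl. ring.
    + ring.
Qed.

(** * Expansions and mixed power series *)

Lemma rep_sum_n (r : R) (M : nat -> R) (F : nat -> C -> C -> C) (N : nat) :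
  (forall i, expands r (M i) (F i)) -> expands r (sum_n M N) (fun t z => sum_n (fun i => F i t z) N).
Proof.
  intros H. induction N as [|N IH].
  - rewrite sum_O. eapply rep_ext; [apply (H 0%nat)|]. intros t z _ _. now rewrite sum_O.
  - rewrite sum_Sn. eapply rep_ext; [apply (rep_plus _ _ _ _ _ IH (H (S N)))|].
    intros t z _ _. now rewrite sum_Sn.
Qed.

Lemma is_series_sum_n {K : AbsRing} {V : NormedModule K} (a : nat -> nat -> V) (l : nat -> V) (N : nat) :
  (forall i, is_series (a i) (l i)) -> is_series (fun n => sum_n (fun i => a i n) N) (sum_n l N).
Proof.
  intros H. induction N as [|N IH].
  - rewrite sum_O. eapply is_series_ext; [|apply (H 0%nat)]. intros n. now rewrite sum_O.
  - rewrite sum_Sn. eapply is_series_ext; [|apply (is_series_plus _ _ _ _ IH (H (S N)))].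
    intros n. now rewrite sum_Sn.
Qed.

Lemma sum_n_indicator {G : AbelianMonoid} (x : nat -> G) (m N : nat) :
  sum_n (fun j => if Nat.eqb m j then x j else zero) N = if Nat.leb m N then x m else zero.
Proof.
  induction N as [|N IH].
  - rewrite sum_O. destruct m; reflexivity.
  - rewrite sum_Sn, IH. destruct (Nat.leb_spec m N); destruct (Nat.eqb_spec m (S N));
    destruct (Nat.leb_spec m (S N)); try lia; subst;
      rewrite ?plus_zero_r, ?plus_zero_l; reflexivity.
Qed.

Lemma Rplus_minus_swap (a b c : R) : (a - b + c = a + c - b)%R.
Proof. ring. Qed.

Lemma sum_n_tail_le (x : nat -> R) (A : R) (N m : nat) :
  (forall n, (0 <= x n)%R) -> is_series x A ->
  (sum_n (fun n => if Nat.leb n N then 0%R else x n) m <= A - sum_n x N)%R.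
Proof.
  intros Hx HA.
  assert (E : forall q, (sum_n (fun n => if Nat.leb n N then 0%R else x n) (N + q)
     = sum_n x (N + q) - sum_n x N)%R).
  { induction q as [|q IH].
    - rewrite Nat.add_0_r, Rminus_diag.
      rewrite (sum_n_ext_loc _ (fun _ => 0%R)), sum_n_const; [apply Rmult_0_r|].
      intros n Hn. destruct (Nat.leb_spec n N); [reflexivity|lia].
    - replace (N + S q)%nat with (S (N + q)) by lia. rewrite !sum_Sn, IH.
      change (@plus R_AbelianMonoid) with Rplus.
      destruct (Nat.leb_spec (S (N + q)) N); [lia|]. apply Rplus_minus_swap. }
  eapply Rle_trans; [apply (sum_n_nonneg_incr _ m (N + m)); [|lia]|].
  - intros n. destruct (Nat.leb n N); [apply Rle_refl|apply Hx].
  - rewrite E. assert (I := sum_n_le_is_series x A (N + m) Hx HA). lra.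
Qed.

Section ToMix.
Variables (r M : R) (w : nat -> term) (F : C -> C -> C).
Hypothesis Hr : (0 < r)%R.
Hypothesis Hw : expansion r M w F.

Let deg (n : nat) : nat := (fst (snd (w n)) + snd (snd (w n)))%nat.
Let wpos (n : nat) : (0 <= tnorm (w n) r)%R := tnorm_pos (w n) r (Rlt_le _ _ Hr).
Let sel {G : AbelianMonoid} (x : nat -> G) (j k n : nat) : G :=
  if andb (Nat.eqb (fst (snd (w n))) j) (Nat.eqb (snd (snd (w n))) k) then x n else zero.

Lemma sel_sum {G : AbelianMonoid} (x : nat -> G) (d n : nat) :
  sum_n (fun j => sel x j (d - j) n) d = if Nat.eqb (deg n) d then x n else zero.
Proof.
  rewrite (sum_n_ext_loc _ (fun j => if Nat.eqb (fst (snd (w n))) j then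
     (if Nat.eqb (deg n) d then x n else zero) else zero)).
  - rewrite (sum_n_indicator (fun _ => if Nat.eqb (deg n) d then x n else zero)).
    destruct (Nat.leb_spec (fst (snd (w n))) d); [reflexivity|].
    destruct (Nat.eqb_spec (deg n) d); [|reflexivity]. unfold deg in *. lia.
  - intros j Hj. unfold sel.
    destruct (Nat.eqb_spec (fst (snd (w n))) j); simpl; [|reflexivity].
    destruct (Nat.eqb_spec (snd (snd (w n))) (d - j)); destruct (Nat.eqb_spec (deg n) d);
      unfold deg in *; try lia; reflexivity.
Qed.

Lemma sel_sum_sum {G : AbelianMonoid} (x : nat -> G) (D n : nat) :
  sum_n (fun d => sum_n (fun j => sel x j (d - j) n) d) D = if Nat.leb (deg n) D then x n else zero.
Proof.
  rewrite (sum_n_ext _ (fun d => if Nat.eqb (deg n) d then x n else zero)).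
  - apply (sum_n_indicator (fun _ => x n)).
  - intros d. apply sel_sum.
Qed.

Lemma norm_series_exists (j k : nat) :
  exists b : R, is_series (fun n => sel (G := R_AbelianMonoid) (fun n => tnorm (w n) r) j k n) b.
Proof.
  destruct (sum_n_bounded_ex_series
    (fun n => sel (G := R_AbelianMonoid) (fun n => tnorm (w n) r) j k n) M) as [b Hb].
  - intros n. unfold sel. destruct andb; [apply tnorm_pos; lra|apply Rle_refl].
  - intros N. eapply Rle_trans; [|apply (proj1 Hw N)]. apply sum_n_le.
    intros n. unfold sel. destruct andb; [apply Rle_refl|apply tnorm_pos; lra].
  - now exists b.
Qed.

Lemma coeff_exists (j k : nat) :
  exists a : C, is_series (fun n => sel (G := C_AbelianMonoid) (fun n => fst (w n)) j k n) a.
Proof.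
  destruct (C_ex_series (fun n => sel (G := C_AbelianMonoid) (fun n => fst (w n)) j k n)
    (/ (r ^ j * r ^ k) * M)) as [a Ha]; [|now exists a].
  assert (P : (0 < r ^ j * r ^ k)%R) by (apply Rmult_lt_0_compat; apply pow_lt; lra).
  intros N. eapply Rle_trans; [apply (sum_n_le _ (fun n => / (r ^ j * r ^ k) * tnorm (w n) r)%R)|].
  - intros n. unfold sel. destruct (Nat.eqb_spec (fst (snd (w n))) j) as [E1|E1];
    destruct (Nat.eqb_spec (snd (snd (w n))) k) as [E2|E2]; simpl;
    try (change (@zero C_AbelianMonoid) with (RtoC 0); rewrite Cmod_0; apply Rmult_le_pos;
       [apply Rlt_le, Rinv_0_lt_compat; lra|apply tnorm_pos; lra]).
    unfold tnorm. rewrite E1, E2. apply Req_le. field.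
    split; apply Rgt_not_eq, pow_lt; lra.
  - rewrite sum_n_scal. apply Rmult_le_compat_l; [apply Rlt_le, Rinv_0_lt_compat; lra|].
    apply (proj1 Hw).
Qed.

(** Equal monomials are collected, then grouped by total degree. The partial
    sum up to degree D contains all terms of index at most N as soon as D
    exceeds their degrees, and the remaining terms have small total modulus. *)
Lemma repw_mix (H : R -> C -> C) (t0 : R) (z0 : C) :
  (forall t z, (Rabs (t - t0) < r)%R -> (Cmod (z - z0) < r)%R -> H t z = F (RtoC (t - t0)) (z - z0)) ->
  mix_analytic_at H t0 z0.
Proof.
  intros HH.
  set (a := fun j k => proj1_sig (constructive_indefinite_description _ (coeff_exists j k))).
  assert (Ha : forall j k, is_series (fun n => sel (G := C_AbelianMonoid) (fun n => fst (w n)) j k n) (a j k))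
    by (intros j k; exact (proj2_sig (constructive_indefinite_description _ (coeff_exists j k)))).
  set (b := fun j k => proj1_sig (constructive_indefinite_description _ (norm_series_exists j k))).
  assert (Hb : forall j k, is_series (fun n => sel (G := R_AbelianMonoid) (fun n => tnorm (w n) r) j k n) (b j k))
    by (intros j k; exact (proj2_sig (constructive_indefinite_description _ (norm_series_exists j k)))).
  assert (Pb : forall j k N, (sum_n (fun n => sel (G := R_AbelianMonoid) (fun n => tnorm (w n) r) j k n) N <= b j k)%R).
  { intros j k N. apply sum_n_le_is_series; [|apply Hb].
    intros n. unfold sel. destruct andb; [apply tnorm_pos; lra|apply Rle_refl]. }
  assert (Pos : forall j k, (0 < r ^ j * r ^ k)%R)
    by (intros; apply Rmult_lt_0_compat; apply pow_lt; lra).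
  assert (Hab : forall j k, (Cmod (a j k) * (r ^ j * r ^ k) <= b j k)%R).
  { intros j k. rewrite <- (Rabs_pos_eq (r ^ j * r ^ k)) by (apply Rlt_le, Pos).
    rewrite <- Cmod_R, <- Cmod_mult, Cmult_comm.
    apply (Cmod_series_le _ _ _ (is_series_C_scal _ _ _ (Ha j k))).
    intros N. eapply Rle_trans; [|apply (Pb j k N)]. apply sum_n_le. intros n.
    unfold sel. destruct (Nat.eqb_spec (fst (snd (w n))) j) as [E1|E1];
    destruct (Nat.eqb_spec (snd (snd (w n))) k) as [E2|E2]; simpl;
      rewrite Cmod_mult; try (change (@zero C_AbelianMonoid) with (RtoC 0); rewrite Cmod_0, Rmult_0_r; apply Rle_refl).
    unfold tnorm. rewrite Cmod_R, (Rabs_pos_eq (r ^ j * r ^ k)) by (apply Rlt_le, Pos).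
    rewrite E1, E2. apply Req_le. ring. }
  exists a, r. split; [exact Hr|]. split.
  - apply (sum_n_bounded_ex_series _ M).
    + intros d. rewrite <- lsum_seq. apply lsum_nonneg. intros j.
      apply Rmult_le_pos; [apply Cmod_ge_0|apply pow_le; lra].
    + intros D. eapply Rle_trans; [apply (sum_n_le _ (fun d => sum_n (fun j => b j (d - j)%nat) d))|].
      * intros d. unfold sum_n. rewrite (sum_n_m_ext_loc _ (fun j => (Cmod (a j (d - j)%nat) * (r ^ j * r ^ (d - j)))%R)).
        -- apply sum_n_m_le. intros j. apply Hab.
        -- intros j Hj. rewrite <- pow_add. do 2 f_equal. lia.
      * assert (S := is_series_sum_n (K := R_AbsRing) (V := R_NormedModule)
           (fun d n => sum_n (fun j => sel (G := R_AbelianMonoid) (fun n => tnorm (w n) r) j (d - j) n) d)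
           (fun d => sum_n (fun j => b j (d - j)%nat) d) D
           (fun d => is_series_sum_n (K := R_AbsRing) (V := R_NormedModule)
              (fun j n => sel (G := R_AbelianMonoid) (fun n => tnorm (w n) r) j (d - j) n)
              (fun j => b j (d - j)%nat) d (fun j => Hb j (d - j)%nat))).
        apply (is_series_bound_le _ _ _ S). intros N. eapply Rle_trans; [|apply (proj1 Hw N)].
        apply sum_n_le. intros n.
        rewrite (sel_sum_sum (G := R_AbelianMonoid) (fun n => tnorm (w n) r)).
        destruct (Nat.leb (deg n) D); [apply Rle_refl|apply tnorm_pos; lra].
  - intros t z Ht Hz. rewrite (HH t z Ht Hz).
    set (T := RtoC (t - t0)). set (Z := z - z0).
    assert (HT : (Cmod T <= r)%R) by (unfold T; rewrite Cmod_R; lra).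
    assert (HZ : (Cmod Z <= r)%R) by (unfold Z; lra).
    assert (St : forall j k, is_series (fun n => sel (G := C_AbelianMonoid) (fun n => tval (w n) T Z) j k n) (a j k * T ^ j * Z ^ k)).
    { intros j k. replace (a j k * T ^ j * Z ^ k) with ((T ^ j * Z ^ k) * a j k) by ring.
      eapply is_series_C_ext; [|apply is_series_C_scal, (Ha j k)].
      intros n. unfold sel, tval. destruct (Nat.eqb_spec (fst (snd (w n))) j) as [E1|E1];
      destruct (Nat.eqb_spec (snd (snd (w n))) k) as [E2|E2]; simpl;
        try (change (@zero C_AbelianMonoid) with (RtoC 0); ring).
      rewrite E1, E2. ring. }
    apply is_series_C_eps. intros eps Heps.
    destruct (sum_n_bounded_ex_series (fun n => tnorm (w n) r) M wpos (proj1 Hw))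
      as [A HA].
    assert (HA' : is_lim_seq (sum_n (fun n => tnorm (w n) r)) A) by exact HA.
    apply is_lim_seq_spec in HA'. destruct (HA' (mkposreal (eps / 2) ltac:(lra))) as [N HN].
    specialize (HN N (Nat.le_refl N)). apply Rabs_def2, proj2 in HN.
    assert (HN' : (A - sum_n (fun n => tnorm (w n) r) N < eps / 2)%R) by (simpl in HN; lra).
    assert (exists D0, forall n, (n <= N)%nat -> (deg n <= D0)%nat) as [D0 HD0].
    { clear. induction N as [|N [D IH]].
      - exists (deg 0). intros n Hn. replace n with 0%nat by lia. lia.
      - exists (D + deg (S N))%nat. intros n Hn. destruct (Nat.eq_dec n (S N)) as [->|]; [lia|].
        specialize (IH n ltac:(lia)). lia. }
    exists D0. intros D HD.
    assert (S := is_series_sum_n (K := C_AbsRing) (V := C_NormedModule)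
           (fun d n => sum_n (fun j => sel (G := C_AbelianMonoid) (fun n => tval (w n) T Z) j (d - j) n) d)
           (fun d => sum_n (fun j => a j (d - j)%nat * T ^ j * Z ^ (d - j)) d) D
           (fun d => is_series_sum_n (K := C_AbsRing) (V := C_NormedModule)
              (fun j n => sel (G := C_AbelianMonoid) (fun n => tval (w n) T Z) j (d - j) n)
              (fun j => a j (d - j)%nat * T ^ j * Z ^ (d - j)) d (fun j => St j (d - j)%nat))).
    assert (S2 := is_series_C_plus _ _ _ _ S (is_series_C_scal (-(1)) _ _ (proj2 Hw T Z HT HZ))).
    match goal with |- (Cmod ?x < _)%R => assert (Q : (Cmod x <= eps / 2)%R); [|lra] end.
    match type of S2 with is_series _ ?l => match goal with |- (Cmod ?x <= _)%R =>
      replace x with l by (unfold Cminus; f_equal; ring) end end.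
    apply (Cmod_series_le _ _ _ S2). intros m.
    (* The terms of index at most N have degree at most D and cancel. *)
    eapply Rle_trans; [apply (sum_n_le _ (fun n => if Nat.leb n N then 0%R else tnorm (w n) r))|].
    + intros n.
      rewrite (sel_sum_sum (G := C_AbelianMonoid) (fun n => tval (w n) T Z)).
      destruct (Nat.leb_spec n N) as [Hn|Hn].
      * specialize (HD0 n Hn). destruct (Nat.leb_spec (deg n) D); [|lia].
        replace (tval (w n) T Z + - (1) * tval (w n) T Z) with (RtoC 0) by ring.
        rewrite Cmod_0. apply Rle_refl.
      * destruct (Nat.leb (deg n) D).
        -- replace (tval (w n) T Z + - (1) * tval (w n) T Z) with (RtoC 0) by ring.
           rewrite Cmod_0. apply tnorm_pos; lra.
        -- change (@zero C_AbelianMonoid) with (RtoC 0).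
           replace (0 + - (1) * tval (w n) T Z) with (- tval (w n) T Z) by ring.
           rewrite Cmod_opp. now apply tval_tnorm.
    + eapply Rle_trans; [exact (sum_n_tail_le (fun n => tnorm (w n) r) A N m wpos HA)|]. apply Rlt_le. exact HN'.
Qed.
End ToMix.

Lemma rep_mix (r M : R) (F : C -> C -> C) (H : R -> C -> C) (t0 : R) (z0 : C) :
  expands r M F ->
  (forall t z, (Rabs (t - t0) < r)%R -> (Cmod (z - z0) < r)%R -> H t z = F (RtoC (t - t0)) (z - z0)) ->
  mix_analytic_at H t0 z0.
Proof. intros (Hr & w & Hw) HH. exact (repw_mix r M w F Hr Hw H t0 z0 HH). Qed.

(** The homogeneous parts are finite sums of monomials, to which the closure
    under sums applies. *)
Lemma mix_rep (H : R -> C -> C) (t0 : R) (z0 : C) :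
  mix_analytic_at H t0 z0 ->
  exists r M F, expands r M F /\
    forall t z, (Rabs t <= r)%R -> (Cmod z <= r)%R -> H (t0 + t)%R (z0 + z) = F (RtoC t) z.
Proof.
  intros (a & r & Hr & [A HA] & HS).
  set (h := (r / 2)%R). assert (Hh : (0 < h)%R) by (unfold h; lra).
  destruct (rep_sum_ex h (fun d => sum_n (fun j => Cmod (a j (d - j)%nat) * (h ^ j * h ^ (d - j)))%R d) A
    (fun d t z => sum_n (fun j => a j (d - j)%nat * (t ^ j * z ^ (d - j))) d)) as (F & HF & SF).
  - intros d. apply (rep_sum_n h (fun j => (Cmod (a j (d - j)%nat) * (h ^ j * h ^ (d - j)))%R)
      (fun j t z => a j (d - j)%nat * (t ^ j * z ^ (d - j)))).
    intros j. now apply rep_monomial.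
  - intros N. eapply Rle_trans; [|apply (sum_n_le_is_series (fun d => sum_n (fun j => (Cmod (a j (d - j)%nat) * r ^ d)%R) d) A N)]; [| |exact HA].
    + apply sum_n_le. intros d. unfold sum_n.
      rewrite (sum_n_m_ext_loc (fun j => (Cmod (a j (d - j)%nat) * (h ^ j * h ^ (d - j)))%R)
        (fun j => (Cmod (a j (d - j)%nat) * h ^ d)%R)).
      * apply sum_n_m_le. intros j. apply Rmult_le_compat_l; [apply Cmod_ge_0|].
        apply pow_incr. unfold h; lra.
      * intros j Hj. rewrite <- pow_add. do 2 f_equal. lia.
    + intros d. rewrite <- lsum_seq. apply lsum_nonneg. intros j.
      apply Rmult_le_pos; [apply Cmod_ge_0|apply pow_le; lra].
  - exists h, A, F. split; [exact HF|]. intros t z Ht Hz.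
    specialize (HS (t0 + t)%R (z0 + z)).
    replace (t0 + t - t0)%R with t in HS by ring.
    replace (z0 + z - z0) with z in HS by ring.
    specialize (HS ltac:(unfold h in *; lra) ltac:(unfold h in *; lra)).
    specialize (SF (RtoC t) z ltac:(rewrite Cmod_R; lra) Hz).
    eapply C_series_unique; [exact HS|].
    eapply is_series_C_ext; [|exact SF]. intros d. apply sum_n_ext. intros j. simpl.
    apply Cmult_assoc.
Qed.

(** * Analytic germs at the origin *)

(** Germs at the origin of the plane of two complex variables; a property of
    one variable is stated with the other one ignored. *)
Definition near (P : C -> C -> Prop) : Prop :=
  exists d : R, (0 < d)%R /\ forall t z, (Cmod t < d)%R -> (Cmod z < d)%R -> P t z.

Definition analytic0 (F : C -> C -> C) : Prop := exists r M, expands r M F.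

Lemma near_and (P Q : C -> C -> Prop) :
  near P -> near Q -> near (fun t z => P t z /\ Q t z).
Proof.
  intros (d & Hd & HP) (e & He & HQ). exists (Rmin d e). split.
  - now apply Rmin_pos.
  - intros t z Ht Hz. assert (A := Rmin_l d e). assert (B := Rmin_r d e).
    split; [apply HP|apply HQ]; lra.
Qed.

Lemma near_imp (P Q : C -> C -> Prop) :
  (forall t z, P t z -> Q t z) -> near P -> near Q.
Proof. intros H (d & Hd & HP). exists d. split; auto. Qed.

Lemma near_true (P : C -> C -> Prop) : (forall t z, P t z) -> near P.
Proof. intros H. exists 1%R. split; [lra|auto]. Qed.

Lemma near_at_0 (P : C -> C -> Prop) : near P -> P 0 0.
Proof. intros (d & Hd & HP). apply HP; now rewrite Cmod_0. Qed.

Lemma an_ext (F G : C -> C -> C) : analytic0 F -> near (fun t z => F t z = G t z) -> analytic0 G.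
Proof.
  intros (r & M & H) (d & Hd & E). assert (Hr := rep_r_pos _ _ _ H).
  exists (Rmin r (d / 2)), M.
  assert (A := Rmin_l r (d / 2)). assert (B := Rmin_r r (d / 2)).
  assert (P : (0 < Rmin r (d / 2))%R) by (apply Rmin_pos; lra).
  eapply rep_ext; [eapply rep_le; [exact H| | |]|]; try lra.
  intros t z Ht Hz. apply E; lra.
Qed.

Lemma rep2 (F G : C -> C -> C) : analytic0 F -> analytic0 G ->
  exists r M, (0 < r <= 1)%R /\ (1 <= M)%R /\ expands r M F /\ expands r M G.
Proof.
  intros (r & M & HF) (r' & M' & HG).
  assert (Hr := rep_r_pos _ _ _ HF). assert (Hr' := rep_r_pos _ _ _ HG).
  set (s := Rmin 1 (Rmin r r')). set (N := Rmax 1 (Rmax M M')).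
  assert (A1 := Rmin_l 1 (Rmin r r')). assert (A2 := Rmin_r 1 (Rmin r r')).
  assert (A3 := Rmin_l r r'). assert (A4 := Rmin_r r r').
  assert (A5 : (0 < Rmin 1 (Rmin r r'))%R) by (repeat apply Rmin_pos; lra).
  assert (B1 := Rmax_l 1 (Rmax M M')). assert (B2 := Rmax_r 1 (Rmax M M')).
  assert (B3 := Rmax_l M M'). assert (B4 := Rmax_r M M').
  exists s, N. unfold s, N. split; [lra|]. split; [lra|]. split.
  - eapply rep_le; [exact HF| | |]; lra.
  - eapply rep_le; [exact HG| | |]; lra.
Qed.

Lemma an_const (c : C) : analytic0 (fun _ _ => c).
Proof. exists 1%R, (Cmod c). apply rep_const; lra. Qed.

Lemma an_fst : analytic0 (fun t _ => t).
Proof. exists 1%R, 1%R. apply rep_fst; lra. Qed.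

Lemma an_snd : analytic0 (fun _ z => z).
Proof. exists 1%R, 1%R. apply rep_snd; lra. Qed.

Lemma an_plus (F G : C -> C -> C) : analytic0 F -> analytic0 G -> analytic0 (fun t z => F t z + G t z).
Proof.
  intros HF HG. destruct (rep2 F G HF HG) as (r & M & _ & _ & H1 & H2).
  exists r, (M + M)%R. now apply rep_plus.
Qed.

Lemma an_minus (F G : C -> C -> C) : analytic0 F -> analytic0 G -> analytic0 (fun t z => F t z - G t z).
Proof.
  intros HF HG. destruct (rep2 F G HF HG) as (r & M & _ & _ & H1 & H2).
  exists r, (M + M)%R. now apply rep_minus.
Qed.

Lemma an_mult (F G : C -> C -> C) : analytic0 F -> analytic0 G -> analytic0 (fun t z => F t z * G t z).
Proof.
  intros HF HG. destruct (rep2 F G HF HG) as (r & M & _ & _ & H1 & H2).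
  exists r, (M * M)%R. now apply rep_mult.
Qed.

Lemma an_opp (F : C -> C -> C) : analytic0 F -> analytic0 (fun t z => - F t z).
Proof. intros (r & M & H). exists r, M. now apply rep_opp. Qed.

Lemma an_pow (F : C -> C -> C) (n : nat) : analytic0 F -> analytic0 (fun t z => F t z ^ n).
Proof. intros (r & M & H). exists r, (M ^ n)%R. now apply rep_pow. Qed.

Lemma an_star (F : C -> C -> C) : analytic0 F -> analytic0 (star F).
Proof. intros (r & M & H). exists r, M. now apply rep_star. Qed.

Lemma an_swap (F : C -> C -> C) : analytic0 F -> analytic0 (fun t z => F z t).
Proof. intros (r & M & H). exists r, M. now apply rep_swap. Qed.

Lemma an_small (X : C -> C -> C) (e : R) :
  analytic0 X -> X 0 0 = 0 -> (0 < e)%R ->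
  exists r0, (0 < r0)%R /\ forall r, (0 < r <= r0)%R -> expands r e X.
Proof.
  intros (r & M & H) X0 He. assert (Hr := rep_r_pos _ _ _ H). assert (HM := rep_M_pos _ _ _ H).
  set (l := Rmin 1 (e / (M + 1))).
  assert (A := Rmin_l 1 (e / (M + 1))). assert (B := Rmin_r 1 (e / (M + 1))).
  assert (P : (0 < e / (M + 1))%R) by (apply Rdiv_lt_0_compat; lra).
  assert (Q : (0 < Rmin 1 (e / (M + 1)))%R) by (apply Rmin_pos; lra).
  fold l in A, B, Q.
  assert (S := rep_small r M l X H X0 (conj Q A)).
  exists (l * r)%R. split; [nra|]. intros r' Hr'.
  eapply rep_le; [exact S| | |]; try lra.
  apply (Rle_trans _ (e / (M + 1) * M)%R).
  - apply Rmult_le_compat_r; lra.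
  - apply (Rmult_le_reg_r (M + 1)); [lra|].
    replace (e / (M + 1) * M * (M + 1))%R with (e * M)%R by (field; lra). nra.
Qed.

Lemma an_comp (F X Y : C -> C -> C) :
  analytic0 F -> analytic0 X -> analytic0 Y -> X 0 0 = 0 -> Y 0 0 = 0 -> analytic0 (fun t z => F (X t z) (Y t z)).
Proof.
  intros (R0 & M & HF) HX HY X0 Y0. assert (HR := rep_r_pos _ _ _ HF).
  destruct (an_small X R0 HX X0 HR) as (r1 & H1 & S1).
  destruct (an_small Y R0 HY Y0 HR) as (r2 & H2 & S2).
  assert (A := Rmin_l r1 r2). assert (B := Rmin_r r1 r2).
  assert (P : (0 < Rmin r1 r2)%R) by (apply Rmin_pos; lra).
  exists (Rmin r1 r2), M. apply (rep_comp R0); [exact HF|apply S1; lra|apply S2; lra].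
Qed.

Lemma near_comp (P : C -> C -> Prop) (X Y : C -> C -> C) :
  near P -> analytic0 X -> analytic0 Y -> X 0 0 = 0 -> Y 0 0 = 0 -> near (fun t z => P (X t z) (Y t z)).
Proof.
  intros (d & Hd & HP) HX HY X0 Y0.
  destruct (an_small X (d / 2) HX X0 ltac:(lra)) as (r1 & H1 & S1).
  destruct (an_small Y (d / 2) HY Y0 ltac:(lra)) as (r2 & H2 & S2).
  exists (Rmin r1 r2). assert (A := Rmin_l r1 r2). assert (B := Rmin_r r1 r2). split.
  - apply Rmin_pos; lra.
  - intros t z Ht Hz.
    assert (BX := rep_bound _ _ _ t z (S1 r1 ltac:(lra)) ltac:(lra) ltac:(lra)).
    assert (BY := rep_bound _ _ _ t z (S2 r2 ltac:(lra)) ltac:(lra) ltac:(lra)).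
    apply HP; lra.
Qed.

Lemma an_cont (F : C -> C -> C) (e : R) : analytic0 F -> (0 < e)%R ->
  near (fun t z => (Cmod (F t z - F 0 0) < e)%R).
Proof.
  intros HF He.
  destruct (an_small (fun t z => F t z - F 0 0) (e / 2)) as (r & Hr & S).
  - apply an_minus; [exact HF|apply an_const].
  - ring.
  - lra.
  - exists r. split; [exact Hr|]. intros t z Ht Hz.
    assert (B := rep_bound _ _ _ t z (S r ltac:(lra)) ltac:(lra) ltac:(lra)). simpl in B. lra.
Qed.

Lemma an_bounded (F : C -> C -> C) : analytic0 F -> exists M, near (fun t z => (Cmod (F t z) <= M)%R).
Proof.
  intros (r & M & H). exists M. exists r. split; [exact (rep_r_pos _ _ _ H)|].
  intros t z Ht Hz. apply (rep_bound r); auto; lra.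
Qed.

Lemma an_nonzero (F : C -> C -> C) : analytic0 F -> F 0 0 <> 0 -> near (fun t z => F t z <> 0).
Proof.
  intros HF H0. assert (P := proj1 (Cmod_gt_0 _) H0).
  destruct (an_cont F _ HF P) as (d & Hd & H). exists d. split; [exact Hd|].
  intros t z Ht Hz E. specialize (H t z Ht Hz). rewrite E in H.
  replace (0 - F 0 0) with (- F 0 0) in H by ring. rewrite Cmod_opp in H. lra.
Qed.

Lemma an_div_snd (F : C -> C -> C) : analytic0 F ->
  exists Q, analytic0 Q /\ near (fun t z => F t z = F t 0 + z * Q t z).
Proof.
  intros (r & M & H). destruct (rep_div_snd r M F H) as (Q & HQ & E).
  exists Q. split; [now exists r, (M / r)%R|].
  exists r. split; [exact (rep_r_pos _ _ _ H)|]. intros t z Ht Hz. apply E; lra.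
Qed.

Lemma an_div_fst (F : C -> C -> C) : analytic0 F ->
  exists Q, analytic0 Q /\ near (fun t z => F t z = F 0 z + t * Q t z).
Proof.
  intros HF. destruct (an_div_snd _ (an_swap F HF)) as (Q & HQ & d & Hd & E).
  exists (fun t z => Q z t). split; [now apply an_swap|]. exists d. split; auto.
Qed.

(** A germ is analytic at all points of a neighbourhood, which the definitions
    of the mixed classes require. *)
Lemma an_recenter (F : C -> C -> C) : analytic0 F ->
  exists d, (0 < d)%R /\ forall t1 z1, (Cmod t1 < d)%R -> (Cmod z1 < d)%R ->
    analytic0 (fun t z => F (t1 + t) (z1 + z)).
Proof.
  intros (r & M & H). assert (Hr := rep_r_pos _ _ _ H). exists (r / 2)%R. split; [lra|].
  intros t1 z1 Ht Hz. exists (r / 2)%R, M.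
  apply (rep_comp r M _ F (fun t _ => t1 + t) (fun _ z => z1 + z) H).
  - eapply rep_le; [apply (rep_plus _ _ _ _ _ (rep_const (r / 2) t1 ltac:(lra)) (rep_fst (r / 2) ltac:(lra)))| | |]; lra.
  - eapply rep_le; [apply (rep_plus _ _ _ _ _ (rep_const (r / 2) z1 ltac:(lra)) (rep_snd (r / 2) ltac:(lra)))| | |]; lra.
Qed.

(** * Implicit functions *)

Section IFT.
Variables (A B : C -> C -> C) (R0 M sg r : R).
Hypothesis HA : expands R0 M A.
Hypothesis HB : expands R0 M B.
Hypothesis HM : (1 <= M)%R.
Hypothesis Hsg : (0 < sg <= R0 / 2)%R.
Hypothesis HsgM : (16 * (sg * M) <= 1)%R.
Hypothesis Hr : (0 < r <= R0)%R.
Hypothesis Hr1 : (8 * (r * (1 + M)) <= sg)%R.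
Hypothesis Hr2 : (16 * (r * M) <= R0)%R.

Let N (Y : C -> C -> C) (t z : C) : C := t * A t (Y t z) + Y t z ^ 2 * B t (Y t z).

Lemma rep_fst_R0 : expands r R0 (fun t _ => t).
Proof. eapply rep_le; [apply (rep_fst r)| | |]; lra. Qed.

(** The constants sg and r are chosen so that the nonlinear part N, composed
    with functions of bound sg, is a contraction of factor 1/2 for the norm-
    like bound. *)
Lemma ift_lip (D : R) (Y Y' : C -> C -> C) :
  expands r sg Y -> expands r sg Y' -> expands r D (fun t z => Y t z - Y' t z) ->
  expands r (D / 2) (fun t z => N Y t z - N Y' t z).
Proof.
  intros HY HY' HD. assert (PD := rep_M_pos _ _ _ HD).
  assert (HR : (0 < R0)%R) by lra.
  assert (GY : expands r (R0 / 2) Y) by (eapply rep_le; [exact HY| | |]; lra).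
  assert (GY' : expands r (R0 / 2) Y') by (eapply rep_le; [exact HY'| | |]; lra).
  assert (LA := rep_lip R0 M r D A _ Y Y' HA rep_fst_R0 GY GY' HD).
  assert (LB := rep_lip R0 M r D B _ Y Y' HB rep_fst_R0 GY GY' HD).
  assert (GBY : expands r M (fun t z => B t (Y t z))).
  { apply (rep_comp R0 M r B (fun t _ => t) Y HB rep_fst_R0). eapply rep_le; [exact HY| | |]; lra. }
  assert (T1 := rep_mult _ _ _ _ _ (rep_fst r ltac:(lra)) LA).
  assert (T2 := rep_mult _ _ _ _ _ (rep_mult _ _ _ _ _ (rep_plus _ _ _ _ _ HY HY') HD) GBY).
  assert (T3 := rep_mult _ _ _ _ _ (rep_pow _ _ _ 2 HY') LB).
  eapply rep_ext; [eapply rep_le; [apply (rep_plus _ _ _ _ _ (rep_plus _ _ _ _ _ T1 T2) T3)| | |]|].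
  - lra.
  - lra.
  - assert (Hi : (0 < / R0)%R) by (apply Rinv_0_lt_compat; lra).
    replace (2 * M / R0 * D)%R with (2 * (M * / R0) * D)%R by (unfold Rdiv; ring).
    assert (E1 : (16 * (r * (M * / R0)) <= 1)%R).
    { replace (16 * (r * (M * / R0)))%R with ((16 * (r * M)) * / R0)%R by ring.
      rewrite <- (Rinv_r R0) by lra. apply Rmult_le_compat_r; lra. }
    assert (E2 : (sg * / R0 <= / 2)%R).
    { replace (/ 2)%R with (R0 / 2 * / R0)%R by (field; lra). apply Rmult_le_compat_r; lra. }
    assert (E3 : (sg ^ 2 * (M * / R0) <= / 32)%R).
    { replace (sg ^ 2 * (M * / R0))%R with ((sg * M) * (sg * / R0))%R by ring.
      replace (/ 32)%R with (/ 16 * / 2)%R by lra.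
      apply Rmult_le_compat; try lra; apply Rmult_le_pos; lra. }
    replace (r * (2 * (M * / R0) * D) + (sg + sg) * D * M + sg ^ 2 * (2 * (M * / R0) * D))%R
      with ((2 * (r * (M * / R0)) + 2 * (sg * M) + 2 * (sg ^ 2 * (M * / R0))) * D)%R by ring.
    replace (D / 2)%R with (/ 2 * D)%R by field.
    apply Rmult_le_compat_r; lra.
  - intros t z _ _. unfold N. simpl. ring.
Qed.

(** The functional estimate applied to constant functions. *)
Lemma ift_lip_pt (t y y' : C) :
  (Cmod t <= r)%R -> (Cmod y <= sg)%R -> (Cmod y' <= sg)%R ->
  (Cmod ((t * A t y + y ^ 2 * B t y) - (t * A t y' + y' ^ 2 * B t y')) <= Cmod (y - y') / 2)%R.
Proof.
  intros Ht Hy Hy'.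
  assert (C1 : forall x, (Cmod x <= sg)%R -> expands r sg (fun _ _ => x)).
  { intros x Hx. eapply rep_le; [apply (rep_const r x)| | |]; lra. }
  assert (L := ift_lip (Cmod (y - y')) _ _ (C1 y Hy) (C1 y' Hy') (rep_const r (y - y') ltac:(lra))).
  apply (rep_bound _ _ _ t 0 L Ht). rewrite Cmod_0. lra.
Qed.

Lemma ift_uniq (t y y' : C) :
  (Cmod t <= r)%R -> (Cmod y <= sg)%R -> (Cmod y' <= sg)%R ->
  y + (t * A t y + y ^ 2 * B t y) = y' + (t * A t y' + y' ^ 2 * B t y') -> y = y'.
Proof.
  intros Ht Hy Hy' E. assert (L := ift_lip_pt t y y' Ht Hy Hy').
  set (n := t * A t y + y ^ 2 * B t y) in *. set (n' := t * A t y' + y' ^ 2 * B t y') in *.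
  replace (n - n') with (- (y - y')) in L.
  - rewrite Cmod_opp in L. assert (P := Cmod_ge_0 (y - y')).
    assert (Z : Cmod (y - y') = 0%R) by lra. apply Cmod_eq_0 in Z.
    replace y with ((y - y') + y') by ring. rewrite Z. ring.
  - replace n with (y + n - y) by ring. rewrite E. ring.
Qed.

Fixpoint picard (n : nat) : C -> C -> C :=
  match n with
  | O => fun _ _ => 0
  | S n => fun t z => z - N (picard n) t z
  end.

Lemma rep_picard (n : nat) : expands r (sg / 2) (picard n).
Proof.
  induction n as [|n IH].
  - simpl. eapply rep_le; [apply (rep_zero r)| | |]; lra.
  - assert (GY : expands r R0 (picard n)) by (eapply rep_le; [exact IH| | |]; lra).
    assert (T1 := rep_mult _ _ _ _ _ (rep_fst r ltac:(lra)) (rep_comp R0 M r A _ _ HA rep_fst_R0 GY)).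
    assert (T2 := rep_mult _ _ _ _ _ (rep_pow _ _ _ 2 IH) (rep_comp R0 M r B _ _ HB rep_fst_R0 GY)).
    eapply rep_ext; [eapply rep_le; [apply (rep_minus _ _ _ _ _ (rep_snd r ltac:(lra)) (rep_plus _ _ _ _ _ T1 T2))| | |]|].
    + lra.
    + lra.
    + assert (E : ((sg / 2) ^ 2 * M = sg * (sg * M) / 4)%R) by (field; lra). rewrite E.
      assert (sg * (sg * M) <= sg * / 16)%R by (apply Rmult_le_compat_l; lra). lra.
    + intros t z _ _. reflexivity.
Qed.

Lemma rep_picard_diff (n : nat) : expands r (sg / 2 * (/ 2) ^ n) (fun t z => picard (S n) t z - picard n t z).
Proof.
  assert (GI : forall n, expands r sg (picard n))
    by (intros m; eapply rep_le; [apply rep_picard| | |]; lra).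
  induction n as [|n IH].
  - eapply rep_ext; [eapply rep_le; [apply (rep_picard 1)| | |]|]; try lra.
    intros t z _ _. simpl. ring.
  - assert (L := ift_lip _ _ _ (GI (S n)) (GI n) IH).
    eapply rep_ext; [eapply rep_le; [apply (rep_opp _ _ _ L)| | |]|]; try lra.
    + simpl. lra.
    + intros t z _ _. change (picard (S (S n)) t z) with (z - N (picard (S n)) t z).
      change (picard (S n) t z) with (z - N (picard n) t z). cbv beta. ring.
Qed.

(** The telescoping series of the successive approximations has geometric
    bounds. *)
Lemma ift_solution : exists Y, expands r sg Y /\
  forall t z, (Cmod t <= r)%R -> (Cmod z <= r)%R ->
    Y t z + (t * A t (Y t z) + Y t z ^ 2 * B t (Y t z)) = z.
Proof.
  destruct (rep_sum_ex r (fun n => (sg / 2 * (/ 2) ^ n)%R) sg (fun n t z => picard (S n) t z - picard n t z))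
    as (Y & HY & SY).
  - exact rep_picard_diff.
  - intros n. rewrite sum_n_scal.
    rewrite sum_half_pow. assert (P := pow_le (/ 2) n ltac:(lra)).
    replace sg with (sg / 2 * 2)%R at 2 by field. apply Rmult_le_compat_l; lra.
  - exists Y. split; [exact HY|]. intros t z Ht Hz.
    specialize (SY t z Ht Hz).
    assert (tel : forall n, sum_n (fun n => picard (S n) t z - picard n t z) n = picard (S n) t z).
    { induction n as [|n IH]; [rewrite sum_O; simpl; ring|].
      rewrite sum_Sn, IH. change (@plus C_AbelianMonoid) with Cplus.
      change (picard (S n) t z + (picard (S (S n)) t z - picard (S n) t z) = picard (S (S n)) t z). ring. }
    assert (BY := rep_bound _ _ _ t z HY Ht Hz).
    set (y := Y t z) in *. set (e := y + (t * A t y + y ^ 2 * B t y) - z).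
    assert (Z : Cmod e = 0%R).
    { apply Rle_antisym; [|apply Cmod_ge_0]. apply le_epsilon. intros eps Heps. rewrite Rplus_0_l.
      destruct (proj1 (is_series_C_eps _ _) SY (eps / 2)%R ltac:(lra)) as [n Hn].
      assert (H1 := Hn n (Nat.le_refl n)). assert (H2 := Hn (S n) (Nat.le_succ_diag_r n)).
      rewrite tel in H1, H2.
      assert (BI : (Cmod (picard (S n) t z) <= sg)%R)
        by (assert (Q := rep_bound _ _ _ t z (rep_picard (S n)) Ht Hz); lra).
      assert (L := ift_lip_pt t y (picard (S n) t z) Ht BY BI).
      change (picard (S (S n)) t z) with (z - N (picard (S n)) t z) in H2. unfold N in H2.
      set (x := picard (S n) t z) in *. set (n1 := t * A t y + y ^ 2 * B t y) in *.
      set (n2 := t * A t x + x ^ 2 * B t x) in *.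
      replace e with (- (z - n2 - y) + (n1 - n2)) by (unfold e; ring).
      assert (T := Cmod_triangle (- (z - n2 - y)) (n1 - n2)). rewrite Cmod_opp in T.
      replace (y - x) with (- (x - y)) in L by ring. rewrite Cmod_opp in L.
      assert (P := Cmod_ge_0 (x - y)). lra. }
    apply Cmod_eq_0 in Z. unfold e in Z.
    match goal with |- ?l = _ => replace l with ((l - z) + z) by ring end. rewrite Z. ring.
Qed.
End IFT.

(** The equation y + t A(t,y) + y^2 B(t,y) = z has y as its linear part in y
    at t = 0, so the remaining part is a contraction in y near the origin. The
    last clause is the uniqueness of the solution, in the form of a left
    inverse. *)
Theorem implicit_function (A B : C -> C -> C) : analytic0 A -> analytic0 B ->
  exists Y, analytic0 Y /\ Y 0 0 = 0 /\
    near (fun t z => Y t z + (t * A t (Y t z) + Y t z ^ 2 * B t (Y t z)) = z) /\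
    near (fun t y => Y t (y + (t * A t y + y ^ 2 * B t y)) = y).
Proof.
  intros HA HB. destruct (rep2 A B HA HB) as (R0 & M & HR & HM & GA & GB).
  (* The radius sg makes the quadratic term a contraction, then r makes the
     term with factor t small compared with sg. *)
  set (sg := (R0 / (16 * M))%R).
  assert (Es : (sg * (16 * M) = R0)%R) by (unfold sg; field; lra).
  assert (Ps : (0 < sg)%R) by (unfold sg; apply Rdiv_lt_0_compat; lra).
  assert (Hsg : (0 < sg <= R0 / 2)%R) by (split; [exact Ps|nra]).
  assert (HsgM : (16 * (sg * M) <= 1)%R) by lra.
  set (r := (sg / (8 * (1 + M)))%R).
  assert (Er : (8 * (r * (1 + M)) = sg)%R) by (unfold r; field; lra).
  assert (Pr : (0 < r)%R) by (unfold r; apply Rdiv_lt_0_compat; lra).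
  assert (Lr : (8 * r <= sg)%R) by nra.
  assert (Hr : (0 < r <= R0)%R) by lra.
  assert (Hr1 : (8 * (r * (1 + M)) <= sg)%R) by lra.
  assert (Hr2 : (16 * (r * M) <= R0)%R) by nra.
  destruct (ift_solution A B R0 M sg r GA GB HM Hsg HsgM Hr Hr1 Hr2) as (Y & HY & SY).
  assert (U := ift_uniq A B R0 M sg r GA GB HM Hsg HsgM Hr Hr2).
  exists Y. split; [now exists r, sg|]. split; [|split].
  - assert (Z0 : (Cmod 0 <= r)%R) by (rewrite Cmod_0; lra).
    apply (U 0); auto.
    + exact (rep_bound _ _ _ _ _ HY Z0 Z0).
    + rewrite Cmod_0. lra.
    + rewrite (SY 0 0 Z0 Z0). simpl. ring.
  - exists r. split; [lra|]. intros t z Ht Hz. apply SY; lra.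
  - set (d := (r / (2 + 2 * M))%R).
    assert (Ed : (d * (2 + 2 * M) = r)%R) by (unfold d; field; lra).
    assert (Pd : (0 < d)%R) by (unfold d; apply Rdiv_lt_0_compat; lra).
    assert (Ld : (2 * d <= r)%R) by nra.
    exists d. split; [exact Pd|]. intros t y Ht Hy.
    assert (BA := rep_bound _ _ _ t y GA ltac:(lra) ltac:(lra)).
    assert (BB := rep_bound _ _ _ t y GB ltac:(lra) ltac:(lra)).
    set (z := y + (t * A t y + y ^ 2 * B t y)).
    assert (Hz : (Cmod z <= r)%R).
    { unfold z. eapply Rle_trans; [apply Cmod_triangle|].
      assert (T := Cmod_triangle (t * A t y) (y ^ 2 * B t y)).
      rewrite !Cmod_mult, Cmod_pow in T.
      assert (P1 := Cmod_ge_0 t). assert (P2 := Cmod_ge_0 y).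
      assert (P3 := Cmod_ge_0 (A t y)). assert (P4 := Cmod_ge_0 (B t y)).
      assert (Q1 : (Cmod t * Cmod (A t y) <= d * M)%R) by (apply Rmult_le_compat; lra).
      assert (Q2 : (Cmod y ^ 2 <= d)%R).
      { simpl. rewrite Rmult_1_r. assert (d <= 1)%R by lra. nra. }
      assert (Q3 : (Cmod y ^ 2 * Cmod (B t y) <= d * M)%R).
      { apply Rmult_le_compat; try lra. apply pow_le; lra. }
      nra. }
    apply (U t).
    + lra.
    + exact (rep_bound r sg Y t z HY ltac:(lra) Hz).
    + lra.
    + rewrite (SY t z) by lra. reflexivity.
Qed.

(** * Division, parity and invariant curves *)

(** Syntactic decomposition of an arithmetic expression in analytic germs;
    matching on the head symbol keeps unification from unfolding the complex
    operations. *)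
Ltac an_arith :=
  lazymatch goal with
  | |- analytic0 (fun t z => @?F t z + @?G t z) => apply (an_plus F G); an_arith
  | |- analytic0 (fun t z => @?F t z - @?G t z) => apply (an_minus F G); an_arith
  | |- analytic0 (fun t z => @?F t z * @?G t z) => apply (an_mult F G); an_arith
  | |- analytic0 (fun t z => - @?F t z) => apply (an_opp F); an_arith
  | |- analytic0 (fun t z => @?F t z ^ ?n) => apply (an_pow F n); an_arith
  | |- analytic0 (fun t z => t) => exact an_fst
  | |- analytic0 (fun t z => z) => exact an_snd
  | |- analytic0 (fun _ _ => ?c) => exact (an_const c)
  | |- _ => try assumption
  end.

Lemma an_comp1 (f : C -> C) (X : C -> C -> C) :
  analytic0 (fun t _ => f t) -> analytic0 X -> X 0 0 = 0 -> analytic0 (fun t z => f (X t z)).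
Proof. intros Hf HX X0. exact (an_comp (fun t _ => f t) X (fun t z => X t z) Hf HX HX X0 X0). Qed.

Lemma near_comp1 (P : C -> Prop) (X : C -> C -> C) :
  near (fun t _ => P t) -> analytic0 X -> X 0 0 = 0 -> near (fun t z => P (X t z)).
Proof. intros HP HX X0. exact (near_comp (fun t _ => P t) X X HP HX HX X0 X0). Qed.

(** The implicit function theorem solves y + t y = z, that is y = z / (1 + t). *)
Lemma an_inv (F : C -> C -> C) : analytic0 F -> F 0 0 <> 0 -> analytic0 (fun t z => / F t z).
Proof.
  intros HF F0.
  destruct (implicit_function (fun _ z => z) (fun _ _ => 0) an_snd (an_const 0))
    as (Y & HY & Y0 & EY & _).
  set (X := fun t z => / F 0 0 * F t z - 1).
  assert (HX : analytic0 X) by (apply an_minus; [apply an_mult; [apply an_const|exact HF]|apply an_const]).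
  assert (X0 : X 0 0 = 0) by (unfold X; field; exact F0).
  apply (an_ext (fun t z => / F 0 0 * (1 - Y (X t z) (X t z)))).
  - apply an_mult; [apply an_const|]. apply an_minus; [apply an_const|].
    now apply (an_comp Y X X).
  - eapply near_imp; [|exact (near_and _ _ (near_comp _ X X EY HX HX X0 X0) (an_nonzero F HF F0))].
    intros t z [E Fn]. cbv beta in E.
    assert (E2 : (1 - Y (X t z) (X t z)) * (1 + X t z) = 1).
    { set (x := X t z) in *. set (y := Y x x) in *.
      replace ((1 - y) * (1 + x)) with (1 + x - (y + (x * y + y ^ 2 * 0))) by ring.
      rewrite E. ring. }
    assert (E3 : 1 + X t z = / F 0 0 * F t z) by (unfold X; ring). rewrite E3 in E2.
    replace (/ F t z) with (((1 - Y (X t z) (X t z)) * (/ F 0 0 * F t z)) * / F t z)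
      by (rewrite E2; ring).
    field. now split.
Qed.

Lemma an_div (F G : C -> C -> C) : analytic0 F -> analytic0 G -> G 0 0 <> 0 -> analytic0 (fun t z => F t z / G t z).
Proof. intros HF HG G0. apply an_mult; [exact HF|]. now apply an_inv. Qed.

Lemma even_odd (f : C -> C) : analytic0 (fun t _ => f t) ->
  exists P Q : C -> C, analytic0 (fun t _ => P t) /\ analytic0 (fun t _ => Q t) /\
    near (fun s _ => f s = P (s ^ 2) + s * Q (s ^ 2)).
Proof.
  intros Hf. destruct (rep2 _ _ Hf Hf) as (r & M & Hr & _ & H & _).
  destruct (rep_even_odd r M _ ltac:(lra) H) as (P & Q & HP & HQ & E).
  exists P, Q. split; [now exists (r ^ 2)%R, M|]. split; [now exists (r ^ 2)%R, (M / r)%R|].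
  exists r. split; [lra|]. intros s z Hs _. apply E; lra.
Qed.

Lemma an_star1 (f : C -> C) : analytic0 (fun t _ => f t) -> analytic0 (fun t _ => Cconj (f (Cconj t))).
Proof. intros H. exact (an_star _ H). Qed.

(** The functions with real coefficients: they take real values at real
    points. *)
Definition conj_invariant (f : C -> C) : Prop := forall t, Cconj (f (Cconj t)) = f t.

Lemma near_conj (P : C -> C -> Prop) : near P -> near (fun t z => P (Cconj t) (Cconj z)).
Proof. intros (d & Hd & H). exists d. split; [exact Hd|]. intros t z Ht Hz. apply H; now rewrite Cmod_conj. Qed.

Lemma Cconj_R (x : R) : Cconj (RtoC x) = RtoC x.
Proof. unfold Cconj, RtoC. simpl. f_equal. ring. Qed.

(** Averaging the two parts with their conjugates does not change f, and makes
    them exactly real. *)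
Lemma even_odd_real (f : C -> C) : analytic0 (fun t _ => f t) ->
  near (fun s _ => Cconj (f (Cconj s)) = f s) ->
  exists P Q : C -> C, analytic0 (fun t _ => P t) /\ analytic0 (fun t _ => Q t) /\ conj_invariant P /\ conj_invariant Q /\
    near (fun s _ => f s = P (s ^ 2) + s * Q (s ^ 2)).
Proof.
  intros Hf Sf. destruct (even_odd f Hf) as (P & Q & HP & HQ & E).
  assert (avg : forall g : C -> C, analytic0 (fun t _ => g t) ->
     analytic0 (fun t _ => / 2 * (g t + Cconj (g (Cconj t)))) /\
     conj_invariant (fun t => / 2 * (g t + Cconj (g (Cconj t))))).
  { intros g Hg. split.
    - apply an_mult; [apply an_const|]. apply an_plus; [exact Hg|now apply an_star1].
    - intros t. rewrite Cmult_conj, Cplus_conj, !Cconj_conj.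
      rewrite Cinv_conj, Cconj_R; [ring|]. intros H. apply (RtoC_inj 2 0) in H. lra. }
  exists (fun t => / 2 * (P t + Cconj (P (Cconj t)))), (fun t => / 2 * (Q t + Cconj (Q (Cconj t)))).
  split; [apply avg, HP|]. split; [apply avg, HQ|]. split; [apply avg, HP|]. split; [apply avg, HQ|].
  eapply near_imp; [|exact (near_and _ _ (near_and _ _ E (near_conj _ E)) Sf)].
  intros s _ [[E1 E2] E3].
  assert (E4 : f s = / 2 * (f s + Cconj (f (Cconj s)))) by (rewrite E3; field).
  rewrite E4, E1, E2. rewrite Cplus_conj, Cmult_conj, Cconj_conj, Cpow_conj. ring.
Qed.

Lemma an_tz2 : analytic0 (fun t z => t - z ^ 2).
Proof. apply an_minus; [apply an_fst|apply an_pow, an_snd]. Qed.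

(** The remainder is the parity splitting of s -> F(s^2, s). After subtraction
    the function vanishes at t = z^2, and in the coordinates (t - z^2, z) the
    division is by a coordinate. *)
Lemma division (F : C -> C -> C) : analytic0 F ->
  exists (b0 b1 : C -> C) (Q : C -> C -> C),
    analytic0 (fun t _ => b0 t) /\ analytic0 (fun t _ => b1 t) /\ analytic0 Q /\
    near (fun t z => F t z = b0 t + z * b1 t + (z ^ 2 - t) * Q t z).
Proof.
  intros HF.
  destruct (even_odd (fun s => F (s ^ 2) s)) as (P & Q & HP & HQ & E).
  { apply (an_comp F (fun t _ => t ^ 2) (fun t _ => t)); [exact HF|apply an_pow, an_fst|apply an_fst|ring|ring]. }
  set (H := fun u z : C => F (z ^ 2 + u) z - (P (z ^ 2 + u) + z * Q (z ^ 2 + u))).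
  assert (A1 : analytic0 (fun u z => z ^ 2 + u)) by (apply an_plus; [apply an_pow, an_snd|apply an_fst]).
  assert (A0 : 0 ^ 2 + 0 = RtoC 0) by ring.
  assert (HH : analytic0 H).
  { apply an_minus; [apply (an_comp F _ _ HF A1 an_snd A0 eq_refl)|].
    apply an_plus; [exact (an_comp1 P _ HP A1 A0)|].
    apply an_mult; [apply an_snd|exact (an_comp1 Q _ HQ A1 A0)]. }
  destruct (an_div_fst H HH) as (K & HK & EK).
  exists P, Q, (fun t z => - K (t - z ^ 2) z).
  assert (T0 : 0 - 0 ^ 2 = RtoC 0) by ring.
  split; [exact HP|]. split; [exact HQ|]. split.
  - apply an_opp. exact (an_comp K _ _ HK an_tz2 an_snd T0 eq_refl).
  - eapply near_imp; [|exact (near_and _ _ (near_comp _ _ _ EK an_tz2 an_snd T0 eq_refl)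
      (near_comp1 _ (fun _ z => z) E an_snd eq_refl))].
    intros t z [E1 E2]. unfold H in E1.
    replace (z ^ 2 + (t - z ^ 2)) with t in E1 by ring.
    replace (z ^ 2 + 0) with (z ^ 2) in E1 by ring.
    rewrite E2 in E1.
    replace (F t z) with (F t z - (P t + z * Q t) + (P t + z * Q t)) by ring.
    rewrite E1. ring.
Qed.

(** * Square roots and the curve of fixed points *)

Lemma csqrt_sq (t : R) : csqrt t ^ 2 = RtoC t.
Proof.
  unfold csqrt. destruct (Rle_dec 0 t) as [H|H].
  - assert (E := sqrt_sqrt t H). apply injective_projections; simpl; nra.
  - assert (E := sqrt_sqrt (- t) ltac:(lra)). apply injective_projections; simpl; nra.
Qed.

Lemma Cmod_lt_of_sq (s : C) (eta d : R) : (0 < d)%R ->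
  s ^ 2 = RtoC eta -> (Rabs eta < d ^ 2)%R -> (Cmod s < d)%R.
Proof.
  intros Hd E H. rewrite <- Cmod_R, <- E, Cmod_pow in H.
  assert (P := Cmod_ge_0 s). simpl in H. nra.
Qed.

Lemma Cmult_integral (a b : C) : a * b = 0 -> a = 0 \/ b = 0.
Proof.
  intros H. destruct (Ceq_dec a 0) as [|Ha]; [now left|]. right.
  replace b with (/ a * (a * b)) by (field; exact Ha). rewrite H. ring.
Qed.

Lemma Csub_eq (a b : C) : a - b = 0 -> a = b.
Proof. intros H. replace a with ((a - b) + b) by ring. rewrite H. ring. Qed.

Lemma Csq_eq (a b : C) : a ^ 2 = b ^ 2 -> a = b \/ a = - b.
Proof.
  intros H. destruct (Cmult_integral (a - b) (a + b)) as [E|E].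
  - replace ((a - b) * (a + b)) with (a ^ 2 - b ^ 2) by ring. rewrite H. ring.
  - left. now apply Csub_eq.
  - right. apply Csub_eq. rewrite <- E. ring.
Qed.

(** Continuity at the origin extends identities from real nonzero parameters,
    where the two square roots are distinct, to the parameter zero. *)
Lemma value_at_0 (f : C -> C) (c : C) : analytic0 (fun t _ => f t) ->
  near (fun t _ => forall eta : R, t = RtoC eta -> eta <> 0%R -> f t = c) -> f 0 = c.
Proof.
  intros Hf (d & Hd & H). apply Csub_eq, Cmod_eq_0. apply Rle_antisym; [|apply Cmod_ge_0].
  apply le_epsilon. intros e He. rewrite Rplus_0_l.
  destruct (an_cont _ e Hf He) as (d' & Hd' & H').
  assert (A := Rmin_l d d'). assert (B := Rmin_r d d').
  assert (P : (0 < Rmin d d')%R) by (apply Rmin_pos; lra).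
  set (x := (Rmin d d' / 2)%R).
  assert (Cx : Cmod (RtoC x) = x) by (rewrite Cmod_R; apply Rabs_pos_eq; unfold x; lra).
  assert (Z : (Cmod 0 = 0)%R) by apply Cmod_0.
  specialize (H' (RtoC x) 0 ltac:(unfold x in *; lra) ltac:(lra)).
  rewrite (H (RtoC x) 0 ltac:(unfold x in *; lra) ltac:(lra) x eq_refl ltac:(unfold x; lra)) in H'.
  replace (c - f 0) with (- (f 0 - c)) in H' by ring. rewrite Cmod_opp in H'. lra.
Qed.

Lemma sq_split (s a b a' b' : C) : s <> 0 ->
  a + s * b = a' + s * b' -> a + - s * b = a' + - s * b' -> a = a' /\ b = b'.
Proof.
  intros Hs H1 H2. split.
  - replace a with (/ 2 * ((a + s * b) + (a + - s * b))) by field.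
    rewrite H1, H2. field.
  - replace b with (/ 2 * / s * ((a + s * b) - (a + - s * b))) by (field; exact Hs).
    rewrite H1, H2. field. exact Hs.
Qed.

Lemma csqrt_neq_0 (eta : R) : eta <> 0%R -> csqrt eta <> 0.
Proof.
  intros H E. assert (E2 := csqrt_sq eta). rewrite E in E2.
  replace (0 ^ 2) with (RtoC 0) in E2 by ring. apply (RtoC_inj 0 eta) in E2. lra.
Qed.

Lemma opp_sq (s : C) : (- s) ^ 2 = s ^ 2.
Proof. ring. Qed.

(** The remainder b_0 + z b_1 of the division equals z at both square roots of
    t, hence b_0 = 0 and b_1 = 1 for real nonzero t, and also at zero by
    continuity. *)
Lemma fixed_curve (F : C -> C -> C) : analytic0 F ->
  near (fun t z => forall eta : R, t = RtoC eta -> forall s, s ^ 2 = t -> F t s = s) ->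
  exists K, analytic0 K /\ near (fun t z => forall eta : R, t = RtoC eta ->
     F t z = z + (z ^ 2 - t) * K t z).
Proof.
  intros HF Fix. destruct (division F HF) as (b0 & b1 & Q & H0 & H1 & HQ & E).
  exists Q. split; [exact HQ|].
  assert (Es : near (fun t z => forall eta : R, t = RtoC eta -> forall s, s ^ 2 = t ->
     F t s = b0 t + s * b1 t)).
  { destruct E as (d & Hd & E). exists (Rmin d (d ^ 2)). split; [apply Rmin_pos; [lra|apply pow_lt; lra]|].
    assert (A := Rmin_l d (d ^ 2)). assert (B := Rmin_r d (d ^ 2)).
    intros t z Ht Hz eta Et s Hs. rewrite E, Hs; [ring|lra|].
    rewrite Et, Cmod_R in Ht. apply (Cmod_lt_of_sq s eta d Hd); [congruence|lra]. }
  assert (N : near (fun t _ => forall eta : R, t = RtoC eta -> eta <> 0%R -> b0 t = 0 /\ b1 t = 1)).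
  { eapply near_imp; [|exact (near_and _ _ Fix Es)]. intros t z [A B] eta Et Hn.
    assert (S1 := csqrt_sq eta).
    assert (S2 : (- csqrt eta) ^ 2 = RtoC eta) by now rewrite opp_sq.
    apply (sq_split (csqrt eta)); [now apply csqrt_neq_0| |].
    - rewrite <- (B eta Et (csqrt eta)), (A eta Et (csqrt eta)); try congruence. ring.
    - rewrite <- (B eta Et (- csqrt eta)), (A eta Et (- csqrt eta)); try congruence. ring. }
  assert (Z0 : b0 0 = 0).
  { apply (value_at_0 b0); [exact H0|]. eapply near_imp; [|exact N]. intros t z H eta Et Hn. now apply (H eta). }
  assert (Z1 : b1 0 = 1).
  { apply (value_at_0 b1); [exact H1|]. eapply near_imp; [|exact N]. intros t z H eta Et Hn. now apply (H eta). }
  eapply near_imp; [|exact (near_and _ _ N E)]. intros t z [A B] eta Et. rewrite B.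
  assert (AB : b0 t = 0 /\ b1 t = 1).
  { destruct (Req_dec eta 0) as [->|Hn]; [subst t; now split|]. now apply (A eta). }
  destruct AB as [-> ->]. ring.
Qed.

(** * Complex derivatives *)

(** Complex differentiability by first order expansion, the form in which both
    real partial derivatives and complex limits are read off. *)
Definition cderiv (P : C -> C) (s l : C) : Prop :=
  forall e : R, (0 < e)%R -> exists d : R, (0 < d)%R /\
    forall h, (Cmod h < d)%R -> (Cmod (P (s + h)%C - P s - l * h)%C <= e * Cmod h)%R.

Lemma cderiv_ext_loc (P Q : C -> C) (s l : C) (d : R) : (0 < d)%R ->
  (forall z, (Cmod (z - s) < d)%R -> P z = Q z) -> cderiv P s l -> cderiv Q s l.
Proof.
  intros Hd E H e He. destruct (H e He) as (d' & Hd' & H').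
  exists (Rmin d d'). assert (A := Rmin_l d d'). assert (B := Rmin_r d d').
  split; [apply Rmin_pos; lra|]. intros h Hh.
  rewrite <- !E; [apply H'; lra| |].
  - replace (s - s) with (RtoC 0) by ring. now rewrite Cmod_0.
  - replace (s + h - s) with h by ring. lra.
Qed.

Lemma cderiv_unique (P : C -> C) (s l l' : C) : cderiv P s l -> cderiv P s l' -> l = l'.
Proof.
  intros H H'. apply Csub_eq, Cmod_eq_0. apply Rle_antisym; [|apply Cmod_ge_0].
  apply le_epsilon. intros e He. rewrite Rplus_0_l.
  destruct (H (e / 2)%R ltac:(lra)) as (d & Hd & D). destruct (H' (e / 2)%R ltac:(lra)) as (d' & Hd' & D').
  assert (A := Rmin_l d d'). assert (B := Rmin_r d d').
  assert (P0 : (0 < Rmin d d')%R) by (apply Rmin_pos; lra).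
  set (x := (Rmin d d' / 2)%R).
  assert (Cx : Cmod (RtoC x) = x) by (rewrite Cmod_R; apply Rabs_pos_eq; unfold x; lra).
  specialize (D (RtoC x) ltac:(unfold x in *; lra)). specialize (D' (RtoC x) ltac:(unfold x in *; lra)).
  set (q := P (s + RtoC x) - P s) in *.
  assert (T := Cmod_triangle (q - l' * RtoC x) (- (q - l * RtoC x))). rewrite Cmod_opp in T.
  replace (q - l' * RtoC x + - (q - l * RtoC x)) with ((l - l') * RtoC x) in T by ring.
  rewrite Cmod_mult, Cx in T. rewrite Cx in D, D'.
  assert (Px : (0 < x)%R) by (unfold x; lra).
  apply (Rmult_le_reg_r x); [exact Px|]. lra.
Qed.

Lemma cderiv_lip (P : C -> C) (s l : C) : cderiv P s l ->
  exists d, (0 < d)%R /\ forall h, (Cmod h < d)%R -> (Cmod (P (s + h)%C - P s)%C <= (Cmod l + 1) * Cmod h)%R.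
Proof.
  intros H. destruct (H 1%R ltac:(lra)) as (d & Hd & D). exists d. split; [exact Hd|].
  intros h Hh. specialize (D h Hh).
  assert (T := Cmod_triangle (P (s + h) - P s - l * h) (l * h)).
  replace (P (s + h) - P s - l * h + l * h) with (P (s + h) - P s) in T by ring.
  rewrite Cmod_mult in T. lra.
Qed.

Lemma cderiv_comp (P Q : C -> C) (s l m : C) :
  cderiv P (Q s) l -> cderiv Q s m -> cderiv (fun z => P (Q z)) s (l * m).
Proof.
  intros HP HQ e He. assert (Pl := Cmod_ge_0 l). assert (Pm := Cmod_ge_0 m).
  destruct (cderiv_lip Q s m HQ) as (d0 & Hd0 & D0).
  destruct (HP (e / (2 * (Cmod m + 1)))%R) as (d1 & Hd1 & D1); [apply Rdiv_lt_0_compat; lra|].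
  destruct (HQ (e / (2 * (Cmod l + 1)))%R) as (d2 & Hd2 & D2); [apply Rdiv_lt_0_compat; lra|].
  set (d3 := (d1 / (Cmod m + 1))%R).
  assert (Hd3 : (0 < d3)%R) by (apply Rdiv_lt_0_compat; lra).
  set (d := Rmin d0 (Rmin d2 d3)).
  assert (A1 := Rmin_l d0 (Rmin d2 d3)). assert (A2 := Rmin_r d0 (Rmin d2 d3)).
  assert (A3 := Rmin_l d2 d3). assert (A4 := Rmin_r d2 d3).
  exists d. split; [unfold d; repeat apply Rmin_pos; lra|]. unfold d. intros h Hh.
  assert (Ph := Cmod_ge_0 h).
  specialize (D0 h ltac:(lra)). specialize (D2 h ltac:(lra)).
  set (k := Q (s + h) - Q s) in *.
  assert (Kd : (Cmod k < d1)%R).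
  { eapply Rle_lt_trans; [exact D0|].
    replace d1 with ((Cmod m + 1) * d3)%R by (unfold d3; field; lra).
    apply Rmult_lt_compat_l; lra. }
  specialize (D1 k Kd). replace (Q s + k) with (Q (s + h)) in D1 by (unfold k; ring).
  replace (P (Q (s + h)) - P (Q s) - l * m * h)
    with ((P (Q (s + h)) - P (Q s) - l * k) + l * (k - m * h)) by ring.
  eapply Rle_trans; [apply Cmod_triangle|]. rewrite Cmod_mult.
  assert (I1 : (e / (2 * (Cmod m + 1)) * Cmod k <= e / 2 * Cmod h)%R).
  { replace (e / 2 * Cmod h)%R with (e / (2 * (Cmod m + 1)) * ((Cmod m + 1) * Cmod h))%R by (field; lra).
    apply Rmult_le_compat_l; [|exact D0]. apply Rlt_le, Rdiv_lt_0_compat; lra. }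
  assert (I2 : (Cmod l * Cmod (k - m * h) <= e / 2 * Cmod h)%R).
  { replace (e / 2 * Cmod h)%R with ((Cmod l + 1) * (e / (2 * (Cmod l + 1)) * Cmod h))%R by (field; lra).
    apply Rmult_le_compat; try lra. apply Cmod_ge_0. }
  lra.
Qed.

Lemma cderiv_conj (P : C -> C) (s l : C) :
  cderiv P (Cconj s) l -> cderiv (fun z => Cconj (P (Cconj z))) s (Cconj l).
Proof.
  intros H e He. destruct (H e He) as (d & Hd & D). exists d. split; [exact Hd|].
  intros h Hh. specialize (D (Cconj h)). rewrite !Cmod_conj in D. specialize (D Hh).
  rewrite <- Cplus_conj in D.
  rewrite <- Cmod_conj in D. rewrite !Cminus_conj, Cmult_conj, Cconj_conj in D. exact D.
Qed.

Lemma cderiv_scal (P : C -> C) (s l c : C) : cderiv P s l -> cderiv (fun z => c * P z) s (c * l).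
Proof.
  intros H e He. assert (Pc := Cmod_ge_0 c).
  destruct (H (e / (Cmod c + 1))%R) as (d & Hd & D); [apply Rdiv_lt_0_compat; lra|].
  exists d. split; [exact Hd|]. intros h Hh. specialize (D h Hh).
  replace (c * P (s + h) - c * P s - c * l * h) with (c * (P (s + h) - P s - l * h)) by ring.
  rewrite Cmod_mult. assert (Ph := Cmod_ge_0 h).
  replace (e * Cmod h)%R with ((Cmod c + 1) * (e / (Cmod c + 1) * Cmod h))%R by (field; lra).
  apply Rmult_le_compat; try lra. apply Cmod_ge_0.
Qed.

(** On the curve s^2 = a the derivative depends only on the linear remainder;
    the function q only has to be bounded. *)
Lemma cderiv_prepared (b0 b1 a s : C) (q : C -> C) (d M : R) :
  (0 < d)%R -> s ^ 2 = a -> (forall h, (Cmod h < d)%R -> (Cmod (q (s + h)%C) <= M)%R) ->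
  cderiv (fun w => w + (w ^ 2 - a) * (b0 + w * b1 + (w ^ 2 - a) * q w)) s (1 + 2 * s * (b0 + s * b1)).
Proof.
  intros Hd Hs HM e He.
  assert (P0 : (0 <= M)%R) by (eapply Rle_trans; [apply Cmod_ge_0|apply (HM 0); rewrite Cmod_0; lra]).
  set (k := (Cmod (2 * s * b1) + Cmod (b0 + s * b1) + Cmod b1 + (2 * Cmod s + 1) ^ 2 * M)%R).
  assert (Ps := Cmod_ge_0 s).
  assert (Pk : (0 <= k)%R).
  { unfold k. repeat apply Rplus_le_le_0_compat; try apply Cmod_ge_0.
    apply Rmult_le_pos; [apply pow2_ge_0|exact P0]. }
  assert (Q : (0 < e / (k + 1))%R) by (apply Rdiv_lt_0_compat; lra).
  set (d' := Rmin 1 (Rmin d (e / (k + 1)))).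
  assert (A1 := Rmin_l 1 (Rmin d (e / (k + 1)))). assert (A2 := Rmin_r 1 (Rmin d (e / (k + 1)))).
  assert (A3 := Rmin_l d (e / (k + 1))). assert (A4 := Rmin_r d (e / (k + 1))).
  exists d'. split; [unfold d'; repeat apply Rmin_pos; lra|]. unfold d'. intros h Hh.
  assert (Ph := Cmod_ge_0 h). specialize (HM h ltac:(lra)).
  set (qq := q (s + h)) in *.
  subst a.
  replace (s + h + ((s + h) ^ 2 - s ^ 2) * (b0 + (s + h) * b1 + ((s + h) ^ 2 - s ^ 2) * qq) -
    (s + (s ^ 2 - s ^ 2) * (b0 + s * b1 + (s ^ 2 - s ^ 2) * q s)) - (1 + 2 * s * (b0 + s * b1)) * h)
   with (h * h * (2 * s * b1 + (b0 + s * b1) + h * b1 + (2 * s + h) ^ 2 * qq)) by ring.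
  rewrite !Cmod_mult.
  assert (B : (Cmod (2 * s * b1 + (b0 + s * b1) + h * b1 + (2 * s + h) ^ 2 * qq) <= k)%R).
  { unfold k. eapply Rle_trans; [apply Cmod_triangle|]. apply Rplus_le_compat.
    - eapply Rle_trans; [apply Cmod_triangle|]. apply Rplus_le_compat; [apply Cmod_triangle|].
      rewrite Cmod_mult. assert (Pb := Cmod_ge_0 b1). nra.
    - rewrite Cmod_mult, Cmod_pow. apply Rmult_le_compat; try apply Cmod_ge_0; [|apply pow_incr|exact HM].
      + apply pow_le, Cmod_ge_0.
      + split; [apply Cmod_ge_0|]. eapply Rle_trans; [apply Cmod_triangle|].
        rewrite Cmod_mult, Cmod_R, Rabs_pos_eq by lra. lra. }
  set (X := Cmod (2 * s * b1 + (b0 + s * b1) + h * b1 + (2 * s + h) ^ 2 * qq)) in *.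
  assert (Hk : (Cmod h * k <= e)%R).
  { replace e with (e / (k + 1) * (k + 1))%R by (field; lra).
    apply Rmult_le_compat; lra. }
  apply (Rle_trans _ (Cmod h * Cmod h * k)%R).
  - apply Rmult_le_compat_l; [nra|exact B].
  - replace (Cmod h * Cmod h * k)%R with ((Cmod h * k) * Cmod h)%R by ring.
    now apply Rmult_le_compat_r.
Qed.

(** * Neighbourhoods and Wirtinger derivatives *)

Lemma locally_Cmod (z : C) (P : C -> Prop) :
  locally z P <-> exists d : R, (0 < d)%R /\ forall w, (Cmod (w - z) < d)%R -> P w.
Proof.
  split.
  - intros H. destruct (locally_norm_le_locally (K := C_AbsRing) (V := C_NormedModule) z P H) as [[d Hd] HP].
    exists d. split; [exact Hd|]. intros w Hw. now apply HP.
  - intros (d & Hd & HP). apply (locally_le_locally_norm (K := C_AbsRing) (V := C_NormedModule)).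
    exists (mkposreal d Hd). intros w Hw. now apply HP.
Qed.

Lemma Cminus_zero (z : C) : @minus C_AbelianGroup z (RtoC 0) = z.
Proof. apply injective_projections; unfold minus, plus, opp; simpl; ring. Qed.

Lemma locally_RC (P : R * C -> Prop) :
  locally origin P <-> exists d : R, (0 < d)%R /\
    forall t z, (Rabs t < d)%R -> (Cmod z < d)%R -> P (t, z).
Proof.
  split.
  - intros [[d Hd] HP]. simpl in HP. exists d. split; [exact Hd|]. intros t z Ht Hz.
    apply HP. split; simpl.
    + unfold ball; simpl. unfold AbsRing_ball, abs, minus, plus, opp; simpl.
      now rewrite Ropp_0, Rplus_0_r.
    + apply C_NormedModule_mixin_compat1.
      rewrite Cminus_zero. exact Hz.
  - intros (d & Hd & HP). assert (S2 : (0 < sqrt 2)%R) by (apply sqrt_lt_R0; lra).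
    assert (S3 : (1 <= sqrt 2)%R) by (rewrite <- sqrt_1; apply sqrt_le_1; lra).
    assert (Q : (0 < d / sqrt 2)%R) by (apply Rdiv_lt_0_compat; lra).
    assert (Q2 : (sqrt 2 * (d / sqrt 2) = d)%R) by (field; lra).
    exists (mkposreal _ Q). intros [t z] [B1 B2]. simpl in B1, B2. apply HP.
    + unfold ball in B1; simpl in B1. unfold AbsRing_ball, abs, minus, plus, opp in B1; simpl in B1.
      rewrite Ropp_0, Rplus_0_r in B1. nra.
    + apply (C_NormedModule_mixin_compat2 (RtoC 0) z (mkposreal _ Q)) in B2. simpl in B2.
      rewrite Cminus_zero in B2. lra.
Qed.

Lemma locally_R0 (P : R -> Prop) :
  locally 0%R P <-> exists d : R, (0 < d)%R /\ forall t, (Rabs t < d)%R -> P t.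
Proof.
  split.
  - intros [[d Hd] HP]. exists d. split; [exact Hd|]. intros t Ht. apply HP.
    unfold ball; simpl. unfold AbsRing_ball, abs, minus, plus, opp; simpl.
    now rewrite Ropp_0, Rplus_0_r.
  - intros (d & Hd & HP). exists (mkposreal _ Hd). intros t B. simpl in B. apply HP.
    unfold ball in B; simpl in B. unfold AbsRing_ball, abs, minus, plus, opp in B; simpl in B.
    now rewrite Ropp_0, Rplus_0_r in B.
Qed.

Lemma Derive_of_expansion (G : R -> C) (x0 : R) (m : C) :
  (forall e : R, (0 < e)%R -> exists d : R, (0 < d)%R /\
    forall h : R, (Rabs h < d)%R -> (Cmod (G (x0 + h)%R - G x0 - m * RtoC h)%C <= e * Rabs h)%R) ->
  (Derive (fun x => Re (G x)) x0, Derive (fun x => Im (G x)) x0) = m.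
Proof.
  intros H.
  assert (K : forall (p : C -> R), (forall a b, p (a - b) = (p a - p b)%R) ->
     (forall a (h : R), p (a * RtoC h) = (p a * h)%R) -> (forall a, (Rabs (p a) <= Cmod a)%R) ->
     is_derive (fun x => p (G x)) x0 (p m)).
  { intros p Pm Ps Pb. apply is_derive_Reals. intros e He.
    destruct (H (e / 2)%R ltac:(lra)) as (d & Hd & D). exists (mkposreal d Hd). simpl.
    intros h Hh Hd'. specialize (D h Hd').
    assert (B := Pb (G (x0 + h)%R - G x0 - m * RtoC h)). rewrite !Pm, Ps in B.
    assert (Ph : (0 < Rabs h)%R) by now apply Rabs_pos_lt.
    replace ((p (G (x0 + h)%R) - p (G x0)) / h - p m)%R
      with ((p (G (x0 + h)%R) - p (G x0) - p m * h) * / h)%R by (field; exact Hh).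
    rewrite Rabs_mult, Rabs_inv.
    apply (Rmult_lt_reg_r (Rabs h)); [exact Ph|].
    rewrite Rmult_assoc, Rinv_l, Rmult_1_r by lra. nra. }
  apply injective_projections; simpl; apply is_derive_unique.
  - apply (K Re).
    + intros a b. reflexivity.
    + intros a h. unfold Re; simpl. ring.
    + apply re_le_Cmod.
  - apply (K Im).
    + intros a b. reflexivity.
    + intros a h. unfold Im; simpl. ring.
    + intros a. eapply Rle_trans; [|apply Rmax_Cmod]. apply Rmax_r.
Qed.

Lemma Cderive_x_of (f : C -> C) (z m : C) :
  (forall e : R, (0 < e)%R -> exists d : R, (0 < d)%R /\
    forall h : R, (Rabs h < d)%R -> (Cmod (f (z + RtoC h)%C - f z - m * RtoC h)%C <= e * Rabs h)%R) ->
  Cderive_x f z = m.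
Proof.
  intros H. apply (Derive_of_expansion (fun x => f (x, Im z))). intros e He.
  destruct (H e He) as (d & Hd & D). exists d. split; [exact Hd|]. intros h Hh.
  specialize (D h Hh). destruct z as [x y].
  replace ((x, y) + RtoC h) with (((x + h)%R, y) : C) in D; [exact D|].
  apply injective_projections; simpl; ring.
Qed.

Lemma Cderive_y_of (f : C -> C) (z m : C) :
  (forall e : R, (0 < e)%R -> exists d : R, (0 < d)%R /\
    forall h : R, (Rabs h < d)%R -> (Cmod (f (z + Ci * RtoC h)%C - f z - m * RtoC h)%C <= e * Rabs h)%R) ->
  Cderive_y f z = m.
Proof.
  intros H. apply (Derive_of_expansion (fun y => f (Re z, y))). intros e He.
  destruct (H e He) as (d & Hd & D). exists d. split; [exact Hd|]. intros h Hh.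
  specialize (D h Hh). destruct z as [x y].
  replace ((x, y) + Ci * RtoC h) with ((x, (y + h)%R) : C) in D; [exact D|].
  apply injective_projections; simpl; ring.
Qed.

Lemma Ci_sq : Ci * Ci = - (1).
Proof. apply injective_projections; simpl; ring. Qed.

(** Expansion along the real and imaginary directions, where the derivatives
    are l and i l. *)
Lemma dz_of_cderiv (g : C -> C) (z l : C) : cderiv g z l -> dz g z = l.
Proof.
  intros H. unfold dz.
  rewrite (Cderive_x_of g z l), (Cderive_y_of g z (l * Ci)).
  - replace (l - Ci * (l * Ci)) with (l * (1 - Ci * Ci)) by ring. rewrite Ci_sq. field.
  - intros e He. destruct (H e He) as (d & Hd & D). exists d. split; [exact Hd|]. intros h Hh.
    specialize (D (Ci * RtoC h)). rewrite Cmod_mult, Cmod_Ci, Rmult_1_l, Cmod_R in D.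
    replace (l * Ci * RtoC h) with (l * (Ci * RtoC h)) by ring. now apply D.
  - intros e He. destruct (H e He) as (d & Hd & D). exists d. split; [exact Hd|]. intros h Hh.
    specialize (D (RtoC h)). rewrite Cmod_R in D. now apply D.
Qed.

Lemma dzbar_of_cderiv (P : C -> C) (z l : C) :
  cderiv P (Cconj z) l -> dzbar (fun w => P (Cconj w)) z = l.
Proof.
  intros H. unfold dzbar.
  rewrite (Cderive_x_of _ z l), (Cderive_y_of _ z (- (l * Ci))).
  - replace (l + Ci * - (l * Ci)) with (l * (1 - Ci * Ci)) by ring. rewrite Ci_sq. field.
  - intros e He. destruct (H e He) as (d & Hd & D). exists d. split; [exact Hd|]. intros h Hh.
    specialize (D (- (Ci * RtoC h))). rewrite Cmod_opp, Cmod_mult, Cmod_Ci, Rmult_1_l, Cmod_R in D.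
    rewrite Cplus_conj. replace (Cconj (Ci * RtoC h)) with (- (Ci * RtoC h)).
    + replace (- (l * Ci) * RtoC h) with (l * - (Ci * RtoC h)) by ring. now apply D.
    + apply injective_projections; simpl; ring.
  - intros e He. destruct (H e He) as (d & Hd & D). exists d. split; [exact Hd|]. intros h Hh.
    specialize (D (RtoC h)). rewrite Cmod_R in D. rewrite Cplus_conj, Cconj_R. now apply D.
Qed.

Lemma C_derive_of_cderiv (g : C -> C) (z l : C) : cderiv g z l -> C_derive g z = l.
Proof.
  intros H. unfold C_derive. apply is_C_lim_unique.
  apply (proj2 (filterlim_locally_ball_norm (K := C_AbsRing) (U := C_NormedModule)
    (F := locally' z) (fun x : C => (g x - g z) / (x - z)) l)).
  intros [e He]. destruct (H (e / 2)%R ltac:(lra)) as (d & Hd & D).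
  apply locally_Cmod. exists d. split; [exact Hd|]. intros w Hw Hn.
  specialize (D (w - z) Hw). replace (z + (w - z)) with w in D by ring.
  assert (Hz : w - z <> 0) by (intros E; apply Hn; now apply Csub_eq).
  change (Cmod ((g w - g z) / (w - z) - l) < e)%R.
  assert (Pz := proj1 (Cmod_gt_0 _) Hz).
  apply (Rmult_lt_reg_r (Cmod (w - z))); [exact Pz|]. rewrite <- Cmod_mult.
  replace (((g w - g z) / (w - z) - l) * (w - z)) with (g w - g z - l * (w - z)) by (field; exact Hz).
  nra.
Qed.

(** * The principal logarithm near one *)

Lemma C_geometric (q : C) : (Cmod q < 1)%R -> is_series (fun n => q ^ n) (/ (1 - q)).
Proof.
  intros Hq.
  assert (N1 : 1 - q <> 0).
  { intros E. apply Csub_eq in E. rewrite <- E, Cmod_1 in Hq. lra. }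
  assert (S : forall n, sum_n (fun n => q ^ n) n - / (1 - q) = - (q ^ S n * / (1 - q))).
  { intros n. replace (sum_n (fun n => q ^ n) n) with ((1 - q ^ S n) / (1 - q)).
    - field. exact N1.
    - induction n as [|n IH].
      + rewrite sum_O. simpl. field. exact N1.
      + rewrite sum_Sn, <- IH. change (@plus C_AbelianMonoid) with Cplus.
        change ((1 - q ^ S (S n)) / (1 - q) = (1 - q ^ S n) / (1 - q) + q * q ^ n).
        rewrite !Cpow_S. field. exact N1. }
  apply is_series_C_eps. intros e He.
  assert (P1 : (0 < Cmod (/ (1 - q)))%R) by (apply Cmod_gt_0; intros E;
    assert (F : (1 - q) * / (1 - q) = 1) by (field; exact N1); rewrite E, Cmult_0_r in F;
    apply (RtoC_inj 0 1) in F; lra).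
  destruct (pow_lt_1_zero (Cmod q) ltac:(rewrite Rabs_pos_eq; [exact Hq|apply Cmod_ge_0])
     (e / Cmod (/ (1 - q)))%R ltac:(apply Rdiv_lt_0_compat; lra)) as [N HN].
  exists N. intros n Hn. rewrite S, Cmod_opp, Cmod_mult, Cmod_pow.
  specialize (HN (Datatypes.S n) ltac:(lia)).
  rewrite Rabs_pos_eq in HN by apply pow_le, Cmod_ge_0.
  replace e with (e / Cmod (/ (1 - q)) * Cmod (/ (1 - q)))%R by (field; lra).
  now apply Rmult_lt_compat_r.
Qed.

(** On the right half plane the argument is an arctangent, hence
    differentiable along a segment. *)
Lemma Carg_atan (x y : R) : (0 < x)%R -> Carg (x, y) = atan (y / x).
Proof.
  intros Hx. unfold Carg, Re, Im. simpl.
  assert (Pm : (0 < Cmod (x, y))%R).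
  { apply Cmod_gt_0. intros E. apply (f_equal fst) in E. simpl in E. lra. }
  assert (Em : (Cmod (x, y) ^ 2 = x ^ 2 + y ^ 2)%R) by (rewrite Cmod2_alt; reflexivity).
  set (m := Cmod (x, y)) in *.
  assert (E : acos (x / m) = atan (Rabs y / x)).
  { rewrite acos_atan by (apply Rdiv_lt_0_compat; lra). f_equal.
    replace (1 - (x / m)²)%R with ((Rabs y / m)²)%R.
    - rewrite sqrt_Rsqr.
      + field. lra.
      + apply Rdiv_le_0_compat; [apply Rabs_pos|lra].
    - unfold Rsqr, Rdiv. assert (A : (Rabs y * Rabs y = y ^ 2)%R).
      { rewrite <- Rabs_mult, Rabs_pos_eq by nra. ring. }
      replace (Rabs y * / m * (Rabs y * / m))%R with ((Rabs y * Rabs y) * (/ m * / m))%R by ring.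
      rewrite A. replace (y ^ 2)%R with (m ^ 2 - x ^ 2)%R by lra. field. lra. }
  rewrite E. destruct (Rle_dec 0 y).
  - now rewrite Rabs_pos_eq.
  - rewrite Rabs_left by lra. rewrite <- atan_opp. f_equal. field. lra.
Qed.

(** The coefficients of log(1 + x) / x. *)
Definition logc (n : nat) : C := RtoC ((-1) ^ n / INR (S n)).

Lemma Cmod_logc (n : nat) : (Cmod (logc n) <= 1)%R.
Proof.
  unfold logc. rewrite Cmod_R. unfold Rdiv. rewrite Rabs_mult, pow_1_abs, Rmult_1_l, Rabs_inv.
  assert (P : (1 <= INR (S n))%R) by (rewrite S_INR; assert (Q := pos_INR n); lra).
  rewrite Rabs_pos_eq by lra. rewrite <- Rinv_1. apply Rinv_le_contravar; lra.
Qed.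

(** For p the real or the imaginary part, the p-part of the logarithmic series
    at t x is a real power series in t whose derivative is the p-part of x /
    (1 + t x), by the geometric series. A function f with the same derivative
    and the same value at 0 agrees with it at t = 1. *)
Lemma log_path (p : C -> R) (x : C) (f : R -> R) :
  (forall a b, p (a + b) = (p a + p b)%R) ->
  (forall a (h : R), p (a * RtoC h) = (p a * h)%R) -> (forall a, (Rabs (p a) <= Cmod a)%R) ->
  (Cmod x <= / 2)%R ->
  (forall t, (0 <= t <= 1)%R -> is_derive f t (p (x / (1 + RtoC t * x)))) ->
  f 0%R = 0%R ->
  forall l, is_series (fun n => logc n * x ^ S n) l -> f 1%R = p l.
Proof.
  intros Pp Ps Pb Hx Hf f0 l Hl.
  assert (P0 : p 0 = 0%R).
  { assert (E := Pp 0 0). replace (0 + 0) with (RtoC 0) in E by ring. lra. }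
  assert (Pm : forall a b : C, (p a - p b)%R = p (a - b)).
  { intros a b. replace a with ((a - b) + b) at 1 by ring. rewrite Pp. ring. }
  set (a := fun n => match n with O => 0%R | S n => p (logc n * x ^ S n) end).
  assert (series_p : forall (b : nat -> C) (s : C), is_series b s -> is_series (fun n => p (b n)) (p s)).
  { intros b s Hb. change (is_lim_seq (sum_n (fun n => p (b n))) (p s)).
    apply is_lim_seq_spec. intros [e He].
    destruct (proj1 (is_series_C_eps b s) Hb e He) as [N HN]. exists N. intros n Hn. simpl.
    assert (E : sum_n (fun n => p (b n)) n = p (sum_n b n)).
    { clear Hn. induction n as [|n IH]; [now rewrite !sum_O|].
      rewrite !sum_Sn, IH. symmetry. apply Pp. }
    specialize (HN n Hn).
    apply (f_equal (fun q => (Rabs (q - p s))%R)) in E. rewrite Pm in E.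
    eapply Rle_lt_trans; [apply Req_le, E|]. eapply Rle_lt_trans; [apply Pb|exact HN]. }
  assert (rad : forall t, (0 <= t <= 1)%R -> Rbar_lt (Rabs t) (CV_radius a)).
  { intros t Ht. apply (Rbar_lt_le_trans _ 2).
    - simpl. rewrite Rabs_pos_eq; lra.
    - apply (proj1 (CV_radius_bounded a)). exists 1%R. intros [|n];
        [change (a 0%nat) with 0%R|change (a (S n)) with (p (logc n * x ^ S n))].
      + rewrite Rmult_0_l, Rabs_R0. lra.
      + rewrite <- Ps, RtoC_pow. eapply Rle_trans; [apply Pb|].
        replace (logc n * x ^ S n * RtoC 2 ^ S n) with (logc n * (x * RtoC 2) ^ S n)
          by (rewrite Cpow_mult_l; ring).
        rewrite Cmod_mult, Cmod_pow, Cmod_mult, Cmod_R, Rabs_pos_eq by lra.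
        rewrite <- (Rmult_1_l 1). apply Rmult_le_compat.
        * apply Cmod_ge_0.
        * apply pow_le. assert (P := Cmod_ge_0 x). nra.
        * apply Cmod_logc.
        * rewrite <- (pow1 (S n)). apply pow_incr. assert (P := Cmod_ge_0 x). lra. }
  assert (der : forall t, (0 <= t <= 1)%R -> is_derive (PSeries a) t (p (x / (1 + RtoC t * x)))).
  { intros t Ht. replace (p (x / (1 + RtoC t * x))) with (PSeries (PS_derive a) t).
    - apply is_derive_PSeries, rad, Ht.
    - apply is_pseries_unique. unfold is_pseries.
      assert (Hq : (Cmod (- (RtoC t * x)) < 1)%R).
      { rewrite Cmod_opp, Cmod_mult, Cmod_R, Rabs_pos_eq by lra. assert (P := Cmod_ge_0 x). nra. }
      assert (G := series_p _ _ (is_series_C_scal x _ _ (C_geometric _ Hq))).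
      replace (x / (1 + RtoC t * x)) with (x * / (1 - - (RtoC t * x)))
        by (unfold Cdiv; do 2 f_equal; ring).
      eapply is_series_ext; [|exact G]. intros n. simpl.
      unfold scal; simpl. unfold mult; simpl. unfold PS_derive. change (a (S n)) with (p (logc n * x ^ S n)).
      rewrite pow_n_pow, (Rmult_comm (t ^ n)).
      rewrite (Rmult_comm (INR (S n))), <- Ps, <- Ps, RtoC_pow. f_equal.
      replace (- (RtoC t * x)) with (RtoC (-1) * RtoC t * x).
      + assert (Pn : (INR (S n) <> 0)%R) by (apply not_0_INR; lia).
        assert (K : RtoC ((-1) ^ n / INR (S n)) * RtoC (INR (S n)) = RtoC (-1) ^ n).
        { rewrite <- RtoC_mult, <- RtoC_pow. f_equal. field. exact Pn. }
        rewrite !Cpow_mult_l, <- K, Cpow_S. unfold logc. ring.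
      + replace (RtoC (-1)) with (- (1)) by (rewrite <- RtoC_opp; reflexivity). ring. }
  assert (E : (f 0 - PSeries a 0 = f 1 - PSeries a 1)%R).
  { apply (eq_is_derive (fun t => (f t - PSeries a t)%R) 0 1); [|lra].
    intros t Ht. replace (@zero R_NormedModule) with (minus (p (x / (1 + RtoC t * x))) (p (x / (1 + RtoC t * x)))).
    - apply (is_derive_minus f (PSeries a) t); [apply Hf, Ht|apply der, Ht].
    - apply (minus_eq_zero (G := R_AbelianGroup)). }
  assert (A0 : PSeries a 0 = 0%R) by (rewrite PSeries_0; reflexivity).
  assert (A1 : PSeries a 1 = p l).
  { apply is_pseries_unique. unfold is_pseries.
    apply (is_series_decr_1 (K := R_AbsRing) (V := R_NormedModule)).
    match goal with |- is_series _ ?y => assert (Z : y = p l) end.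
    { unfold plus, opp, scal; simpl. unfold mult; simpl. ring. }
    rewrite Z. eapply is_series_ext; [|apply (series_p _ _ Hl)].
    intros n. change (a (S n)) with (p (logc n * x ^ S n)).
    unfold scal; simpl. unfold mult; simpl. rewrite pow_n_pow, pow1. change one with 1%R.
    rewrite !Rmult_1_l. reflexivity. }
  lra.
Qed.

Lemma Clog_series (x l : C) : (Cmod x <= / 2)%R ->
  is_series (fun n => logc n * x ^ S n) l -> Clog (1 + x) = l.
Proof.
  intros Hx Hl. destruct x as [a b].
  assert (Ha : (Rabs a <= / 2)%R).
  { eapply Rle_trans; [|exact Hx]. eapply Rle_trans; [|apply Rmax_Cmod]. apply Rmax_l. }
  apply Rabs_le_between in Ha.
  assert (Pt : forall t, (0 <= t <= 1)%R -> (0 < 1 + t * a)%R) by (intros; nra).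
  assert (Q : forall t, (0 <= t <= 1)%R -> (0 < (1 + t * a) ^ 2 + (t * b) ^ 2)%R).
  { intros t Ht. specialize (Pt t Ht). nra. }
  assert (quot : forall t, (0 <= t <= 1)%R -> ((a, b) : C) / (1 + RtoC t * (a, b)) =
    ((a * (1 + t * a) + t * b * b) / ((1 + t * a) ^ 2 + (t * b) ^ 2),
     b / ((1 + t * a) ^ 2 + (t * b) ^ 2))%R).
  { intros t Ht. specialize (Q t Ht).
    assert (N : 1 + RtoC t * (a, b) <> 0).
    { intros E. apply (f_equal fst) in E. simpl in E. specialize (Pt t Ht). nra. }
    apply injective_projections; simpl; field; nra. }
  unfold Clog. apply injective_projections.
  - change (ln (Cmod (1 + (a, b))) = Re l). rewrite <- (log_path Re (a, b) (fun t => ln (sqrt ((1 + t * a) ^ 2 + (t * b) ^ 2)))) with (l := l).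
    + unfold Cmod. simpl. do 2 f_equal. ring.
    + reflexivity.
    + intros c h. unfold Re; simpl. ring.
    + apply re_le_Cmod.
    + exact Hx.
    + intros t Ht. rewrite quot by exact Ht. simpl. specialize (Q t Ht).
      assert (S := sqrt_lt_R0 _ Q). assert (S2 := sqrt_sqrt _ (Rlt_le _ _ Q)).
      auto_derive.
      * simpl in *. repeat split; try lra.
      * simpl in *. set (s := sqrt _) in *. rewrite <- S2. field; lra.
    + replace ((1 + 0 * a) ^ 2 + (0 * b) ^ 2)%R with 1%R by ring. now rewrite sqrt_1, ln_1.
    + exact Hl.
  - change (Carg (1 + (a, b)) = Im l). rewrite <- (log_path Im (a, b) (fun t => atan ((t * b) / (1 + t * a)))) with (l := l).
    + rewrite <- Carg_atan by (apply Pt; lra). f_equal. apply injective_projections; simpl; ring.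
    + reflexivity.
    + intros c h. unfold Im; simpl. ring.
    + intros c. eapply Rle_trans; [|apply Rmax_Cmod]. apply Rmax_r.
    + exact Hx.
    + intros t Ht. rewrite quot by exact Ht. simpl. specialize (Q t Ht). specialize (Pt t Ht).
      auto_derive.
      * lra.
      * field; repeat split; nra.
    + replace (0 * b / (1 + 0 * a))%R with 0%R by (field; lra). apply atan_0.
    + exact Hl.
Qed.

Lemma Clog_analytic : exists lam : C -> C, analytic0 (fun x _ => lam x) /\ lam 0 = 1 /\
  near (fun x _ => Clog (1 + x) = x * lam x).
Proof.
  destruct (rep_make (/ 2) 2 (fun n => (logc n, (n, 0%nat)))) as [F HF].
  - lra.
  - intros N. eapply Rle_trans; [apply (sum_n_le _ (fun n => (/ 2) ^ n)%R)|].
    + intros n. unfold tnorm; simpl. rewrite Rmult_1_r.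
      rewrite <- (Rmult_1_l ((/ 2) ^ n)) at 2. apply Rmult_le_compat_r; [apply pow_le; lra|apply Cmod_logc].
    + rewrite sum_half_pow. assert (P := pow_le (/ 2) N ltac:(lra)). lra.
  - assert (Z : (Cmod 0 <= / 2)%R) by (rewrite Cmod_0; lra).
    exists (fun x => F x 0). split; [|split].
    + apply (an_comp F (fun x _ => x) (fun _ _ => 0)); try reflexivity.
      * exists (/ 2)%R, 2%R. split; [lra|]. eexists; exact HF.
      * apply an_fst.
      * apply an_const.
    + apply (C_series_unique _ _ _ (proj2 HF 0 0 Z Z)). apply (is_series_eventually _ _ 0).
      intros n _. induction n as [|n IH].
      * rewrite sum_O. unfold tval, logc. simpl. replace (1 / 1)%R with 1%R by field. ring.
      * rewrite sum_Sn, IH. unfold tval. simpl. unfold plus; simpl. ring.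
    + exists (/ 2)%R. split; [lra|]. intros x z Hx _. apply Clog_series; [lra|].
      assert (S := proj2 HF x 0 ltac:(lra) Z).
      eapply is_series_C_ext; [|apply is_series_C_scal, S]. intros n. unfold tval. simpl. ring.
Qed.

(** * Analytic germs and the mixed classes *)

(** Re-expansion at each real point near the origin. *)
Lemma mix_germ_of_an (F : C -> C -> C) (H : R -> C -> C) :
  analytic0 F -> near (fun t z => forall eta : R, t = RtoC eta -> H eta z = F t z) ->
  mix_analytic_germ H.
Proof.
  intros HF (d & Hd & E). destruct (an_recenter F HF) as (d' & Hd' & HR).
  apply locally_RC. exists (Rmin (d / 2) d').
  assert (A := Rmin_l (d / 2) d'). assert (B := Rmin_r (d / 2) d').
  split; [apply Rmin_pos; lra|]. intros t0 z0 Ht Hz. simpl.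
  destruct (HR (RtoC t0) z0) as (r & M & HM); [rewrite Cmod_R; lra|lra|].
  assert (Hr := rep_r_pos _ _ _ HM).
  assert (A1 := Rmin_l r (d / 2)). assert (B1 := Rmin_r r (d / 2)).
  assert (P1 : (0 < Rmin r (d / 2))%R) by (apply Rmin_pos; lra).
  apply (rep_mix (Rmin r (d / 2)) M (fun t z => F (RtoC t0 + t) (z0 + z))).
  - eapply rep_le; [exact HM| | |]; lra.
  - intros t z Ht1 Hz1. rewrite <- RtoC_plus.
    replace (t0 + (t - t0))%R with t by ring. replace (z0 + (z - z0)) with z by ring.
    apply E; [|  |reflexivity].
    + rewrite Cmod_R. assert (T := Rabs_triang (t - t0) t0).
      replace (t - t0 + t0)%R with t in T by ring. lra.
    + assert (T := Cmod_triangle (z - z0) z0).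
      replace (z - z0 + z0) with z in T by ring. lra.
Qed.

Lemma analytic_of_mix (B : R -> C) (t0 : R) :
  mix_analytic_at (fun t _ => B t) t0 0 -> analytic_at B t0.
Proof.
  intros (a & r & Hr & _ & H). exists (fun n => a n 0%nat), r. split; [exact Hr|].
  intros t Ht. specialize (H t 0 Ht).
  eapply is_series_C_ext; [|apply H].
  - intros n. replace (0 - 0) with (RtoC 0) by ring.
    destruct n as [|n]; [rewrite sum_O; simpl; ring|].
    rewrite sum_Sn, (sum_n_ext_loc _ (fun _ => zero)).
    + assert (Z : sum_n (fun _ => @zero C_AbelianMonoid) n = zero).
      { induction n as [|n IH]; [now rewrite sum_O|]. rewrite sum_Sn, IH. apply plus_zero_l. }
      rewrite Z, plus_zero_l, Nat.sub_diag. simpl. ring.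
    + intros j Hj. replace (S n - j)%nat with (S (n - j)) by lia. rewrite Cpow_0_l.
      apply Cmult_0_r.
  - replace (0 - 0) with (RtoC 0) by ring. rewrite Cmod_0. exact Hr.
Qed.

Lemma analytic_germ_of_an (b : C -> C) :
  analytic0 (fun t _ => b t) -> analytic_germ (fun t => b (RtoC t)).
Proof.
  intros Hb.
  assert (G := mix_germ_of_an (fun t _ => b t) (fun t _ => b (RtoC t)) Hb).
  apply locally_RC in G.
  - destruct G as (d & Hd & G). apply locally_R0. exists d. split; [exact Hd|].
    intros t Ht. apply analytic_of_mix. apply (G t 0 Ht). now rewrite Cmod_0.
  - apply near_true. intros t z eta ->. reflexivity.
Qed.

Lemma near_R0 (P : R -> Prop) :
  near (fun t _ => forall eta : R, t = RtoC eta -> P eta) -> locally 0%R P.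
Proof.
  intros (d & Hd & H). apply locally_R0. exists d. split; [exact Hd|]. intros t Ht.
  apply (H (RtoC t) 0); [now rewrite Cmod_R|now rewrite Cmod_0|reflexivity].
Qed.

Lemma near_RC (P : R -> C -> Prop) :
  near (fun t z => forall eta : R, t = RtoC eta -> P eta z) ->
  locally origin (fun p => P (fst p) (snd p)).
Proof.
  intros (d & Hd & H). apply locally_RC. exists d. split; [exact Hd|]. intros t z Ht Hz.
  apply (H (RtoC t) z); [now rewrite Cmod_R|assumption|reflexivity].
Qed.

Lemma RC_near (P : R * C -> Prop) :
  locally origin P -> near (fun t z => forall eta : R, t = RtoC eta -> P (eta, z)).
Proof.
  intros H. apply locally_RC in H. destruct H as (d & Hd & H). exists d. split; [exact Hd|].
  intros t z Ht Hz eta ->. rewrite Cmod_R in Ht. now apply H.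
Qed.

(** * The family in terms of its curve of fixed points *)

Lemma csqrt_conj (eta : R) : ((0 <= eta)%R -> Cconj (csqrt eta) = csqrt eta) /\
  ((eta < 0)%R -> Cconj (csqrt eta) = - csqrt eta).
Proof.
  unfold csqrt. split; intros H; destruct (Rle_dec 0 eta); try lra;
    apply injective_projections; simpl; ring.
Qed.

(** For eta >= 0 the square roots s of eta are real fixed points; for eta < 0
    they are exchanged by f, and also by conjugation. In both cases z ->
    f(conj z) fixes s. The value of K at the origin is read off from the
    second order term of the parabolic germ. *)
Lemma family_normal_form (f0 : C -> C) (a : nat -> R -> C) (ft : R -> C -> C) :
  parabolic_codim_one f0 -> unfolding f0 a ft -> fixed_points_sq ft ->
  exists K, analytic0 K /\ K 0 0 = 1 / 2 /\
    near (fun t z => forall eta : R, t = RtoC eta -> ft eta (Cconj z) = z + (z ^ 2 - t) * K t z).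
Proof.
  intros (_ & _ & _ & _ & b0 & Dom) ((G0 & (_ & _ & An) & _) & a0 & Ser) (Fix & Per).
  apply locally_RC in An. destruct An as (d1 & Hd1 & An).
  assert (Z0 : (Cmod 0 < d1)%R) by now rewrite Cmod_0.
  specialize (An 0%R 0 ltac:(rewrite Rabs_R0; lra) Z0). simpl in An.
  unfold mix_antianalytic_at in An.
  destruct (mix_rep _ _ _ An) as (r & M & F & HF & EF).
  assert (Hr := rep_r_pos _ _ _ HF).
  assert (nF : near (fun t z => forall eta : R, t = RtoC eta -> ft eta (Cconj z) = F t z)).
  { exists r. split; [exact Hr|]. intros t z Ht Hz eta ->. rewrite Cmod_R in Ht.
    rewrite <- EF by lra. rewrite Rplus_0_l. f_equal. rewrite Cplus_conj, Cconj_conj. ring. }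
  assert (aF : analytic0 F) by now exists r, M.
  assert (FixF : near (fun t z => forall eta : R, t = RtoC eta -> forall s, s ^ 2 = t -> F t s = s)).
  { apply RC_near in Fix. apply locally_R0 in Per.
    destruct nF as (e1 & He1 & nF). destruct Fix as (e2 & He2 & Fix). destruct Per as (e3 & He3 & Per).
    set (e := Rmin e1 e2). assert (A := Rmin_l e1 e2). assert (B := Rmin_r e1 e2).
    assert (Pe : (0 < e)%R) by now apply Rmin_pos.
    (* The radius e^2 for the parameter keeps its square roots in the disc of
       radius e. *)
    exists (Rmin (Rmin e e3) (e ^ 2)).
    assert (A1 := Rmin_l (Rmin e e3) (e ^ 2)). assert (B1 := Rmin_r (Rmin e e3) (e ^ 2)).
    assert (A2 := Rmin_l e e3). assert (B2 := Rmin_r e e3). fold e in A, B.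
    split; [repeat apply Rmin_pos; try lra; apply pow_lt; lra|].
    intros t z Ht _ eta -> s Hs. rewrite Cmod_R in Ht.
    assert (Hms : (Cmod s < e)%R) by (apply (Cmod_lt_of_sq s eta); try assumption; lra).
    rewrite <- (nF (RtoC eta) s ltac:(rewrite Cmod_R; lra) ltac:(lra) eta eq_refl).
    assert (Es : s = csqrt eta \/ s = - csqrt eta) by (apply Csq_eq; now rewrite Hs, csqrt_sq).
    destruct (csqrt_conj eta) as [Cp Cm].
    destruct (Rle_dec 0 eta) as [Hp|Hn].
    - assert (Ec : Cconj s = s) by (destruct Es as [-> | ->]; rewrite ?Copp_conj, Cp; auto).
      rewrite Ec.
      apply (proj1 (Fix (RtoC eta) s ltac:(rewrite Cmod_R; lra) ltac:(lra) eta eq_refl) Hp). exact Es.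
    - assert (Hn' : (eta < 0)%R) by lra. specialize (Per eta ltac:(lra) Hn').
      assert (Ec : Cconj s = - s) by (destruct Es as [-> | ->]; rewrite ?Copp_conj, Cm; auto).
      rewrite Ec. destruct Es as [-> | ->]; [tauto|].
      replace (- - csqrt eta) with (csqrt eta) by ring. tauto. }
  destruct (fixed_curve F aF FixF) as (K & aK & EK).
  exists K. split; [exact aK|]. split.
  2:{ eapply near_imp; [|exact (near_and _ _ nF EK)]. intros t z [E1 E2] eta Et.
      now rewrite (E1 eta Et), (E2 eta Et). }
  apply Csub_eq, Cmod_eq_0, Rle_antisym; [|apply Cmod_ge_0]. apply le_epsilon. intros e He.
  rewrite Rplus_0_l.
  specialize (Dom (mkposreal 1 Rlt_0_1)). apply (proj1 (locally_Cmod _ _)) in Dom. destruct Dom as (d2 & Hd2 & Dom).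
  apply RC_near in Ser. destruct Ser as (d3 & Hd3 & Ser).
  destruct nF as (d4 & Hd4 & nF). destruct EK as (d5 & Hd5 & EK).
  destruct (an_cont K (e / 2) aK ltac:(lra)) as (d6 & Hd6 & CK).
  set (c := 1 / 4 - RtoC b0 / 2) in *. assert (Pc := Cmod_ge_0 c).
  (* The expansion of the germ bounds K(0,x) - 1/2 by (1 + |c|) x, where c is
     the cubic coefficient. *)
  set (d7 := (e / (2 * (1 + Cmod c)))%R).
  assert (Hd7 : (0 < d7)%R) by (apply Rdiv_lt_0_compat; lra).
  assert (exists x : R, (0 < x)%R /\ (x < d2)%R /\ (x < d3)%R /\ (x < d4)%R /\ (x < d5)%R /\ (x < d6)%R /\ (x <= d7)%R)
    as (x & Px & X2 & X3 & X4 & X5 & X6 & X7).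
  { set (y := Rmin d2 (Rmin d3 (Rmin d4 (Rmin d5 (Rmin d6 d7))))).
    exists (y / 2)%R.
    assert (L1 := Rmin_l d2 (Rmin d3 (Rmin d4 (Rmin d5 (Rmin d6 d7))))).
    assert (L2 := Rmin_r d2 (Rmin d3 (Rmin d4 (Rmin d5 (Rmin d6 d7))))).
    assert (L3 := Rmin_l d3 (Rmin d4 (Rmin d5 (Rmin d6 d7)))).
    assert (L4 := Rmin_r d3 (Rmin d4 (Rmin d5 (Rmin d6 d7)))).
    assert (L5 := Rmin_l d4 (Rmin d5 (Rmin d6 d7))). assert (L6 := Rmin_r d4 (Rmin d5 (Rmin d6 d7))).
    assert (L7 := Rmin_l d5 (Rmin d6 d7)). assert (L8 := Rmin_r d5 (Rmin d6 d7)).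
    assert (L9 := Rmin_l d6 d7). assert (L10 := Rmin_r d6 d7).
    assert (Py : (0 < y)%R) by (unfold y; repeat apply Rmin_pos; lra). fold y in L1, L2.
    repeat split; lra. }
  assert (Mx : Cmod (RtoC x) = x) by (rewrite Cmod_R; apply Rabs_pos_eq; lra).
  assert (M0 : Cmod 0 = 0%R) by apply Cmod_0.
  assert (Efx : ft 0%R (RtoC x) = f0 (RtoC x)).
  { apply Csub_eq. specialize (Ser (RtoC 0) (RtoC x) ltac:(lra) ltac:(lra) 0%R eq_refl). simpl in Ser.
    eapply C_series_unique; [exact Ser|]. apply (is_series_eventually _ _ 0). intros n _.
    induction n as [|n IH].
    - rewrite sum_O, a0. apply Cmult_0_l.
    - rewrite sum_Sn, IH, a0. rewrite Cmult_0_l. apply (plus_zero_l (G := C_AbelianMonoid)). }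
  specialize (Dom (RtoC x)). replace (RtoC x - 0) with (RtoC x) in Dom by ring.
  specialize (Dom ltac:(lra)). rewrite <- Efx in Dom.
  specialize (nF (RtoC 0) (RtoC x) ltac:(lra) ltac:(lra) 0%R eq_refl).
  specialize (EK (RtoC 0) (RtoC x) ltac:(lra) ltac:(lra) 0%R eq_refl).
  rewrite Cconj_R, EK in nF. rewrite nF, Cconj_R in Dom.
  specialize (CK (RtoC 0) (RtoC x) ltac:(lra) ltac:(lra)).
  set (k := K 0 (RtoC x)) in *.
  change (Cmod (RtoC x + (RtoC x ^ 2 - 0) * k - (RtoC x + 1 / 2 * RtoC x ^ 2 + c * RtoC x ^ 3))
     <= 1 * Cmod (RtoC x ^ 3))%R in Dom.
  replace (RtoC x + (RtoC x ^ 2 - 0) * k - (RtoC x + 1 / 2 * RtoC x ^ 2 + c * RtoC x ^ 3))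
    with (RtoC x ^ 2 * (k - 1 / 2 - c * RtoC x)) in Dom by ring.
  rewrite Cmod_mult, !Cmod_pow, Mx in Dom.
  assert (Dom' : (Cmod (k - 1 / 2 - c * RtoC x) <= x)%R).
  { apply (Rmult_le_reg_l (x ^ 2)); [apply pow_lt; lra|]. simpl in *. lra. }
  assert (T1 := Cmod_triangle (- (k - K 0 0)) ((k - 1 / 2 - c * RtoC x) + c * RtoC x)).
  replace (- (k - K 0 0) + (k - 1 / 2 - c * RtoC x + c * RtoC x)) with (K 0 0 - 1 / 2) in T1 by ring.
  assert (T2 := Cmod_triangle (k - 1 / 2 - c * RtoC x) (c * RtoC x)).
  rewrite Cmod_mult, Mx in T2. rewrite Cmod_opp in T1.
  assert (Q : (x * (1 + Cmod c) <= e / 2)%R).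
  { replace (e / 2)%R with (d7 * (1 + Cmod c))%R by (unfold d7; field; lra).
    apply Rmult_le_compat_r; lra. }
  lra.
Qed.

Lemma Cinv_conj_total (a : C) : Cconj (/ a) = / Cconj a.
Proof.
  destruct (Ceq_dec a 0) as [->|H]; [|now apply Cinv_conj].
  apply injective_projections; simpl; unfold Rdiv; ring.
Qed.

Lemma Clog_conj (x : C) : (Cmod x < 1)%R -> Clog (1 + Cconj x) = Cconj (Clog (1 + x)).
Proof.
  intros Hx. replace (1 + Cconj x) with (Cconj (1 + x)) by (rewrite Cplus_conj, Cconj_R; reflexivity).
  unfold Clog. rewrite Cmod_conj.
  assert (Pa : (0 < fst (1 + x)%C)%R).
  { assert (B := Rmax_Cmod x). assert (B2 := Rmax_l (Rabs (fst x)) (Rabs (snd x))).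
    assert (B3 : (Rabs (fst x) < 1)%R) by lra. apply Rabs_def2 in B3. simpl. lra. }
  destruct (1 + x) as [a b]. simpl in Pa. unfold Cconj. simpl. f_equal.
  rewrite !Carg_atan by exact Pa. rewrite <- atan_opp. f_equal. field. lra.
Qed.

(** The principal logarithm commutes with conjugation near 1; the quotient by
    x needs the value at 0 separately. *)
Lemma lambda_real (lam : C -> C) : lam 0 = 1 -> near (fun x _ => Clog (1 + x) = x * lam x) ->
  near (fun x _ => Cconj (lam (Cconj x)) = lam x).
Proof.
  intros L0 H.
  assert (N1 : near (fun x _ => (Cmod x < 1)%R)) by (exists 1%R; split; [lra|auto]).
  eapply near_imp; [|exact (near_and _ _ N1 (near_and _ _ H (near_conj _ H)))].
  intros x zz (Hx & E1 & E2).
  destruct (Ceq_dec x 0) as [->|Nx].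
  - rewrite !Cconj_R, L0. apply Cconj_R.
  - rewrite Clog_conj, E1 in E2 by exact Hx.
    apply (f_equal Cconj) in E2. rewrite Cconj_conj, Cmult_conj, Cconj_conj in E2.
    replace (lam x) with (/ x * (x * lam x)) by (field; exact Nx). rewrite E2. field. exact Nx.
Qed.

(** * Canonical parameter and angle of the multipliers *)

Section Data.
Variable K : C -> C -> C.
Hypothesis aK : analytic0 K.
Hypothesis K0 : K 0 0 = 1 / 2.

(** The function K on the curve t = s^2, on which it is a function of the
    square root s of the parameter. *)
Definition slice (s : C) : C := K (s ^ 2) s.
Definition slice_conj (s : C) : C := Cconj (slice (Cconj s)).
(** The derivative at w = s of w + (w^2 - s^2) K(s^2, w). *)
Definition multiplier (s : C) : C := 1 + 2 * s * slice s.

Lemma an_slice : analytic0 (fun s _ => slice s).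
Proof.
  apply (an_comp K (fun s _ => s ^ 2) (fun s _ => s)); [exact aK|apply an_pow, an_fst|apply an_fst|ring|ring].
Qed.

Lemma an_slice_conj : analytic0 (fun s _ => slice_conj s).
Proof. exact (an_star1 slice an_slice). Qed.

Lemma slice_0 : slice 0 = 1 / 2.
Proof. unfold slice. replace (0 ^ 2) with (RtoC 0) by ring. exact K0. Qed.

Lemma half_real : Cconj (1 / 2) = 1 / 2.
Proof. unfold Cdiv. now rewrite Cmult_conj, Cinv_conj_total, !Cconj_R. Qed.

Lemma slice_conj_0 : slice_conj 0 = 1 / 2.
Proof. unfold slice_conj. rewrite Cconj_R, slice_0. apply half_real. Qed.

Lemma multiplier_conj (s : C) : Cconj (multiplier (Cconj s)) = 1 + 2 * s * slice_conj s.
Proof. unfold multiplier, slice_conj. now rewrite Cplus_conj, !Cmult_conj, Cconj_conj, !Cconj_R. Qed.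

(** The product of the multipliers is 1 + 2 s D(s), where D is conjugation
    invariant and D(0) = 1. Its logarithm is s W(s) with W(s) = P(s^2) + s
    Q(s^2) and W(0) = 2, so that the difference of the inverse logarithms at s
    and - s is 2 P / (s (P^2 - s^2 Q^2)). *)
Lemma canonical_data : exists e : C -> C, analytic0 (fun t _ => e t) /\ conj_invariant e /\ e 0 = 1 /\
  near (fun s _ => s <> 0 ->
    / ((/ Clog (multiplier s * Cconj (multiplier (Cconj s))) - / Clog (multiplier (- s) * Cconj (multiplier (Cconj (- s))))) ^ 2)
    = s ^ 2 * e (s ^ 2) ^ 2).
Proof.
  destruct Clog_analytic as (lam & aL & L0 & EL).
  assert (RL := lambda_real lam L0 EL).
  set (D := fun s => slice s + slice_conj s + 2 * s * slice s * slice_conj s).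
  assert (aD : analytic0 (fun s _ => D s)).
  { assert (a1 := an_slice). assert (a2 := an_slice_conj). unfold D. an_arith. }
  set (X := fun s => 2 * s * D s).
  assert (aX : analytic0 (fun s _ => X s)).
  { apply an_mult; [apply an_mult; [apply an_const|apply an_fst]|exact aD]. }
  assert (X0 : X 0 = 0) by (unfold X; ring).
  set (W := fun s => 2 * D s * lam (X s)).
  assert (aW : analytic0 (fun s _ => W s)).
  { apply an_mult; [apply an_mult; [apply an_const|exact aD]|].
    exact (an_comp1 lam (fun s _ => X s) aL aX X0). }
  assert (RD : forall s, Cconj (D (Cconj s)) = D s).
  { intros s. unfold D, slice_conj. rewrite !Cplus_conj, !Cmult_conj, !Cconj_conj, Cconj_R. ring. }
  assert (RX : forall s, Cconj (X (Cconj s)) = X s).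
  { intros s. unfold X. now rewrite !Cmult_conj, !Cconj_conj, Cconj_R, RD. }
  assert (RX' : forall s, X (Cconj s) = Cconj (X s)).
  { intros s. rewrite <- (RX s). now rewrite Cconj_conj. }
  assert (RW : near (fun s _ => Cconj (W (Cconj s)) = W s)).
  { eapply near_imp; [|exact (near_comp1 _ (fun s _ => X s) RL aX X0)].
    intros s zz E. cbv beta in E. unfold W. rewrite !Cmult_conj, Cconj_R, RD, RX'. now rewrite E. }
  destruct (even_odd_real W aW RW) as (P & Q & aP & aQ & RP & RQ & EW).
  assert (D0 : D 0 = 1) by (unfold D; rewrite slice_0, slice_conj_0; field).
  assert (W0 : W 0 = 2) by (unfold W; rewrite D0, X0, L0; ring).
  assert (P0 : P 0 = 2).
  { assert (E := near_at_0 _ EW). cbv beta in E. rewrite W0 in E.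
    replace (0 ^ 2) with (RtoC 0) in E by ring. rewrite E. ring. }
  assert (aMinus : analytic0 (fun s _ => - s)) by apply an_opp, an_fst.
  assert (M0 : - (0) = RtoC 0) by ring.
  exists (fun t => (P t ^ 2 - t * Q t ^ 2) / (2 * P t)).
  split; [|split; [|split]].
  - apply an_div.
    + apply an_minus; [apply an_pow, aP|apply an_mult; [apply an_fst|apply an_pow, aQ]].
    + apply an_mult; [apply an_const|exact aP].
    + rewrite P0. intros E. apply (f_equal fst) in E. simpl in E. lra.
  - intros t. unfold Cdiv. rewrite Cmult_conj, Cinv_conj_total, Cminus_conj, !Cmult_conj, !Cpow_conj, Cconj_conj, Cconj_R.
    now rewrite RP, RQ.
  - rewrite P0. field.
  - assert (W0' : W 0 <> 0) by (rewrite W0; intros E; apply (f_equal fst) in E; simpl in E; lra).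
    assert (NW := an_nonzero _ aW W0').
    assert (P0' : P 0 <> 0) by (rewrite P0; intros E; apply (f_equal fst) in E; simpl in E; lra).
    assert (aS2 : analytic0 (fun s _ => s ^ 2)) by apply an_pow, an_fst.
    assert (S20 : 0 ^ 2 = RtoC 0) by ring.
    assert (NP := near_comp1 _ (fun s _ => s ^ 2) (an_nonzero _ aP P0') aS2 S20).
    assert (ELX := near_comp1 _ (fun s _ => X s) EL aX X0).
    assert (EWm := near_comp1 _ (fun s _ => - s) EW aMinus M0).
    assert (ELXm := near_comp1 _ (fun s _ => - s) ELX aMinus M0).
    assert (NWm := near_comp1 _ (fun s _ => - s) NW aMinus M0).
    eapply near_imp; [|exact (near_and _ _ (near_and _ _ (near_and _ _ EW EWm) (near_and _ _ ELX ELXm))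
      (near_and _ _ (near_and _ _ NW NWm) NP))].
    intros s zz [[[E1 E2] [E3 E4]] [[N1 N2] N3]] Ns. cbv beta in *.
    assert (EX : forall s, multiplier s * Cconj (multiplier (Cconj s)) = 1 + X s).
    { intros x. rewrite multiplier_conj. unfold multiplier, X, D. ring. }
    rewrite !EX, E3, E4.
    rewrite opp_sq in E2.
    set (p := P (s ^ 2)) in *. set (q := Q (s ^ 2)) in *.
    replace (X s * lam (X s)) with (s * (p + s * q)) by (rewrite <- E1; unfold W, X; ring).
    replace (X (- s) * lam (X (- s))) with (- s * (p + - s * q)) by (rewrite <- E2; unfold W, X; ring).
    rewrite E1 in N1. rewrite E2 in N2.
    replace (p ^ 2 - s ^ 2 * q ^ 2) with ((p + s * q) * (p + - s * q)) by ring.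
    field.
    repeat split; try assumption.
    replace (- s * (p + - s * q) - s * (p + s * q)) with (- (2) * s * p) by ring.
    repeat apply Cmult_neq_0; try assumption.
    intros E. apply (f_equal fst) in E. simpl in E. lra.
Qed.

Definition angle (v0 v1 : C -> C) (s : C) : C := v0 (s ^ 2) + s * v1 (s ^ 2).

(** With u = 1 + 2 s v, the equation u^2 = conj(l(conj s)) reads v + s v^2 =
    conj(K) / 2, where no square root is left; it is solved by implicit
    functions around v(0) = 1/4. The product of u with its conjugate is
    conjugation invariant, hence has real even and odd parts. *)
Lemma angle_data : exists v0 v1 h0 h1 : C -> C,
  analytic0 (fun t _ => v0 t) /\ analytic0 (fun t _ => v1 t) /\ analytic0 (fun t _ => h0 t) /\ analytic0 (fun t _ => h1 t) /\
  conj_invariant h0 /\ conj_invariant h1 /\ h0 0 = 1 /\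
  near (fun s _ =>
    (1 + 2 * s * angle v0 v1 s) ^ 2 = Cconj (multiplier (Cconj s)) /\
    (1 + 2 * s * angle v0 v1 s) * Cconj (1 + 2 * Cconj s * angle v0 v1 (Cconj s))
      = 1 + s * (h0 (s ^ 2) + s * h1 (s ^ 2))).
Proof.
  assert (aA : analytic0 (fun _ y => (1 / 4 + y) ^ 2)) by (apply an_pow, an_plus; [apply an_const|apply an_snd]).
  destruct (implicit_function _ (fun _ _ => 0) aA (an_const 0)) as (Y & aY & Y0 & EY & _).
  set (z := fun s => slice_conj s / 2 - 1 / 4).
  assert (az : analytic0 (fun s _ => z s)).
  { apply an_minus; [|apply an_const]. apply an_mult; [apply an_slice_conj|apply an_const]. }
  assert (z0 : z 0 = 0) by (unfold z; rewrite slice_conj_0; field).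
  set (v := fun s => 1 / 4 + Y s (z s)).
  assert (av : analytic0 (fun s _ => v s)).
  { apply an_plus; [apply an_const|].
    exact (an_comp Y (fun s _ => s) (fun s _ => z s) aY an_fst az eq_refl z0). }
  assert (v00 : v 0 = 1 / 4) by (unfold v; rewrite z0, Y0; ring).
  assert (Ev := near_comp _ (fun s _ => s) (fun s _ => z s) EY an_fst az eq_refl z0).
  cbv beta in Ev.
  set (H := fun s => 2 * (v s + Cconj (v (Cconj s)) + 2 * s * v s * Cconj (v (Cconj s)))).
  assert (aH : analytic0 (fun s _ => H s)).
  { assert (avs := an_star1 v av).
    unfold H. an_arith. }
  assert (RH : forall s, Cconj (H (Cconj s)) = H s).
  { intros s. unfold H. rewrite !Cmult_conj, !Cplus_conj, !Cmult_conj, !Cconj_conj, Cconj_R. ring. }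
  destruct (even_odd v av) as (v0 & v1 & a0 & a1 & E01).
  destruct (even_odd_real H aH (near_true _ (fun s _ => RH s))) as (h0 & h1 & b0 & b1 & R0 & R1 & EH).
  exists v0, v1, h0, h1. do 6 (split; [assumption|]). split.
  - assert (E := near_at_0 _ EH). cbv beta in E. replace (0 ^ 2) with (RtoC 0) in E by ring.
    replace (h0 0) with (h0 0 + 0 * h1 0) by ring. rewrite <- E. unfold H.
    rewrite Cconj_R, v00.
    replace (Cconj (1 / 4)) with (1 / 4) by (unfold Cdiv; now rewrite Cmult_conj, Cinv_conj_total, !Cconj_R).
    field.
  - eapply near_imp; [|exact (near_and _ _ (near_and _ _ Ev EH) (near_and _ _ E01 (near_conj _ E01)))].
    intros s zz [[Ey Eh] [E1 E2]]. cbv beta in *. unfold angle. rewrite <- E1, <- E2. split.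
    + rewrite multiplier_conj.
      assert (Ek : slice_conj s = 2 * (v s + s * v s ^ 2)).
      { unfold v. set (y := Y s (z s)) in *.
        replace (slice_conj s) with (2 * (z s + 1 / 4)) by (unfold z; field). rewrite <- Ey. ring. }
      rewrite Ek. ring.
    + rewrite <- Eh. unfold H. rewrite Cplus_conj, !Cmult_conj, Cconj_conj, !Cconj_R. ring.
Qed.
End Data.

(** * Inverting the parameter and the coordinate *)

(** With e(0) = 1 the map t -> t e(t)^2 is t + t^2 B(t). The inverse is real
    because its conjugate is also an inverse. *)
Lemma parameter_inverse (e : C -> C) : analytic0 (fun t _ => e t) -> conj_invariant e -> e 0 = 1 ->
  exists th : C -> C, analytic0 (fun t _ => th t) /\ th 0 = 0 /\
    near (fun t _ => th t * e (th t) ^ 2 = t) /\ near (fun t _ => th (t * e t ^ 2) = t) /\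
    near (fun t _ => Cconj (th (Cconj t)) = th t).
Proof.
  intros ae Re e0.
  destruct (an_div_fst (fun t _ => e t ^ 2)) as (B & aB & EB); [now apply an_pow|].
  cbv beta in EB.
  assert (aB1 : analytic0 (fun _ y => B y 0)) by
    exact (an_comp B (fun _ y => y) (fun _ _ => 0) aB an_snd (an_const 0) eq_refl eq_refl).
  destruct (implicit_function (fun _ _ => 0) (fun _ y => B y 0) (an_const 0) aB1) as (Y & aY & Y0 & E1 & E2).
  set (th := fun t => Y 0 t).
  assert (ath : analytic0 (fun t _ => th t)) by
    exact (an_comp Y (fun _ _ => 0) (fun t _ => t) aY (an_const 0) an_fst eq_refl eq_refl).
  assert (Eb : near (fun t _ => t * e t ^ 2 = t + t ^ 2 * B t 0)).
  { eapply near_imp; [|exact (near_comp _ (fun t _ => t) (fun _ _ => 0) EB an_fst (an_const 0) eq_refl eq_refl)].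
    intros t zz E. cbv beta in E. rewrite E, e0. ring. }
  assert (L : near (fun t _ => th (t * e t ^ 2) = t)).
  { eapply near_imp; [|exact (near_and _ _ Eb (near_comp _ (fun _ _ => 0) (fun t _ => t) E2 (an_const 0) an_fst eq_refl eq_refl))].
    intros t zz [F1 F2]. cbv beta in F2. rewrite F1. unfold th.
    etransitivity; [|exact F2]. f_equal. ring. }
  assert (Rr : near (fun t _ => th t * e (th t) ^ 2 = t)).
  { eapply near_imp; [|exact (near_and _ _ (near_comp1 _ (fun t _ => th t) Eb ath Y0)
      (near_comp _ (fun _ _ => 0) (fun t _ => t) E1 (an_const 0) an_fst eq_refl eq_refl))].
    intros t zz [F1 F2]. cbv beta in F1, F2. rewrite F1. unfold th.
    etransitivity; [|exact F2]. ring. }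
  exists th. do 4 (split; [assumption|]).
  assert (aths := an_star1 th ath).
  assert (ths0 : Cconj (th (Cconj 0)) = 0) by (rewrite Cconj_R; unfold th; rewrite Y0; apply Cconj_R).
  eapply near_imp; [|exact (near_and _ _ (near_comp1 _ (fun t _ => Cconj (th (Cconj t))) L aths ths0)
     (near_conj _ Rr))].
  intros t zz [F1 F2]. cbv beta in F1, F2.
  rewrite <- F1. f_equal.
  apply (f_equal Cconj) in F2. rewrite Cconj_conj, Cmult_conj, Cpow_conj in F2.
  rewrite <- (Re (Cconj (th (Cconj t)))), Cconj_conj. exact F2.
Qed.

(** The coordinate change that fixes the points of the curve z^2 = t and has
    derivative 1 + 2 z (v_0 + z v_1) there. *)
Definition shear (v0 v1 : C -> C) (t z : C) : C := z + (z ^ 2 - t) * (v0 t + z * v1 t).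

Lemma an_shear (v0 v1 : C -> C) : analytic0 (fun t _ => v0 t) -> analytic0 (fun t _ => v1 t) -> analytic0 (shear v0 v1).
Proof.
  intros a0 a1. unfold shear.
  an_arith.
Qed.

Lemma shear_inverse (v0 v1 : C -> C) : analytic0 (fun t _ => v0 t) -> analytic0 (fun t _ => v1 t) ->
  exists Y, analytic0 Y /\ Y 0 0 = 0 /\
    near (fun t z => shear v0 v1 t (Y t z) = z) /\ near (fun t z => Y t (shear v0 v1 t z) = z).
Proof.
  intros a0 a1.
  assert (aV : analytic0 (fun t z => v0 t + z * v1 t))
    by (apply an_plus; [exact a0|apply an_mult; [apply an_snd|exact a1]]).
  destruct (implicit_function _ _ (an_opp _ aV) aV) as (Y & aY & Y0 & E1 & E2).
  exists Y. split; [exact aY|]. split; [exact Y0|]. split.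
  - eapply near_imp; [|exact E1]. intros t z E. cbv beta in E. unfold shear. etransitivity; [|exact E]. ring.
  - eapply near_imp; [|exact E2]. intros t z E. cbv beta in E. etransitivity; [|exact E]. f_equal. unfold shear. ring.
Qed.

Lemma shear_fixed (v0 v1 : C -> C) (t s : C) : s ^ 2 = t -> shear v0 v1 t s = s.
Proof. intros <-. unfold shear. ring. Qed.

(** * Multipliers along the curve of fixed points *)

Lemma near_open (P : C -> C -> Prop) : near P ->
  near (fun t z => exists d, (0 < d)%R /\ forall w, (Cmod (w - z) < d)%R -> P t w).
Proof.
  intros (d & Hd & H). exists d. split; [exact Hd|]. intros t z Ht Hz.
  exists (d - Cmod z)%R. split; [lra|]. intros w Hw. apply H; [exact Ht|].
  assert (T := Cmod_triangle (w - z) z). replace (w - z + z) with w in T by ring. lra.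
Qed.

(** A disc of radius d for the square root s contains the square roots of the
    parameters in the disc of radius d^2. *)
Lemma near_sqrt (P : C -> C -> Prop) : near (fun t z => z ^ 2 = t -> P t z) ->
  near (fun t _ => forall s, s ^ 2 = t -> P t s).
Proof.
  intros (d & Hd & H). exists (Rmin d (d ^ 2)).
  assert (A := Rmin_l d (d ^ 2)). assert (B := Rmin_r d (d ^ 2)).
  split; [apply Rmin_pos; [lra|apply pow_lt; lra]|].
  intros t zz Ht _ s Hs. apply H; [lra| |exact Hs].
  assert (E := Cmod_pow s 2). rewrite Hs in E. assert (P0 := Cmod_ge_0 s). simpl in *. nra.
Qed.

Lemma real_of_conj (z : C) : Cconj z = z -> RtoC (Re z) = z.
Proof.
  intros H. apply (f_equal snd) in H. simpl in H.
  apply injective_projections; simpl; [reflexivity|lra].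
Qed.

Lemma cderiv_ext (P Q : C -> C) (s l : C) : (forall z, P z = Q z) -> cderiv P s l -> cderiv Q s l.
Proof. intros E. apply (cderiv_ext_loc P Q s l 1); [lra|auto]. Qed.

Lemma cderiv_invariant (K : C -> C -> C) : analytic0 K ->
  near (fun t z => z ^ 2 = t -> cderiv (fun w => w + (w ^ 2 - t) * K t w) z (1 + 2 * z * K t z)).
Proof.
  intros aK. destruct (division K aK) as (k0 & k1 & Q & a0 & a1 & aQ & E).
  destruct (an_bounded Q aQ) as (M & BQ).
  eapply near_imp; [|exact (near_open _ (near_and _ _ E BQ))].
  intros t z (d & Hd & H) Hz.
  assert (Ez : K t z = k0 t + z * k1 t).
  { rewrite (proj1 (H z ltac:(replace (z - z) with (RtoC 0) by ring; now rewrite Cmod_0))), Hz. ring. }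
  rewrite Ez.
  apply (cderiv_ext_loc (fun w => w + (w ^ 2 - t) * (k0 t + w * k1 t + (w ^ 2 - t) * Q t w)) _ _ _ d Hd).
  - intros w Hw. now rewrite (proj1 (H w Hw)).
  - apply (cderiv_prepared _ _ t z (Q t) d M Hd Hz). intros h Hh. apply H.
    now replace (z + h - z) with h by ring.
Qed.

Lemma cderiv_shear (v0 v1 : C -> C) (t z : C) : z ^ 2 = t ->
  cderiv (shear v0 v1 t) z (1 + 2 * z * (v0 t + z * v1 t)).
Proof.
  intros Hz. apply (cderiv_ext (fun w => w + (w ^ 2 - t) * (v0 t + w * v1 t + (w ^ 2 - t) * 0))).
  - intros w. unfold shear. ring.
  - apply (cderiv_prepared _ _ t z (fun _ => 0) 1 0 ltac:(lra) Hz). intros h _. rewrite Cmod_0. lra.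
Qed.

(** The second iterate is the composition of f after conjugation with its
    conjugate, both complex differentiable. *)
Lemma cderiv_square (f : C -> C) (z T1 T2 : C) : f z = Cconj z ->
  cderiv (fun w => f (Cconj w)) z T1 -> cderiv (fun w => f (Cconj w)) (Cconj z) T2 ->
  cderiv (fun x => f (f x)) z (T1 * Cconj T2).
Proof.
  intros Ez H1 H2.
  apply (cderiv_ext (fun x => f (Cconj (Cconj (f (Cconj (Cconj x))))))).
  - intros x. now rewrite !Cconj_conj.
  - apply (cderiv_comp (fun w => f (Cconj w)) (fun x => Cconj (f (Cconj (Cconj x))))).
    + rewrite Cconj_conj, Ez, Cconj_conj. exact H1.
    + exact (cderiv_conj (fun w => f (Cconj w)) z T2 H2).
Qed.

Lemma dzbar_of_cderiv_conj (f : C -> C) (z l : C) :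
  cderiv (fun w => f (Cconj w)) (Cconj z) l -> dzbar f z = l.
Proof.
  intros H. rewrite <- (dzbar_of_cderiv (fun w => f (Cconj w)) z l H). f_equal.
  apply functional_extensionality. intros w. now rewrite Cconj_conj.
Qed.

Lemma conj_sq_real (z : C) (eta : R) : z ^ 2 = RtoC eta -> Cconj z ^ 2 = RtoC eta.
Proof. intros H. now rewrite <- Cpow_conj, H, Cconj_R. Qed.

(** Conjugation exchanges or fixes the two points of the curve, so f maps s to
    conj s; the chain rule for the second iterate then involves the
    derivatives at s and at conj s. *)
Lemma family_multipliers (f : R -> C -> C) (K : C -> C -> C) : analytic0 K ->
  near (fun t z => forall eta : R, t = RtoC eta -> f eta (Cconj z) = z + (z ^ 2 - t) * K t z) ->
  near (fun t _ => forall eta : R, t = RtoC eta -> forall s, s ^ 2 = t ->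
    dzbar (f eta) s = 1 + 2 * Cconj s * K t (Cconj s) /\
    cderiv (fun x => f eta (f eta x)) s
      ((1 + 2 * s * K t s) * Cconj (1 + 2 * Cconj s * K t (Cconj s)))).
Proof.
  intros aK E.
  assert (H : near (fun t z => z ^ 2 = t -> forall eta : R, t = RtoC eta ->
     f eta (Cconj z) = z /\ cderiv (fun w => f eta (Cconj w)) z (1 + 2 * z * K t z))).
  { eapply near_imp; [|exact (near_and _ _ (near_and _ _ E (near_open _ E)) (cderiv_invariant K aK))].
    intros t z [[E1 (d & Hd & E2)] D] Hz eta Et. split.
    - rewrite (E1 eta Et), Hz. ring.
    - apply (cderiv_ext_loc (fun w => w + (w ^ 2 - t) * K t w) _ _ _ d Hd).
      + intros w Hw. now rewrite (E2 w Hw eta Et).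
      + now apply D. }
  apply near_sqrt in H. eapply near_imp; [|exact H]. cbv beta. intros t zz G eta Et s Hs.
  assert (Hc : Cconj s ^ 2 = t) by (rewrite Et; apply conj_sq_real; congruence).
  destruct (G s Hs eta Et) as [G1 G2]. destruct (G (Cconj s) Hc eta Et) as [G3 G4].
  rewrite Cconj_conj in G3. split.
  - now apply dzbar_of_cderiv_conj.
  - now apply cderiv_square.
Qed.

(** * The conjugated family *)

Section Main.
Variables (ft : R -> C -> C) (K : C -> C -> C).
Hypothesis aK : analytic0 K.
Hypothesis K0 : K 0 0 = 1 / 2.
Hypothesis Eft : near (fun t z => forall eta : R, t = RtoC eta -> ft eta (Cconj z) = z + (z ^ 2 - t) * K t z).
Variable e : C -> C.
Hypothesis ae : analytic0 (fun t _ => e t).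
Hypothesis re : conj_invariant e.
Hypothesis e0 : e 0 = 1.
Hypothesis He : near (fun s _ => s <> 0 ->
    / ((/ Clog (multiplier K s * Cconj (multiplier K (Cconj s))) - / Clog (multiplier K (- s) * Cconj (multiplier K (Cconj (- s))))) ^ 2)
    = s ^ 2 * e (s ^ 2) ^ 2).
Variables (v0 v1 h0 h1 : C -> C).
Hypothesis av0 : analytic0 (fun t _ => v0 t).
Hypothesis av1 : analytic0 (fun t _ => v1 t).
Hypothesis ah0 : analytic0 (fun t _ => h0 t).
Hypothesis ah1 : analytic0 (fun t _ => h1 t).
Hypothesis rh0 : conj_invariant h0.
Hypothesis rh1 : conj_invariant h1.
Hypothesis h00 : h0 0 = 1.
Hypothesis Hv : near (fun s _ =>
    (1 + 2 * s * angle v0 v1 s) ^ 2 = Cconj (multiplier K (Cconj s)) /\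
    (1 + 2 * s * angle v0 v1 s) * Cconj (1 + 2 * Cconj s * angle v0 v1 (Cconj s))
      = 1 + s * (h0 (s ^ 2) + s * h1 (s ^ 2))).
Variable th : C -> C.
Hypothesis ath : analytic0 (fun t _ => th t).
Hypothesis th0 : th 0 = 0.
Hypothesis thR : near (fun t _ => th t * e (th t) ^ 2 = t).
Hypothesis thL : near (fun t _ => th (t * e t ^ 2) = t).
Hypothesis thC : near (fun t _ => Cconj (th (Cconj t)) = th t).
Variable Y : C -> C -> C.
Hypothesis aY : analytic0 Y.
Hypothesis Y0 : Y 0 0 = 0.
Hypothesis YR : near (fun t z => shear v0 v1 t (Y t z) = z).
Hypothesis YL : near (fun t z => Y t (shear v0 v1 t z) = z).

Definition param (t : C) : C := t * e t ^ 2.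
Definition param_real (eta : R) : R := Re (param (RtoC eta)).
Definition param_inv (t : R) : R := Re (th (RtoC t)).
Definition coord (eta : R) (z : C) : C := e (RtoC eta) * shear v0 v1 (RtoC eta) z.
(** The coordinate z is first divided by e, then the shear is inverted; both
    are taken at the parameter th(t) of the given family. *)
Definition coord_inv (p : R * C) : R * C :=
  (param_inv (fst p), Y (th (RtoC (fst p))) (snd p / e (th (RtoC (fst p))))).
Definition new_family (t : R) (z : C) : C := coord (param_inv t) (ft (param_inv t) (snd (coord_inv (t, z)))).

Lemma an_param : analytic0 (fun t _ => param t).
Proof. apply an_mult; [apply an_fst|apply an_pow, ae]. Qed.

Lemma param_0 : param 0 = 0.
Proof. unfold param. ring. Qed.

Lemma param_RtoC (eta : R) : param (RtoC eta) = RtoC (param_real eta).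
Proof.
  unfold param_real. symmetry. apply real_of_conj. unfold param.
  rewrite Cmult_conj, Cpow_conj, Cconj_R. f_equal. f_equal.
  rewrite <- (re (RtoC eta)) at 2. now rewrite Cconj_R.
Qed.

Lemma param_inv_RtoC : near (fun t _ => forall eta : R, t = RtoC eta -> th t = RtoC (param_inv eta)).
Proof.
  eapply near_imp; [|exact thC]. intros t zz H eta ->. unfold param_inv. symmetry. apply real_of_conj.
  now rewrite Cconj_R in H.
Qed.

Lemma one_neq_0 : RtoC 1 <> 0.
Proof. intros H. apply (RtoC_inj 1 0) in H. lra. Qed.

Lemma e_neq_0 : near (fun t _ => e t <> 0).
Proof. apply (an_nonzero _ ae). rewrite e0. apply one_neq_0. Qed.

Lemma param_canonical : near (fun t _ => forall eta : R, t = RtoC eta -> RtoC (param_real eta) = canonical_parameter ft eta).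
Proof.
  assert (Hs : near (fun t _ => forall s, s ^ 2 = t -> s <> 0 ->
    / ((/ Clog (multiplier K s * Cconj (multiplier K (Cconj s))) - / Clog (multiplier K (- s) * Cconj (multiplier K (Cconj (- s))))) ^ 2)
    = s ^ 2 * e (s ^ 2) ^ 2)).
  { apply (near_sqrt (fun t s => s <> 0 -> _ = s ^ 2 * e (s ^ 2) ^ 2)).
    eapply near_imp; [|exact (near_comp1 _ (fun _ z => z) He an_snd eq_refl)].
    intros t z H _. exact H. }
  eapply near_imp; [|exact (near_and _ _ (family_multipliers ft K aK Eft) Hs)].
  intros t zz [F H] eta Et. unfold canonical_parameter.
  destruct (Req_dec_T eta 0) as [E0|N0].
  - subst eta. rewrite <- param_RtoC. apply param_0.
  - assert (S1 : csqrt eta ^ 2 = t) by (rewrite Et; apply csqrt_sq).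
    assert (S2 : (- csqrt eta) ^ 2 = t) by now rewrite opp_sq.
    assert (D : forall s, s ^ 2 = t ->
       C_derive (fun z => ft eta (ft eta z)) s = multiplier K s * Cconj (multiplier K (Cconj s))).
    { intros s Hs2. apply C_derive_of_cderiv.
      destruct (F eta Et s Hs2) as [_ D].
      assert (Hc : Cconj s ^ 2 = t) by (rewrite Et; apply conj_sq_real; congruence).
      unfold multiplier, slice. rewrite Hs2, Hc. exact D. }
    cbv zeta. rewrite (D _ S1), (D _ S2), (H _ S1 (csqrt_neq_0 eta N0)), S1, Et. symmetry. apply param_RtoC.
Qed.

Definition coord_map (t z : C) : C := e t * shear v0 v1 t z.
Definition coord_map_inv (t z : C) : C := Y (th t) (z / e (th t)).

Lemma an_coord_map : analytic0 coord_map.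
Proof. apply an_mult; [exact ae|now apply an_shear]. Qed.

Lemma an_e_th : analytic0 (fun t _ => e (th t)).
Proof. exact (an_comp1 e (fun t _ => th t) ae ath th0). Qed.

Lemma eth_neq_0 : near (fun t _ => e (th t) <> 0).
Proof. exact (near_comp1 _ (fun t _ => th t) e_neq_0 ath th0). Qed.

Lemma an_scaled : analytic0 (fun t z => z / e (th t)).
Proof. apply an_div; [apply an_snd|apply an_e_th|]. rewrite th0, e0. apply one_neq_0. Qed.

Lemma scaled_0 : 0 / e (th 0) = 0.
Proof. unfold Cdiv. ring. Qed.

Lemma an_coord_map_inv : analytic0 coord_map_inv.
Proof. exact (an_comp Y (fun t _ => th t) _ aY ath an_scaled th0 scaled_0). Qed.

Lemma shear_0 : shear v0 v1 0 0 = 0.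
Proof. unfold shear. ring. Qed.

Lemma coord_diffeo : germ_diffeo mix_analytic_germ (fun p => (param_real (fst p), coord (fst p) (snd p))) coord_inv.
Proof.
  assert (R1 : near (fun t z => coord_map_inv (param t) (coord_map t z) = z)).
  { eapply near_imp; [|exact (near_and _ _ YL (near_and _ _ thL e_neq_0))].
    intros t z (H1 & H2 & H3). unfold coord_map_inv, coord_map. unfold param. rewrite H2.
    replace (e t * shear v0 v1 t z / e t) with (shear v0 v1 t z) by (field; exact H3). exact H1. }
  assert (R2 : near (fun t z => coord_map (th t) (coord_map_inv t z) = z)).
  { eapply near_imp; [|exact (near_and _ _ (near_comp _ (fun t _ => th t) _ YR ath an_scaled th0 scaled_0) eth_neq_0)].
    intros t z (H1 & H2). cbv beta in H1. unfold coord_map, coord_map_inv. rewrite H1. field. exact H2. }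
  split; [|split; [|split]].
  - split; [|split].
    + simpl. unfold origin. f_equal.
      * apply (RtoC_inj (param_real 0) 0). rewrite <- param_RtoC. apply param_0.
      * unfold coord. rewrite shear_0. ring.
    + apply (mix_germ_of_an (fun t _ => param t)); [exact an_param|]. apply near_true. intros t z eta ->.
      simpl. symmetry. apply param_RtoC.
    + apply (mix_germ_of_an coord_map); [exact an_coord_map|]. apply near_true. intros t z eta ->. reflexivity.
  - split; [|split].
    + unfold coord_inv, origin. simpl. f_equal.
      * unfold param_inv. rewrite th0. reflexivity.
      * rewrite th0. replace (0 / e 0) with (RtoC 0) by (unfold Cdiv; ring). exact Y0.
    + apply (mix_germ_of_an (fun t _ => th t)); [exact ath|]. eapply near_imp; [|exact param_inv_RtoC].
      intros t z H eta Et. simpl. symmetry. now apply H.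
    + apply (mix_germ_of_an coord_map_inv); [exact an_coord_map_inv|]. apply near_true. intros t z eta ->. reflexivity.
  - assert (N : near (fun t z => forall eta : R, t = RtoC eta -> coord_inv (param_real eta, coord eta z) = (eta, z))).
    { eapply near_imp; [|exact (near_and _ _ R1 thL)]. intros t z (H1 & H2) eta ->.
      unfold coord_inv. simpl. rewrite <- param_RtoC. f_equal; [|exact H1].
      unfold param_inv. rewrite <- param_RtoC. unfold param. rewrite H2. reflexivity. }
    apply near_RC in N. eapply filter_imp; [|exact N]. intros [t z] H. exact H.
  - assert (N : near (fun t z => forall eta : R, t = RtoC eta ->
       (param_real (param_inv eta), coord (param_inv eta) (coord_map_inv t z)) = (eta, z))).
    { eapply near_imp; [|exact (near_and _ _ R2 (near_and _ _ param_inv_RtoC thR))].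
      intros t z (H1 & H2 & H3) eta Et. specialize (H2 eta Et). f_equal.
      - apply RtoC_inj. rewrite <- param_RtoC, <- H2, <- Et. exact H3.
      - unfold coord. rewrite <- H2. exact H1. }
    assert (N' : near (fun t z => forall eta : R, t = RtoC eta ->
       (param_real (param_inv eta), coord (param_inv eta) (coord_map_inv (RtoC eta) z)) = (eta, z))).
    { eapply near_imp; [|exact N]. intros t z H eta Et. rewrite <- (H eta Et), Et. reflexivity. }
    apply near_RC in N'. eapply filter_imp; [|exact N']. intros [t z] H. exact H.
Qed.

Lemma coord_maps_family : maps_family param_real coord coord_inv ft new_family.
Proof.
  unfold maps_family.
  assert (N : near (fun t z => forall eta : R, t = RtoC eta ->
     new_family (param_real eta) z = coord eta (ft eta (snd (coord_inv (param_real eta, z)))))).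
  { eapply near_imp; [|exact thL]. intros t z H eta ->. unfold new_family.
    replace (param_inv (param_real eta)) with eta; [reflexivity|].
    unfold param_inv. rewrite <- param_RtoC. unfold param. now rewrite H. }
  apply near_RC in N. exact N.
Qed.

Definition old_map (t w : C) : C := w + (w ^ 2 - t) * K t w.
(** The conjugated family as an analytic function of the canonical parameter
    and of conj z. The inverse of the coordinate appears with conjugate
    coefficients because f conjugates its argument. *)
Definition new_map (t w : C) : C := coord_map (th t) (old_map (th t) (star Y (th t) (w / e (th t)))).

Lemma an_old_map : analytic0 old_map.
Proof.
  unfold old_map. an_arith.
Qed.

Lemma star_0 : star Y 0 0 = 0.
Proof. unfold star. rewrite !Cconj_R, Y0. apply Cconj_R. Qed.

Lemma an_star_Y : analytic0 (fun t w => star Y (th t) (w / e (th t))).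
Proof. exact (an_comp (star Y) (fun t _ => th t) _ (an_star Y aY) ath an_scaled th0 scaled_0). Qed.

Lemma starY_0 : star Y (th 0) (0 / e (th 0)) = 0.
Proof. rewrite scaled_0, th0. apply star_0. Qed.

Lemma an_old_star_Y : analytic0 (fun t w => old_map (th t) (star Y (th t) (w / e (th t)))).
Proof. exact (an_comp old_map (fun t _ => th t) _ an_old_map ath an_star_Y th0 starY_0). Qed.

Lemma old_star_Y_0 : old_map (th 0) (star Y (th 0) (0 / e (th 0))) = 0.
Proof. rewrite starY_0, th0. unfold old_map. ring. Qed.

Lemma an_new_map : analytic0 new_map.
Proof. exact (an_comp coord_map (fun t _ => th t) _ an_coord_map ath an_old_star_Y th0 old_star_Y_0). Qed.

Lemma new_family_new_map : near (fun t w => forall eta : R, t = RtoC eta -> new_family eta (Cconj w) = new_map t w).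
Proof.
  eapply near_imp; [|exact (near_and _ _ (near_and _ _ param_inv_RtoC param_inv_RtoC)
     (near_comp _ (fun t _ => th t) _ Eft ath an_star_Y th0 starY_0))].
  intros t w [[H1 _] H2] eta Et. specialize (H1 eta Et). cbv beta in H2.
  specialize (H2 (param_inv eta) H1). unfold new_map, coord_map, old_map. rewrite <- H2.
  unfold new_family, coord, coord_inv. simpl. rewrite <- Et, <- !H1. do 2 f_equal.
  unfold star. rewrite Cconj_conj. rewrite !H1, Cconj_R. do 2 f_equal.
  unfold Cdiv. rewrite Cmult_conj, Cinv_conj_total. do 2 f_equal.
  rewrite <- (re (RtoC (param_inv eta))) at 1. now rewrite Cconj_R.
Qed.

(** If S^2 is the canonical parameter then s = S / e is a square root of the
    given parameter, and s is fixed by the inverse shear, by the given map and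
    by the shear. *)
Lemma new_map_fixed : near (fun t z => forall eta : R, t = RtoC eta -> forall s, s ^ 2 = t -> new_map t s = s).
Proof.
  assert (Q : near (fun t z => z ^ 2 = t -> forall eta : R, t = RtoC eta -> new_map t z = z)).
  { eapply near_imp; [|exact (near_and _ _ (near_and _ _ param_inv_RtoC thR)
       (near_and _ _ eth_neq_0 (near_comp _ (fun t _ => th t) _ (near_conj _ YL) ath an_scaled th0 scaled_0)))].
    intros t S [[H1 H2] [H3 H4]] HS eta Et. cbv beta in H4. specialize (H1 eta Et).
    set (s := S / e (th t)) in *.
    assert (Hs : s ^ 2 = th t).
    { unfold s. replace ((S / e (th t)) ^ 2) with (S ^ 2 / e (th t) ^ 2) by (field; exact H3).
      rewrite HS, <- H2 at 1. field. exact H3. }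
    assert (Es : star Y (th t) s = s).
    { unfold star. rewrite shear_fixed in H4.
      - rewrite H4. apply Cconj_conj.
      - now rewrite <- Cpow_conj, Hs. }
    unfold new_map. fold s. rewrite Es. unfold old_map. rewrite Hs.
    replace (s + (th t - th t) * K (th t) s) with s by ring.
    unfold coord_map. rewrite shear_fixed by exact Hs. unfold s. field. exact H3. }
  apply near_sqrt in Q. eapply near_imp; [|exact Q]. cbv beta. intros t zz H eta Et s Hs.
  now apply (H s Hs eta).
Qed.

Section Prepared.
Variables (Kh Q : C -> C -> C) (B0 B1 : C -> C).
Hypothesis aKh : analytic0 Kh.
Hypothesis aB0 : analytic0 (fun t _ => B0 t).
Hypothesis aB1 : analytic0 (fun t _ => B1 t).
Hypothesis aQ : analytic0 Q.
Hypothesis EPhi : near (fun t z => forall eta : R, t = RtoC eta -> new_map t z = z + (z ^ 2 - t) * Kh t z).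
Hypothesis EKh : near (fun t z => Kh t z = B0 t + z * B1 t + (z ^ 2 - t) * Q t z).

Lemma new_map_semiconj : near (fun t x => new_map (param t) (e t * star (shear v0 v1) t x) = coord_map t (old_map t x)).
Proof.
  eapply near_imp; [|exact (near_and _ _ (near_and _ _ thL e_neq_0) (near_conj _ YL))].
  intros t x [[H1 H2] H3]. unfold new_map, param. rewrite H1. do 2 f_equal.
  replace (e t * star (shear v0 v1) t x / e t) with (star (shear v0 v1) t x) by (field; exact H2).
  unfold star. rewrite Cconj_conj, H3. apply Cconj_conj.
Qed.

Lemma cderiv_new_map : near (fun t z => z ^ 2 = t -> forall eta : R, t = RtoC eta ->
  cderiv (new_map t) z (1 + 2 * z * (B0 t + z * B1 t))).
Proof.
  eapply near_imp; [|exact (near_and _ _ (near_and _ _ (near_open _ EPhi) EKh) (cderiv_invariant Kh aKh))].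
  intros t z [[(d & Hd & H1) H2] H3] Hz eta Et.
  apply (cderiv_ext_loc (fun w => w + (w ^ 2 - t) * Kh t w) _ _ _ d Hd).
  - intros w Hw. symmetry. now apply (H1 w Hw eta).
  - replace (B0 t + z * B1 t) with (Kh t z); [now apply H3|]. rewrite H2, Hz. ring.
Qed.

(** Differentiating the semiconjugacy at s gives l_new e conj(u(conj s)) = e
    u(s) l(s), and l(s) is the square of conj(u(conj s)). *)
Lemma multiplier_relation : near (fun t z => z ^ 2 = t -> forall eta : R, t = RtoC eta ->
  1 + 2 * (e t * z) * (B0 (param t) + (e t * z) * B1 (param t)) = 1 + z * (h0 t + z * h1 t)).
Proof.
  assert (aS : analytic0 (fun t z => e t * z)) by (apply an_mult; [exact ae|apply an_snd]).
  assert (S0 : e 0 * 0 = 0) by ring.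
  assert (aell : analytic0 (fun s _ => multiplier K s)).
  { unfold multiplier. apply an_plus; [apply an_const|]. apply an_mult; [apply an_mult; [apply an_const|apply an_fst]|].
    now apply an_slice. }
  assert (ell0 : multiplier K 0 <> 0).
  { unfold multiplier. replace (1 + 2 * 0 * slice K 0) with (RtoC 1) by ring. apply one_neq_0. }
  eapply near_imp; [|exact (near_and _ _
    (near_and _ _ (near_open _ new_map_semiconj) (near_comp _ (fun t _ => param t) (fun t z => e t * z) cderiv_new_map an_param aS param_0 S0))
    (near_and _ _ (near_and _ _ (cderiv_invariant K aK) e_neq_0)
      (near_and _ _ (near_comp1 _ (fun _ z => z) (an_nonzero _ aell ell0) an_snd eq_refl)
        (near_and _ _ (near_comp1 _ (fun _ z => z) Hv an_snd eq_refl)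
           (near_conj _ (near_comp1 _ (fun _ z => z) Hv an_snd eq_refl))))))].
  intros t z [[(d & Hd & SC) PD] [[FD Ne] [Nl [[V1 V2] [V3 _]]]]] Hz eta Et. cbv beta in *.
  assert (Ct : Cconj t = t) by (rewrite Et; apply Cconj_R).
  assert (Hzc : Cconj z ^ 2 = t) by (now rewrite <- Cpow_conj, Hz).
  set (u := 1 + 2 * z * angle v0 v1 z) in *.
  set (uc := 1 + 2 * Cconj z * angle v0 v1 (Cconj z)) in *.
  rewrite Cconj_conj in V3.
  assert (V4 : Cconj uc ^ 2 = multiplier K z) by (rewrite <- Cpow_conj, V3; apply Cconj_conj).
  assert (Nu : Cconj uc <> 0) by (intros E; apply Nl; rewrite <- V4, E; ring).
  (* The two sides of the semiconjugacy are differentiated at z and compared. *)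
  assert (DN : cderiv (fun x => e t * star (shear v0 v1) t x) z (e t * Cconj uc)).
  { apply cderiv_scal.
    assert (D := cderiv_conj (shear v0 v1 (Cconj t)) z _
       (cderiv_shear v0 v1 (Cconj t) (Cconj z) ltac:(now rewrite Ct))).
    unfold star. unfold uc, angle. rewrite Hzc. rewrite Ct in D |- *. exact D. }
  assert (Ns : e t * star (shear v0 v1) t z = e t * z).
  { f_equal. unfold star. rewrite shear_fixed; [apply Cconj_conj|]. now rewrite Ct. }
  set (S := e t * z) in *.
  assert (HS : S ^ 2 = param t) by (unfold S, param; rewrite <- Hz; ring).
  assert (HE : param t = RtoC (param_real eta)) by (rewrite Et; apply param_RtoC).
  assert (DP := PD HS (param_real eta) HE).
  assert (D1 : cderiv (fun x => new_map (param t) (e t * star (shear v0 v1) t x)) z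
     ((1 + 2 * S * (B0 (param t) + S * B1 (param t))) * (e t * Cconj uc))).
  { apply (cderiv_comp (new_map (param t)) (fun x => e t * star (shear v0 v1) t x)); [|exact DN].
    rewrite Ns. exact DP. }
  assert (Fz : old_map t z = z) by (unfold old_map; rewrite Hz; ring).
  assert (D2 : cderiv (fun x => coord_map t (old_map t x)) z ((e t * u) * multiplier K z)).
  { apply (cderiv_comp (coord_map t) (old_map t)).
    - rewrite Fz. apply cderiv_scal. unfold u, angle. rewrite Hz. now apply cderiv_shear.
    - unfold multiplier, slice. rewrite Hz. now apply FD. }
  assert (D3 := cderiv_ext_loc _ _ _ _ d Hd SC D1).
  assert (E := cderiv_unique _ _ _ _ D3 D2).
  rewrite <- V4 in E. rewrite Hz in V2.
  rewrite <- V2.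
  set (T := 1 + 2 * S * (B0 (param t) + S * B1 (param t))) in *.
  replace T with ((T * (e t * Cconj uc)) * / (e t * Cconj uc)) by (field; split; assumption).
  rewrite E. field. split; assumption.
Qed.

(** The relation of the multipliers at the two square roots separates into its
    even and odd parts. *)
Lemma B_relation : near (fun t _ => forall eta : R, t = RtoC eta -> eta <> 0%R ->
  2 * e (th t) * B0 t = h0 (th t) /\ 2 * e (th t) ^ 2 * B1 t = h1 (th t)).
Proof.
  assert (N : near (fun t _ => forall eta : R, t = RtoC eta -> eta <> 0%R ->
    2 * e t * B0 (param t) = h0 t /\ 2 * e t ^ 2 * B1 (param t) = h1 t)).
  { eapply near_imp; [|exact (near_sqrt _ multiplier_relation)]. cbv beta.
    intros t zz H eta Et Hn.
    assert (S1 : csqrt eta ^ 2 = t) by (rewrite Et; apply csqrt_sq).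
    assert (S2 : (- csqrt eta) ^ 2 = t) by now rewrite opp_sq.
    assert (Ns := csqrt_neq_0 eta Hn).
    assert (C1 := H _ S1 eta Et). assert (C2 := H _ S2 eta Et).
    set (s := csqrt eta) in *.
    assert (cancel : forall x a b : C, x <> 0 -> 1 + x * a = 1 + x * b -> a = b).
    { intros x a b Nx E. replace a with (/ x * ((1 + x * a) - 1)) by (field; exact Nx).
      rewrite E. field. exact Nx. }
    apply (sq_split s); [exact Ns| |].
    - apply (cancel s); [exact Ns|]. rewrite <- C1. ring.
    - assert (Ns' : - s <> 0) by (intros E; apply Ns; replace s with (- - s) by ring; rewrite E; ring).
      apply (cancel (- s)); [exact Ns'|]. rewrite <- C2. ring. }
  eapply near_imp; [|exact (near_and _ _ (near_comp1 _ (fun t _ => th t) N ath th0) (near_and _ _ param_inv_RtoC thR))].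
  intros t zz [H1 [H2 H3]] eta Et Hn. cbv beta in H1.
  specialize (H2 eta Et).
  assert (Hn' : param_inv eta <> 0%R).
  { intros E. rewrite E in H2. rewrite H2 in H3. apply Hn. apply RtoC_inj. rewrite <- Et, <- H3. ring. }
  specialize (H1 (param_inv eta) H2 Hn'). unfold param in H1. rewrite H3 in H1. exact H1.
Qed.

(** Continuity is needed here: at the parameter zero the multipliers are 1
    whatever B_0 is. *)
Lemma B0_0 : B0 0 = 1 / 2.
Proof.
  assert (E : 2 * e (th 0) * B0 0 - h0 (th 0) = 0).
  { apply (value_at_0 (fun t => 2 * e (th t) * B0 t - h0 (th t))).
    - apply an_minus.
      + apply an_mult; [apply an_mult; [apply an_const|exact an_e_th]|exact aB0].
      + exact (an_comp1 h0 (fun t _ => th t) ah0 ath th0).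
    - eapply near_imp; [|exact B_relation]. intros t zz H eta Et Hn.
      rewrite (proj1 (H eta Et Hn)). ring. }
  rewrite th0, e0, h00 in E.
  replace (B0 0) with (/ 2 * ((2 * 1 * B0 0 - 1) + 1)) by field. rewrite E. field.
Qed.

(** The difference with the conjugate is analytic and vanishes at real nonzero
    parameters. *)
Lemma real_at_0 (b : C -> C) : analytic0 (fun t _ => b t) ->
  near (fun t _ => forall eta : R, t = RtoC eta -> eta <> 0%R -> Cconj (b t) = b t) ->
  near (fun t _ => forall eta : R, t = RtoC eta -> Cconj (b t) = b t).
Proof.
  intros ab H.
  assert (Z : b 0 - Cconj (b (Cconj 0)) = 0).
  { apply (value_at_0 (fun t => b t - Cconj (b (Cconj t)))).
    - apply an_minus; [exact ab|now apply an_star1].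
    - eapply near_imp; [|exact H]. intros t zz E eta Et Hn.
      assert (Ct : Cconj t = t) by (rewrite Et; apply Cconj_R). rewrite Ct, (E eta Et Hn). ring. }
  eapply near_imp; [|exact H]. intros t zz E eta Et.
  destruct (Req_dec eta 0) as [E0|Hn]; [|now apply (E eta)].
  subst eta. rewrite Et. rewrite Cconj_R in Z. apply Csub_eq in Z. now symmetry.
Qed.

Lemma B_real : near (fun t _ => forall eta : R, t = RtoC eta ->
  Cconj (B0 t) = B0 t /\ Cconj (B1 t) = B1 t).
Proof.
  assert (aux : forall b h : C -> C, forall n, analytic0 (fun t _ => b t) -> conj_invariant h ->
    near (fun t _ => forall eta : R, t = RtoC eta -> eta <> 0%R -> 2 * e (th t) ^ n * b t = h (th t)) ->
    near (fun t _ => forall eta : R, t = RtoC eta -> Cconj (b t) = b t)).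
  { intros b h n ab rh H. apply (real_at_0 b ab).
    eapply near_imp; [|exact (near_and _ _ H (near_and _ _ param_inv_RtoC eth_neq_0))].
    intros t zz [H1 [H2 H3]] eta Et Hn. specialize (H1 eta Et Hn). specialize (H2 eta Et).
    assert (Cth : Cconj (th t) = th t) by (rewrite H2; apply Cconj_R).
    assert (Ce : Cconj (e (th t)) = e (th t)) by (rewrite <- Cth at 1; apply re).
    assert (Ch : Cconj (h (th t)) = h (th t)) by (rewrite <- Cth at 1; apply rh).
    assert (Nn : e (th t) ^ n <> 0) by now apply Cpow_nz.
    assert (Eb : b t = / (2 * e (th t) ^ n) * h (th t)) by (rewrite <- H1; field; exact Nn).
    rewrite Eb, Cmult_conj, Cinv_conj_total, Cmult_conj, Cpow_conj, Ce, Ch, Cconj_R. reflexivity. }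
  assert (R0 : near (fun t _ => forall eta : R, t = RtoC eta -> Cconj (B0 t) = B0 t)).
  { apply (aux B0 h0 1%nat aB0 rh0). eapply near_imp; [|exact B_relation].
    intros t zz H eta Et Hn. rewrite <- (proj1 (H eta Et Hn)). ring. }
  assert (R1 : near (fun t _ => forall eta : R, t = RtoC eta -> Cconj (B1 t) = B1 t)).
  { apply (aux B1 h1 2%nat aB1 rh1). eapply near_imp; [|exact B_relation].
    intros t zz H eta Et Hn. exact (proj2 (H eta Et Hn)). }
  eapply near_imp; [|exact (near_and _ _ R0 R1)]. intros t zz [H1 H2] eta Et. split; eauto.
Qed.

Lemma new_family_expansion : near (fun t w => forall eta : R, t = RtoC eta ->
  new_family eta (Cconj w) = w + (w ^ 2 - t) * Kh t w).
Proof.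
  eapply near_imp; [|exact (near_and _ _ new_family_new_map EPhi)]. intros t w [H1 H2] eta Et.
  now rewrite (H1 eta Et), (H2 eta Et).
Qed.

Lemma new_family_prepared : prepared_form new_family (fun t => B0 (RtoC t)) (fun t => B1 (RtoC t)) (fun t w => Q (RtoC t) w).
Proof.
  split; [now apply analytic_germ_of_an|]. split; [now apply analytic_germ_of_an|]. split.
  - apply (mix_germ_of_an Q); [exact aQ|]. apply near_true. intros t z eta ->. reflexivity.
  - assert (N : near (fun t z => forall eta : R, t = RtoC eta ->
      new_family eta z = Cconj z + (Cconj z ^ 2 - RtoC eta) *
        (B0 (RtoC eta) + B1 (RtoC eta) * Cconj z + (Cconj z ^ 2 - RtoC eta) * Q (RtoC eta) (Cconj z)))).
    { eapply near_imp; [|exact (near_conj _ (near_and _ _ new_family_expansion EKh))].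
      intros t z [H1 H2] eta Et. subst t. rewrite Cconj_R in H1, H2. specialize (H1 eta eq_refl).
      rewrite Cconj_conj in H1. rewrite H1, H2. ring. }
    apply near_RC in N. exact N.
Qed.

Lemma new_family_multipliers : near (fun t _ => forall eta : R, t = RtoC eta -> forall s, s ^ 2 = t ->
  Cconj (B0 t) = B0 t /\ Cconj (B1 t) = B1 t /\
  dzbar (new_family eta) s = 1 + 2 * Cconj s * (B0 t + Cconj s * B1 t) /\
  dz (fun z => new_family eta (new_family eta z)) s = (1 + 2 * s * (B0 t + s * B1 t)) ^ 2).
Proof.
  assert (N : near (fun t z => z ^ 2 = t -> Kh t z = B0 t + z * B1 t)).
  { eapply near_imp; [|exact EKh]. intros t z H Hz. rewrite H, Hz. ring. }
  eapply near_imp; [|exact (near_and _ _ (near_and _ _ (near_sqrt _ N) B_real) (family_multipliers new_family Kh aKh new_family_expansion))].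
  intros t zz [[H1 H2] H3] eta Et s Hs. cbv beta in *.
  destruct (H2 eta Et) as [R0 R1]. destruct (H3 eta Et s Hs) as [D1 D2].
  assert (Hc : Cconj s ^ 2 = t) by (rewrite Et; apply conj_sq_real; congruence).
  rewrite (H1 _ Hc) in D1, D2. rewrite (H1 _ Hs) in D2.
  split; [exact R0|]. split; [exact R1|]. split; [exact D1|].
  rewrite (dz_of_cderiv _ _ _ D2).
  rewrite !Cplus_conj, !Cmult_conj, Cplus_conj, Cmult_conj, !Cconj_conj, !Cconj_R, R0, R1. ring.
Qed.

Lemma new_family_tau : locally 0%R (fun t : R =>
  let tau_p := dzbar (new_family t) (csqrt t) in
  let tau_m := dzbar (new_family t) (- csqrt t) in
  ((0 < t)%R -> Im tau_p = 0%R /\ Im tau_m = 0%R) /\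
  ((t < 0)%R -> tau_p = Cconj tau_m /\ tau_m = Cconj tau_p) /\
  (t = 0%R -> tau_p = 1 /\ tau_m = 1)).
Proof.
  apply near_R0. eapply near_imp; [|exact new_family_multipliers]. cbv beta zeta.
  intros t zz H eta Et.
  assert (S1 : csqrt eta ^ 2 = t) by (rewrite Et; apply csqrt_sq).
  assert (S2 : (- csqrt eta) ^ 2 = t) by now rewrite opp_sq.
  destruct (H eta Et _ S1) as (R0 & R1 & Dp & _). destruct (H eta Et _ S2) as (_ & _ & Dm & _).
  rewrite Dp, Dm. destruct (csqrt_conj eta) as [Cp Cm].
  assert (Im0 : forall z : C, Cconj z = z -> Im z = 0%R).
  { intros z E. apply (f_equal snd) in E. simpl in E. unfold Im. lra. }
  split; [|split].
  - intros Hp. rewrite Copp_conj, Cp by lra.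
    split; apply Im0; rewrite !Cplus_conj, !Cmult_conj, Cplus_conj, Cmult_conj, ?Copp_conj, !Cconj_R, Cp, R0, R1 by lra; reflexivity.
  - intros Hm. rewrite !Copp_conj, Cm by lra.
    rewrite !Cplus_conj, !Cmult_conj, !Cplus_conj, !Cmult_conj, !Copp_conj, !Cconj_R, Cm, R0, R1 by lra.
    split; ring.
  - intros E0. subst eta.
    assert (Z : csqrt 0 = 0).
    { unfold csqrt. destruct (Rle_dec 0 0) as [_|n]; [|lra]. now rewrite sqrt_0. }
    rewrite Z, Copp_conj, Cconj_R. split; ring.
Qed.

Lemma new_family_lambda : locally 0%R (fun t : R =>
  let tau_p := dzbar (new_family t) (csqrt t) in
  let tau_m := dzbar (new_family t) (- csqrt t) in
  let g := fun z => new_family t (new_family t z) in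
  dz g (csqrt t) = Cconj (tau_p ^ 2) /\ dz g (- csqrt t) = Cconj (tau_m ^ 2)).
Proof.
  apply near_R0. eapply near_imp; [|exact new_family_multipliers]. cbv beta zeta.
  intros t zz H eta Et.
  assert (S1 : csqrt eta ^ 2 = t) by (rewrite Et; apply csqrt_sq).
  assert (S2 : (- csqrt eta) ^ 2 = t) by now rewrite opp_sq.
  destruct (H eta Et _ S1) as (R0 & R1 & Dp & Gp). destruct (H eta Et _ S2) as (_ & _ & Dm & Gm).
  rewrite Dp, Dm, Gp, Gm.
  rewrite !Cpow_conj, !Cplus_conj, !Cmult_conj, !Cplus_conj, !Cmult_conj, !Cconj_conj, !Cconj_R, R0, R1.
  split; reflexivity.
Qed.
End Prepared.
End Main.

(** * The normal form *)

Theorem theorem3p3p3 :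
  forall (f0 : C -> C) (a : nat -> R -> C) (ft : R -> C -> C),
    parabolic_codim_one f0 ->
    unfolding f0 a ft ->
    generic a ->
    fixed_points_sq ft ->
    exists (eps : R -> R) (m : R -> C -> C) (G : R * C -> R * C)
           (f : R -> C -> C) (B0 B1 : R -> C) (Q : R -> C -> C),
      locally 0%R (fun eta => RtoC (eps eta) = canonical_parameter ft eta) /\
      germ_diffeo mix_analytic_germ
        (fun p => (eps (fst p), m (fst p) (snd p))) G /\
      maps_family eps m G ft f /\
      prepared_form f B0 B1 Q /\
      (B0 0%R = 1 / 2 /\
       locally 0%R (fun e => Im (B0 e) = 0%R /\ Im (B1 e) = 0%R)) /\
      locally 0%R (fun e : R =>
        let tau_p := dzbar (f e) (csqrt e) in
        let tau_m := dzbar (f e) (- csqrt e) in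
        ((0 < e)%R -> Im tau_p = 0%R /\ Im tau_m = 0%R) /\
        ((e < 0)%R -> tau_p = Cconj tau_m /\ tau_m = Cconj tau_p) /\
        (e = 0%R -> tau_p = 1 /\ tau_m = 1)) /\
      locally 0%R (fun e : R =>
        let tau_p := dzbar (f e) (csqrt e) in
        let tau_m := dzbar (f e) (- csqrt e) in
        let g := fun z => f e (f e z) in
        dz g (csqrt e) = Cconj (tau_p ^ 2) /\
        dz g (- csqrt e) = Cconj (tau_m ^ 2)).
Proof.
  intros f0 a ft H1 H2 _ H4.
  destruct (family_normal_form f0 a ft H1 H2 H4) as (K & aK & K0 & Eft).
  destruct (canonical_data K aK K0) as (e & ae & re & e0 & He).
  destruct (angle_data K aK K0) as (v0 & v1 & h0 & h1 & av0 & av1 & ah0 & ah1 & rh0 & rh1 & h00 & Hv).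
  destruct (parameter_inverse e ae re e0) as (th & ath & th0 & thR & thL & thC).
  destruct (shear_inverse v0 v1 av0 av1) as (Y & aY & Y0 & YR & YL).
  assert (aP : analytic0 (new_map K e v0 v1 th Y)) by (apply an_new_map; assumption).
  assert (Fix : near (fun t z => forall eta : R, t = RtoC eta -> forall s, s ^ 2 = t -> new_map K e v0 v1 th Y t s = s))
    by (apply new_map_fixed; assumption).
  destruct (fixed_curve _ aP Fix) as (Kh & aKh & EPhi).
  destruct (division Kh aKh) as (B0 & B1 & Q & aB0 & aB1 & aQ & EKh).
  exists (param_real e), (coord e v0 v1), (coord_inv e th Y), (new_family ft e v0 v1 th Y),
    (fun t => B0 (RtoC t)), (fun t => B1 (RtoC t)), (fun t w => Q (RtoC t) w).
  split; [apply near_R0; apply (param_canonical ft K); assumption|].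
  split; [eapply coord_diffeo; eassumption|].
  split; [eapply coord_maps_family; eassumption|].
  split; [apply (new_family_prepared ft K) with (Kh := Kh); assumption|].
  split; [split|split].
  - apply (B0_0 K aK e ae re e0 v0 v1 h0 h1 ah0 h00 Hv th ath th0 thR thL thC Y YL Kh Q B0 B1 aKh aB0 EPhi EKh).
  - apply near_R0. eapply near_imp; [|exact (B_real K aK e ae re e0 v0 v1 h0 h1 rh0 rh1 Hv th ath th0 thR thL thC Y YL Kh Q B0 B1 aKh aB0 aB1 EPhi EKh)].
    intros t zz H eta Et. destruct (H eta Et) as [R0 R1]. subst t.
    apply (f_equal snd) in R0, R1. simpl in R0, R1. unfold Im. lra.
  - apply (new_family_tau ft K) with (h0 := h0) (h1 := h1) (Kh := Kh) (Q := Q) (B0 := B0) (B1 := B1); assumption.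
  - apply (new_family_lambda ft K) with (h0 := h0) (h1 := h1) (Kh := Kh) (Q := Q) (B0 := B0) (B1 := B1); assumption.
Qed.
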